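(* Let $Y$ be one of $W$, $(W,H)$, $(W,H,K)$, where $W$ is a standard $d$-dimensional Brownian motion and $H$, $K$ are its space-time and space-time-time Lévy areas; for $r\ge t_0$ write $Y_r:=Y_{t_0,r}$, i.e. $W_{t_0,r}$, $(W_{t_0,r},H_{t_0,r})$ or $(W_{t_0,r},H_{t_0,r},K_{t_0,r})$ respectively. Let $0\le t_0<t_1$, $L,d\in\mathbb{N}$, $\varepsilon=(t_1-t_0)2^{-L}$. Let $(y_r)_{r\in[t_0,t_1]}$ be the path generated by the Virtual Brownian Tree on $[t_0,t_1]$ with tolerance $\varepsilon$ in dimension $d$, in the mode corresponding to the choice of $Y$ (''none'' for $W$, ''space-time'' for $(W,H)$, ''space-time-time'' for $(W,H,K)$), with a uniformly random seed that is fixed throughout (construction and idealised randomness model as given in the context). Let $V=\{t_0+(t_1-t_0)k2^{-L}: k\in\{0,1,\dots,2^L\}\}$ and let $S=\{r_1,\dots,r_N\}\subset[t_0,t_1]$ be a set of query times such that for all $1\le n<N$ we have $r_n\le r_{n+1}$ and $|V\cap[r_n,r_{n+1}]|\ge 1$. Then the joint distribution of $y$ at the points of $S$ equals that of $Y$ at the same points: $$(y_r)_{r\in S}\overset{d}{=}(Y_r)_{r\in S}.$$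
   Context: **Lévy areas.** For a Brownian motion $W$ in $\mathbb{R}^d$ and $0\le s<t$ put $W_{s,t}=W_t-W_s$, $B_r^{s,t}=W_{s,r}-\frac{r-s}{t-s}W_{s,t}$ for $r\in[s,t]$, $$H_{s,t}=\frac1{t-s}\int_s^t B_r^{s,t}\,dr,\qquad K_{s,t}=\frac1{(t-s)^2}\int_s^t B_r^{s,t}\Big(\frac{t+s}{2}-r\Big)dr,$$ with $H_{s,s}=K_{s,s}=0$. Rescaled versions: $\bar H_{s,t}=(t-s)H_{s,t}$, $\bar K_{s,t}=(t-s)^2K_{s,t}$. **Randomness model.** The pseudo-random generator is idealised: with a uniformly random seed, all Gaussian variables attached below to the root, to the internal nodes and to the leaves of the binary tree are exactly Gaussian and mutually independent, and each is the same in every evaluation (it depends only on the seed and the node, not on the query time). $I_d$ is the identity matrix; all formulas below are vector-valued in $\mathbb{R}^d$, applied coordinatewise. **Virtual Brownian Tree.** Work on the normalised interval $[0,1]$. The construction produces $\bar Y_v=(W_v,\bar H_v,\bar K_v)$ at dyadic times $v=k2^{-L}$ and $\bar Y_{s,u}=(W_{s,u},\bar H_{s,u},\bar K_{s,u})$ for dyadic tree intervals $[s,u]$ (in mode ''space-time'' drop $K$; in mode ''none'' drop $H$ and $K$). In this construction these symbols denote generated quantities. *Root.* $\bar Y_0=0$; $\bar Y_1=\bar Y_{0,1}=(W_1,H_1,K_1)$ with independent $W_1\sim N(0,I_d)$, $H_1\sim N(0,\frac1{12}I_d)$, $K_1\sim N(0,\frac1{720}I_d)$. *Midpoint step.* For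 each tree interval $[s,u]=[k2^{-l},(k+1)2^{-l}]$, $0\le l<L$, put $h=u-s$, $t=\frac{s+u}{2}$. - Mode ''none'': $W_t=\frac{W_s+W_u}{2}+\frac12\sqrt h\,G$, with $G\sim N(0,I_d)$ attached to the node. - Mode ''space-time'': with independent $Z\sim N(0,\frac h{16}I_d)$, $M\sim N(0,\frac h{12}I_d)$ attached to the node, $W_{s,t}=\frac12W_{s,u}+\frac{3}{2h}\bar H_{s,u}+Z$, $W_{t,u}=\frac12W_{s,u}-\frac3{2h}\bar H_{s,u}-Z$, $\bar H_{s,t}=\frac18\bar H_{s,u}-\frac h4Z+\frac h4M$, $\bar H_{t,u}=\frac18\bar H_{s,u}-\frac h4Z-\frac h4M$. - Mode ''space-time-time'': with independent $Z\sim N(0,\frac h{16}I_d)$, $X_1\sim N(0,\frac h{768}I_d)$, $X_2\sim N(0,\frac h{2880}I_d)$ attached to the node, $W_{s,t},W_{t,u}$ are as in the previous mode, and $\bar H_{s,t}=\frac18\bar H_{s,u}+\frac{15}{8h}\bar K_{s,u}-\frac h4Z+\frac h2X_1$, $\bar H_{t,u}=\frac18\bar H_{s,u}-\frac{15}{8h}\bar K_{s,u}-\frac h4Z-\frac h2X_1$, $\bar K_{s,t}=\frac1{32}\bar K_{s,u}-\frac{h^2}8X_1+\frac{h^2}4X_2$, $\bar K_{t,u}=\frac1{32}\bar K_{s,u}-\frac{h^2}8X_1-\frac{h^2}4X_2$. In the last two modes, the values at $t$ are obtained by the concatenation rule (C) from $\bar Y_s$ and $\bar Y_{s,t}$, where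 for $s\le r$ rule (C) is $$W_r=W_s+W_{s,r},\quad \bar H_r=\bar H_s+\bar H_{s,r}+\tfrac12(rW_s-sW_r),$$ $$\bar K_r=\bar K_s+\bar K_{s,r}+\tfrac{r-s}{2}\bar H_s-\tfrac s2\bar H_{s,r}+\tfrac{r-2s}{12}(rW_s-sW_r).$$ *Final interpolation.* Given a normalised query time $\hat r\in[0,1]$, let $[s,u]$ be the leaf interval $[k2^{-L},(k+1)2^{-L}]$ with $s<\hat r\le u$ (the first leaf if $\hat r=0$), and put $h=u-s$, $p=\hat r-s$, $q=u-\hat r$. - Mode ''none'': $W_{\hat r}=W_s+\frac ph(W_u-W_s)+\sqrt{pq/h}\,G$ with $G\sim N(0,I_d)$ attached to the leaf. - Mode ''space-time'': with independent $X_1,X_2\sim N(0,I_d)$ attached to the leaf, $\delta=\sqrt{p^3+q^3}$, $a=\frac{p^{7/2}q^{1/2}}{2h\delta}$, $b=\frac{p^{1/2}q^{7/2}}{2h\delta}$, $c=\frac{\sqrt3\,p^{3/2}q^{3/2}}{6\delta}$, set $W_{s,\hat r}=\frac phW_{s,u}+\frac{6pq}{h^3}\bar H_{s,u}+\frac{2(a+b)}{h}X_1$, $\bar H_{s,\hat r}=\frac{p^3}{h^3}\bar H_{s,u}-aX_1+cX_2$, and apply (C). - Mode ''space-time-time'': let $H_{s,u}=\bar H_{s,u}/h$, $K_{s,u}=\bar K_{s,u}/h^2$, and let $(\hat W,\hat H,\hat K)$ be the Gaussian triple obtained, independently for each of the $d$ coordinates, by applying a fixed matrix square root $A_r$ ($A_rA_r^T=\Sigma_r$)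 to a standard Gaussian vector in $\mathbb{R}^3$ attached to the leaf, where $\Sigma_r$ is the symmetric $3\times3$ matrix with entries $\Sigma^{WW}=\frac{pq((p-q)^4+4p^2q^2)}{h^5}$, $\Sigma^{WH}=-\frac{p^3q(p^2-3pq+6q^2)}{2h^5}$, $\Sigma^{WK}=\frac{p^4q(p-q)}{12h^5}$, $\Sigma^{HH}=\frac p{12}\big(1-\frac{p^3(p^2+2pq+16q^2)}{h^5}\big)$, $\Sigma^{HK}=-\frac{p^5q}{24h^5}$, $\Sigma^{KK}=\frac p{720}\big(1-\frac{p^5}{h^5}\big)$. Set $W_{s,\hat r}=\frac phW_{s,u}+\frac{6pq}{h^2}H_{s,u}+\frac{60pq(q-p)}{h^3}K_{s,u}+\hat W$, $\bar H_{s,\hat r}=p\big(\frac{p^2}{h^2}H_{s,u}+\frac{30p^2q}{h^3}K_{s,u}+\hat H\big)$, $\bar K_{s,\hat r}=p^2\big(\frac{p^3}{h^3}K_{s,u}+\hat K\big)$, and apply (C). *Output.* For $r\in[t_0,t_1]$ and $\hat r=\frac{r-t_0}{t_1-t_0}$, the output is $y_r=\sqrt{t_1-t_0}\,\big(W_{\hat r},\ \hat r^{-1}\bar H_{\hat r},\ \hat r^{-2}\bar K_{\hat r}\big)$ (with the components not present in the chosen mode dropped, and $y_{t_0}=0$). *)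

(* Defs.v *)
From HB Require Import structures.
From mathcomp Require Import all_boot all_order all_algebra.
From mathcomp Require Import all_classical all_reals all_analysis.

Set Implicit Arguments.
Unset Strict Implicit.
Unset Printing Implicit Defensive.

Import Order.TTheory GRing.Theory Num.Theory.
Import numFieldNormedType.Exports.

Local Open Scope classical_set_scope.
Local Open Scope ring_scope.

(* Product rule over all finite subfamilies of distinct indices taken in [D]. *)
Definition mutually_independent (R : realType)
    (dO : measure_display) (O : measurableType dO) (P : probability O R)
    (dT : measure_display) (T : measurableType dT)
    (I : Type) (D : set I) (X : I -> O -> T) : Prop :=
  forall (n : nat) (f : 'I_n -> I), injective f -> (forall i, D (f i)) ->
  forall B : 'I_n -> set T, (forall i, measurable (B i)) ->
    P (\bigcap_(i in [set: 'I_n]) (X (f i) @^-1` B i))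
    = (\prod_(i < n) P (X (f i) @^-1` B i))%E.

(* [X ~ N(0, v I_d)] for a variance [v > 0]; [normal_prob] takes the standard
   deviation, and is not a Dirac mass for the standard deviation [0]. *)
Definition isotropic_normal (R : realType)
    (dO : measure_display) (O : measurableType dO) (P : probability O R)
    (d : nat) (X : O -> d.-tuple R) (v : R) : Prop :=
  [/\ measurable_fun [set: O] X,
      mutually_independent P [set: 'I_d] (fun j w => tnth (X w) j)
    & forall (j : 'I_d) (B : set R), measurable B ->
        P ((fun w => tnth (X w) j) @^-1` B) = normal_prob 0 (Num.sqrt v) B].

Definition eq_distribution (R : realType)
    (d1 : measure_display) (O1 : measurableType d1) (P1 : probability O1 R)
    (d2 : measure_display) (O2 : measurableType d2) (P2 : probability O2 R)
    (dT : measure_display) (T : measurableType dT)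
    (X1 : O1 -> T) (X2 : O2 -> T) : Prop :=
  [/\ measurable_fun [set: O1] X1, measurable_fun [set: O2] X2
    & forall B : set T, measurable B -> P1 (X1 @^-1` B) = P2 (X2 @^-1` B)].

Definition increment (R : realType) (O : Type) (d : nat)
    (W : R -> O -> d.-tuple R) (s t : R) (w : O) : d.-tuple R :=
  [tuple tnth (W t w) j - tnth (W s w) j | j < d].

(* The time set is [0, +oo[: nothing is required of [W t] for [t < 0]. *)
Record brownian_motion (R : realType)
    (dO : measure_display) (O : measurableType dO) (P : probability O R)
    (d : nat) (W : R -> O -> d.-tuple R) : Prop := BrownianMotion {
  bm_measurable : forall t, 0 <= t -> measurable_fun [set: O] (W t) ;
  bm_start : {ae P, forall w, forall j, tnth (W 0 w) j = 0} ;
  bm_continuous : forall w j,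
    {within [set t : R | 0 <= t], continuous (fun t : R => tnth (W t w) j)} ;
  bm_independent : forall (n : nat) (t : nat -> R), 0 <= t 0%N ->
    (forall i, (i < n)%N -> t i <= t i.+1) ->
    mutually_independent P [set: 'I_n] (fun i => increment W (t i) (t i.+1)) ;
  bm_normal : forall s t, 0 <= s -> s < t ->
    isotropic_normal P (increment W s t) (t - s) }.

Definition bridge (R : realType) (x : R -> R) (s t r : R) : R :=
  (x r - x s) - (r - s) / (t - s) * (x t - x s).

Definition levyH (R : realType) (x : R -> R) (s t : R) : R :=
  if s == t then 0 else
  (t - s)^-1 * \int[lebesgue_measure]_(r in `[s, t]) bridge x s t r.

Definition levyK (R : realType) (x : R -> R) (s t : R) : R :=
  if s == t then 0 else
  ((t - s) ^+ 2)^-1 *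
    \int[lebesgue_measure]_(r in `[s, t]) (bridge x s t r * ((t + s) / 2 - r)).

Inductive mode := NoLevyArea | SpaceTime | SpaceTimeTime.

(* Number of components among W, H, K.  In every mode this is also the number
   of Gaussian vectors attached to each of the root, the nodes and the leaves
   (one normal [G] is used at nodes and leaves in mode [NoLevyArea]). *)
Definition ncomp (m : mode) : nat :=
  match m with NoLevyArea => 1 | SpaceTime => 2 | SpaceTimeTime => 3 end.

(* The components of [Y_{s,t}] are numbered 0 for W, 1 for H, 2 for K. *)
Definition levy_component (R : realType) (x : R -> R) (s t : R) (i : nat) : R :=
  nth 0 [:: x t - x s; levyH x s t; levyK x s t] i.

(* [Node l k] is the interval [k 2^-l, (k+1) 2^-l], which is split at its
   midpoint; [Leaf k] is the leaf interval [k 2^-L, (k+1) 2^-L]. *)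
Inductive site := Root | Node of nat & nat | Leaf of nat.

Definition valid_site (L : nat) (s : site) : bool :=
  match s with
  | Root => true
  | Node l k => (l < L)%N && (k < 2 ^ l)%N
  | Leaf k => (k < 2 ^ L)%N
  end.

(* Per-coordinate variance of the [i]-th Gaussian vector attached to a site:
   (W_1, H_1, K_1) at the root; (G), (Z, M) or (Z, X_1, X_2) at a node; standard
   normals at a leaf. *)
Definition noise_variance (R : realType) (m : mode) (s : site) (i : nat) : R :=
  match s with
  | Root => nth 0 [:: 1; 12^-1; 720^-1] i
  | Node l _ =>
      let h := 2 ^- l in
      match m with
      | NoLevyArea => 1
      | SpaceTime => nth 0 [:: h / 16; h / 12] i
      | SpaceTimeTime => nth 0 [:: h / 16; h / 768; h / 2880] i
      end
  | Leaf _ => 1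
  end.

Definition vbt_noise (R : realType) (m : mode) (L : nat)
    (dO : measure_display) (O : measurableType dO) (P : probability O R)
    (d : nat) (xi : site -> nat -> O -> d.-tuple R) : Prop :=
  let slots := [set a : site * nat | valid_site L a.1 /\ (a.2 < ncomp m)%N] in
  (forall a, slots a ->
     isotropic_normal P (xi a.1 a.2) (noise_variance R m a.1 a.2)) /\
  mutually_independent P slots (fun a => xi a.1 a.2).

(* From here to [vbt_component] everything is scalar: [g s i] is the value of
   one coordinate of the [i]-th Gaussian vector at the site [s]; the
   vector-valued construction applies this to every coordinate. *)

(* Value attached to the interval number [k] of level [l] when [split] maps the
   value of an interval to those of its left and right halves. *)
Fixpoint tree_interval (Y : Type) (root : Y) (split : nat -> nat -> Y -> Y * Y)
    (l k : nat) : Y :=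
  if l is l'.+1 then
    let c := split l' k./2 (tree_interval root split l' k./2) in
    if odd k then c.2 else c.1
  else root.

(* Value at the time k 2^-l, for k <= 2^l: [interval] gives the values on the
   tree intervals and [concat s r] is rule (C) from [s] to [r].  An odd [k] is
   the midpoint of the parent [k./2]; the left half is the interval [k.-1]. *)
Fixpoint tree_time (R : realType) (Y : Type) (zero : Y)
    (interval : nat -> nat -> Y) (concat : R -> R -> Y -> Y -> Y)
    (l k : nat) : Y :=
  if l is l'.+1 then
    let v := tree_time zero interval concat l' k./2 in
    if odd k then
      concat (k./2%:R / 2 ^+ l') (k%:R / 2 ^+ l) v (interval l k.-1)
    else v
  else if k == 0%N then zero else interval 0%N 0%N.

(* The leaf [k] with k 2^-L < x <= (k+1) 2^-L, and [0] for x = 0. *)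
Definition leaf_index (R : realType) (L : nat) (x : R) : nat :=
  `|Num.ceil (x * 2 ^+ L)|%N.-1.

(* In mode [NoLevyArea] W itself is computed at the dyadic times k 2^-l. *)
Fixpoint none_time (R : realType) (g : site -> nat -> R) (l k : nat) : R :=
  if l is l'.+1 then
    let j := k./2 in
    if odd k then
      (none_time g l' j + none_time g l' j.+1) / 2
      + Num.sqrt (2 ^- l') / 2 * g (Node l' j) 0%N
    else none_time g l' j
  else if k == 0%N then 0 else g Root 0%N.

Definition none_query (R : realType) (g : site -> nat -> R) (L : nat) (x : R)
    : R :=
  let k := leaf_index L x in
  let h := 2 ^- L in
  let p := x - k%:R / 2 ^+ L in
  let q := k.+1%:R / 2 ^+ L - x in
  none_time g L k + p / h * (none_time g L k.+1 - none_time g L k)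
  + Num.sqrt (p * q / h) * g (Leaf k) 0%N.

(* In mode [SpaceTime] values are pairs (W, \bar H). *)
Definition st_concat (R : realType) (s r : R) (y z : R * R) : R * R :=
  let: (Ws, Hs) := y in
  let: (Wsr, Hsr) := z in
  let Wr := Ws + Wsr in
  (Wr, Hs + Hsr + (r * Ws - s * Wr) / 2).

Definition st_split (R : realType) (g : site -> nat -> R) (l k : nat)
    (y : R * R) : (R * R) * (R * R) :=
  let: (W, H) := y in
  let h := 2 ^- l in
  let Z := g (Node l k) 0%N in
  let M := g (Node l k) 1%N in
  ((W / 2 + 3 / (2 * h) * H + Z, H / 8 - h / 4 * Z + h / 4 * M),
   (W / 2 - 3 / (2 * h) * H - Z, H / 8 - h / 4 * Z - h / 4 * M)).

Definition st_interval (R : realType) (g : site -> nat -> R) :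
    nat -> nat -> R * R :=
  tree_interval (g Root 0%N, g Root 1%N) (st_split g).

Definition st_time (R : realType) (g : site -> nat -> R) : nat -> nat -> R * R :=
  tree_time (0, 0) (st_interval g) (@st_concat R).

Definition st_query (R : realType) (g : site -> nat -> R) (L : nat) (x : R)
    : R * R :=
  let k := leaf_index L x in
  let h := 2 ^- L in
  let s := k%:R / 2 ^+ L in
  let p := x - s in
  let q := k.+1%:R / 2 ^+ L - x in
  let X1 := g (Leaf k) 0%N in
  let X2 := g (Leaf k) 1%N in
  let delta := Num.sqrt (p ^+ 3 + q ^+ 3) in
  let a := p `^ (7 / 2) * q `^ (1 / 2) / (2 * h * delta) in
  let b := p `^ (1 / 2) * q `^ (7 / 2) / (2 * h * delta) in
  let c := Num.sqrt 3 * p `^ (3 / 2) * q `^ (3 / 2) / (6 * delta) in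
  let: (Wsu, Hsu) := st_interval g L k in
  st_concat s x (st_time g L k)
    (p / h * Wsu + 6 * p * q / h ^+ 3 * Hsu + 2 * (a + b) / h * X1,
     p ^+ 3 / h ^+ 3 * Hsu - a * X1 + c * X2).

(* In mode [SpaceTimeTime] values are triples (W, \bar H, \bar K). *)
Definition stt_concat (R : realType) (s r : R) (y z : R * R * R) : R * R * R :=
  let: (Ws, Hs, Ks) := y in
  let: (Wsr, Hsr, Ksr) := z in
  let Wr := Ws + Wsr in
  (Wr,
   Hs + Hsr + (r * Ws - s * Wr) / 2,
   Ks + Ksr + (r - s) / 2 * Hs - s / 2 * Hsr
     + (r - 2 * s) / 12 * (r * Ws - s * Wr)).

Definition stt_split (R : realType) (g : site -> nat -> R) (l k : nat)
    (y : R * R * R) : (R * R * R) * (R * R * R) :=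
  let: (W, H, K) := y in
  let h := 2 ^- l in
  let Z := g (Node l k) 0%N in
  let X1 := g (Node l k) 1%N in
  let X2 := g (Node l k) 2%N in
  ((W / 2 + 3 / (2 * h) * H + Z,
    H / 8 + 15 / (8 * h) * K - h / 4 * Z + h / 2 * X1,
    K / 32 - h ^+ 2 / 8 * X1 + h ^+ 2 / 4 * X2),
   (W / 2 - 3 / (2 * h) * H - Z,
    H / 8 - 15 / (8 * h) * K - h / 4 * Z - h / 2 * X1,
    K / 32 - h ^+ 2 / 8 * X1 - h ^+ 2 / 4 * X2)).

Definition stt_interval (R : realType) (g : site -> nat -> R) :
    nat -> nat -> R * R * R :=
  tree_interval (g Root 0%N, g Root 1%N, g Root 2%N) (stt_split g).

Definition stt_time (R : realType) (g : site -> nat -> R) :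
    nat -> nat -> R * R * R :=
  tree_time (0, 0, 0) (stt_interval g) (@stt_concat R).

(* The covariance matrix of (\hat W, \hat H, \hat K), with h = p + q. *)
Definition stt_cov (R : realType) (h p q : R) : 'M[R]_3 :=
  let WW := p * q * ((p - q) ^+ 4 + 4 * p ^+ 2 * q ^+ 2) / h ^+ 5 in
  let WH := - (p ^+ 3 * q * (p ^+ 2 - 3 * p * q + 6 * q ^+ 2) / (2 * h ^+ 5)) in
  let WK := p ^+ 4 * q * (p - q) / (12 * h ^+ 5) in
  let HH := p / 12 *
    (1 - p ^+ 3 * (p ^+ 2 + 2 * p * q + 16 * q ^+ 2) / h ^+ 5) in
  let HK := - (p ^+ 5 * q / (24 * h ^+ 5)) in
  let KK := p / 720 * (1 - p ^+ 5 / h ^+ 5) in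
  \matrix_(i, j) nth 0 (nth [::] [:: [:: WW; WH; WK];
                                     [:: WH; HH; HK];
                                     [:: WK; HK; KK]] i) j.

(* [A x] is the square root used at the normalised query time [x]. *)
Definition stt_roots (R : realType) (L : nat) (A : R -> 'M[R]_3) : Prop :=
  forall x : R, 0 <= x <= 1 ->
    let k := leaf_index L x in
    A x *m (A x)^T
    = stt_cov (2 ^- L) (x - k%:R / 2 ^+ L) (k.+1%:R / 2 ^+ L - x).

Definition stt_query (R : realType) (g : site -> nat -> R)
    (A : R -> 'M[R]_3) (L : nat) (x : R) : R * R * R :=
  let k := leaf_index L x in
  let h := 2 ^- L in
  let s := k%:R / 2 ^+ L in
  let p := x - s in
  let q := k.+1%:R / 2 ^+ L - x in
  let hat : 'cV[R]_3 := A x *m \col_i g (Leaf k) i in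
  let hatW := hat (inord 0) ord0 in
  let hatH := hat (inord 1) ord0 in
  let hatK := hat (inord 2) ord0 in
  let: (Wsu, bHsu, bKsu) := stt_interval g L k in
  let Hsu := bHsu / h in
  let Ksu := bKsu / h ^+ 2 in
  stt_concat s x (stt_time g L k)
    (p / h * Wsu + 6 * p * q / h ^+ 2 * Hsu
       + 60 * p * q * (q - p) / h ^+ 3 * Ksu + hatW,
     p * (p ^+ 2 / h ^+ 2 * Hsu + 30 * p ^+ 2 * q / h ^+ 3 * Ksu + hatH),
     p ^+ 2 * (p ^+ 3 / h ^+ 3 * Ksu + hatK)).

(* W, \bar H, \bar K (rescaled areas), at the normalised time [x]. *)
Definition vbt_query (R : realType) (m : mode) (g : site -> nat -> R)
    (A : R -> 'M[R]_3) (L : nat) (x : R) : seq R :=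
  match m with
  | NoLevyArea => [:: none_query g L x]
  | SpaceTime => let: (W, H) := st_query g L x in [:: W; H]
  | SpaceTimeTime => let: (W, H, K) := stt_query g A L x in [:: W; H; K]
  end.

Definition vbt_component (R : realType) (m : mode) (g : site -> nat -> R)
    (A : R -> 'M[R]_3) (L : nat) (t0 t1 r : R) (i : nat) : R :=
  if r == t0 then 0 else
  let x := (r - t0) / (t1 - t0) in
  Num.sqrt (t1 - t0) * (x ^- i * nth 0 (vbt_query m g A L x) i).

Definition levy_process (R : realType) (m : mode) (O : Type) (d : nat)
    (W : R -> O -> d.-tuple R) (t0 r : R) (w : O)
    : (ncomp m).-tuple (d.-tuple R) :=
  [tuple [tuple levy_component (fun t => tnth (W t w) j) t0 r i | j < d]
    | i < ncomp m].

Definition vbt_process (R : realType) (m : mode) (O : Type) (d : nat)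
    (xi : site -> nat -> O -> d.-tuple R) (A : R -> 'M[R]_3)
    (L : nat) (t0 t1 r : R) (w : O) : (ncomp m).-tuple (d.-tuple R) :=
  [tuple
    [tuple vbt_component m (fun s i => tnth (xi s i w) j) A L t0 t1 r i | j < d]
    | i < ncomp m].

Definition dyadic_times (R : realType) (L : nat) (t0 t1 : R) : set R :=
  [set t0 + (t1 - t0) * (k%:R / 2 ^+ L) | k in [set k | (k <= 2 ^ L)%N]].

(* Main.v *)
(* Both families are images, under one and the same linear map, of the triples
   (W, \bar H, \bar K) of the leaves and of the part of each leaf which precedes
   the unique query strictly inside it; dyadic queries are read off rule (C).
   A linear functional of these triples is Gaussian and centred on both sides,
   so only its variance matters.  For the tree, the midpoint step and the final
   interpolation are isometries for the quadratic form
   h u_0^2 + h^3/12 u_1^2 + h^5/720 u_2^2.  For the Brownian motion, the triple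
   of an interval is the limit of Riemann sums of its increments against the
   shifted Legendre polynomials of degree 0, 1 and 2, which are orthogonal.
   Equality of the laws follows from that of the functions E cos (l + theta),
   for all linear combinations l of the components: multiplying inductively by
   indicators of the components, inverting by Gaussian smoothing each time,
   gives equality on boxes. *)
Require Import Defs.
From HB Require Import structures.
From mathcomp Require Import all_boot all_order all_algebra.
From mathcomp Require Import all_classical all_reals all_analysis.
From mathcomp Require Import finmap measurable_realfun ring lra.

Set Implicit Arguments.
Unset Strict Implicit.
Unset Printing Implicit Defensive.

Import Order.TTheory GRing.Theory Num.Theory.
Import numFieldNormedType.Exports.

Local Open Scope classical_set_scope.
Local Open Scope ring_scope.

(** * Bounded convergence and weighted laws *)

(** Queries in one leaf all reuse the noise of that leaf, so the final interpolation is only right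
    for one point strictly inside it. The condition on [V] ensures this: two queries in one open
    leaf would have no dyadic time between them. A leaf without a query inside receives its midpoint
    as an artificial one, so that all leaves carry the same kind of data. In the poorer modes the
    tree triples are padded with zeros and only coefficient vectors vanishing on the absent
    components are tested; this is consistent because rule (C) is triangular. The coefficients 1,
    1/12, 1/720 are the squared norms on [0, 1] of the kernels 1, 1/2 - r and 1/12 - r (1 - r) / 2,
    which represent W, H and K as integrals against dW. The phase theta replaces complex
    exponentials: it yields cosine and sine transforms together. The weights met in the induction on
    components (indicators times a cosine) change sign, so laws are compared through integrals and
    not as measures. Degenerate linear forms, such as those at the query [t0], have variance 0 and
    need no separate treatment. *)

Section integration.
Context d (T : measurableType d) (R : realType).
Variable mu : {measure set T -> \bar R}.

Lemma Rdominated_convergence (f_ : nat -> T -> R) (f g : T -> R) :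
    (forall n, measurable_fun [set: T] (f_ n)) ->
    (forall x, f_ n x @[n --> \oo] --> f x) ->
    mu.-integrable [set: T] (EFin \o g) ->
    (forall n x, `|f_ n x| <= g x) ->
  mu.-integrable [set: T] (EFin \o f) /\
  \int[mu]_x f_ n x @[n --> \oo] --> \int[mu]_x f x.
Proof.
move=> mf_ cf ig fg.
have mEf : measurable_fun [set: T] (EFin \o f).
  apply: (@emeasurable_fun_cvg _ _ _ _ (fun n x => (f_ n x)%:E)).
  - by move=> n; exact/measurable_EFinP.
  - by move=> x _; apply: cvg_EFin; [exact: nearW|exact: cf].
have [|||||intf _ cvgf] := @dominated_convergence _ _ _ mu _ measurableT
  (fun n x => (f_ n x)%:E) (EFin \o f) (EFin \o g).
- by move=> n; exact/measurable_EFinP.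
- exact: mEf.
- apply: aeW => x _; apply: cvg_EFin; first exact: nearW.
  exact: cf.
- by [].
- by apply: aeW => x n _; rewrite lee_fin.
split=> //; apply: fine_cvg; rewrite fineK//.
exact: integrable_fin_num.
Qed.

Lemma integrableM_bounded (h f : T -> R) (M : R) :
    mu.-integrable [set: T] (EFin \o h) -> measurable_fun [set: T] f ->
    (forall x, `|f x| <= M) ->
  mu.-integrable [set: T] (EFin \o (fun x => h x * f x)).
Proof.
move=> ih mf fM.
have mh : measurable_fun [set: T] h by apply/measurable_EFinP; case/integrableP: ih.
apply: (@le_integrable _ _ _ mu _ measurableT _ (fun x => `|M%:E * (h x)%:E|%E)).
- exact/measurable_EFinP/measurable_funM.
- move=> x _ /=; rewrite lee_fin normrM [leRHS]ger0_norm// normrM mulrC.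
  by rewrite ler_wpM2r// (le_trans (fM x))// ler_norm.
- exact/integrable_abse/integrableZl.
Qed.

Lemma Rintegral_sum (I : Type) (s : seq I) (f : I -> T -> R) :
  (forall i, mu.-integrable [set: T] (EFin \o f i)) ->
  \int[mu]_x (\sum_(i <- s) f i x) = \sum_(i <- s) \int[mu]_x f i x.
Proof.
move=> intf; elim: s => [|i s IH].
  rewrite big_nil; under eq_Rintegral do rewrite big_nil.
  by rewrite Rintegral_cst// mul0r.
rewrite big_cons -IH; under eq_Rintegral do rewrite big_cons.
rewrite RintegralD//.
have -> : EFin \o (fun x => \sum_(j <- s) f j x) =
    (fun x => \sum_(j <- s) (EFin \o f j) x)%E.
  by apply/funext => x /=; rewrite sumEFin.
exact: integrable_sum.
Qed.

End integration.

Section weighted_law.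
Import HBNNSimple.
Context d1 (T1 : measurableType d1) d2 (T2 : measurableType d2) (R : realType).
Variables (m1 : {measure set T1 -> \bar R}) (m2 : {measure set T2 -> \bar R}).
Variables (h1 : T1 -> R) (h2 : T2 -> R) (X1 : T1 -> R) (X2 : T2 -> R).
Hypothesis ih1 : m1.-integrable [set: T1] (EFin \o h1).
Hypothesis ih2 : m2.-integrable [set: T2] (EFin \o h2).
Hypothesis mX1 : measurable_fun [set: T1] X1.
Hypothesis mX2 : measurable_fun [set: T2] X2.
Hypothesis eqX : forall B : set R, measurable B ->
  \int[m1]_w (h1 w * \1_B (X1 w)) = \int[m2]_w (h2 w * \1_B (X2 w)).

(** The weights may change sign and the measures need not be finite. This covers a probability with
    weight 1 against Lebesgue measure with a density, as well as probabilities weighted by cosines.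
    Both sides are linear in [f], so simple functions and dominated convergence suffice. *)
Lemma weighted_law_ext (f : R -> R) (M : R) :
    measurable_fun [set: R] f -> (forall x, `|f x| <= M) ->
  \int[m1]_w (h1 w * f (X1 w)) = \int[m2]_w (h2 w * f (X2 w)).
Proof.
move=> mf fM.
have indic_le (B : set R) x : `|\1_B x : R| <= 1.
  by rewrite indicE; case: (_ \in _); rewrite ?normr0 ?normr1.
have int1 (B : set R) : measurable B ->
    m1.-integrable [set: T1] (EFin \o (fun w => h1 w * \1_B (X1 w))).
  move=> mB; apply: (@integrableM_bounded _ _ _ m1 h1 _ 1) => //.
  by apply: measurableT_comp => //; exact: measurable_indic.
have int2 (B : set R) : measurable B ->
    m2.-integrable [set: T2] (EFin \o (fun w => h2 w * \1_B (X2 w))).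
  move=> mB; apply: (@integrableM_bounded _ _ _ m2 h2 _ 1) => //.
  by apply: measurableT_comp => //; exact: measurable_indic.
(* Simple functions approximate nonnegative functions from below, hence the shift by the bound
   [M]. *)
pose g x := f x + M.
have g0 x : 0 <= g x by have := fM x; rewrite ler_norml /g => /andP[]; lra.
have gM x : g x <= M + M by have := fM x; rewrite ler_norml /g => /andP[]; lra.
have mg : measurable_fun [set: R] (EFin \o g).
  by apply/measurable_EFinP; exact: measurable_funD.
pose phi := nnsfun_approx measurableT mg.
have phi_le n x : phi n x <= g x.
  rewrite -lee_fin /phi nnsfun_approxE.
  by apply: le_approx => // y _; rewrite lee_fin.
have cphi x : phi n x @[n --> \oo] --> g x.
  have := cvg_nnsfun_approx measurableT mg (fun y _ => g0 y) (Logic.I : setT x).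
  by move/fine_cvgP => [].
have eqphi n : \int[m1]_w (h1 w * phi n (X1 w)) = \int[m2]_w (h2 w * phi n (X2 w)).
  have E (d : measure_display) (T : measurableType d)
      (m : {measure set T -> \bar R}) (h X : T -> R) :
      (forall B : set R, measurable B ->
        m.-integrable [set: T] (EFin \o (fun w => h w * \1_B (X w)))) ->
      \int[m]_w (h w * phi n (X w)) = \sum_(y <- fset_set (range (phi n)))
         y * \int[m]_w (h w * \1_(phi n @^-1` [set y]) (X w)).
    move=> intB.
    have mfib y : measurable (phi n @^-1` [set y]) by exact: (measurable_funPTI (phi n)).
    under [RHS]eq_bigr => y _.
      rewrite -RintegralZl//; last exact: intB.
      over.
    rewrite -Rintegral_sum.
      apply: eq_Rintegral => w _.
      rewrite fimfunE fsbig_finite//= mulr_sumr.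
      by apply: eq_bigr => y _; rewrite mulrCA.
    by move=> y; exact: (integrableZl measurableT y (intB _ (mfib y))).
  rewrite (E _ _ m1)// (E _ _ m2)//; apply: eq_bigr => y _; congr (_ * _).
  by apply: eqX; exact: (measurable_funPTI (phi n)).
have mphi n : measurable_fun [set: R] (phi n) by [].
have cvgi (d : measure_display) (T : measurableType d)
      (m : {measure set T -> \bar R}) (h X : T -> R) :
    m.-integrable [set: T] (EFin \o h) -> measurable_fun [set: T] X ->
    \int[m]_w (h w * phi n (X w)) @[n --> \oo] --> \int[m]_w (h w * g (X w)).
  move=> ih mX.
  have mh : measurable_fun [set: T] h by apply/measurable_EFinP; case/integrableP: ih.
  apply: (@Rdominated_convergence _ _ _ m (fun n w => h w * phi n (X w))
    (fun w => h w * g (X w)) (fun w => `|(M + M) * h w|) _ _ _ _).2.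
  - by move=> n; apply: measurable_funM => //; exact: measurableT_comp.
  - by move=> w; apply: cvgM; [exact: cvg_cst|exact: cphi].
  - have := integrable_abse (integrableZl measurableT (M + M) ih).
    by apply: eq_integrable.
  - move=> n w; rewrite !normrM mulrC ler_wpM2r//.
    rewrite ger0_norm; last exact: fun_ge0.
    by rewrite (le_trans (phi_le _ _))// (le_trans (gM _))// ler_norm.
have eqg : \int[m1]_w (h1 w * g (X1 w)) = \int[m2]_w (h2 w * g (X2 w)).
  have c1 := cvgi _ _ m1 h1 X1 ih1 mX1; have c2 := cvgi _ _ m2 h2 X2 ih2 mX2.
  have e : (fun n => \int[m1]_w (h1 w * phi n (X1 w))) =
           (fun n => \int[m2]_w (h2 w * phi n (X2 w))) by apply/funext.
  by rewrite e in c1; exact: (cvg_unique _ c1 c2).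
(* The shift contributes [M] times the total weight, and [eqX] at [setT] says that the total weights
   agree. *)
have sub (d : measure_display) (T : measurableType d)
      (m : {measure set T -> \bar R}) (h X : T -> R) :
    m.-integrable [set: T] (EFin \o h) -> measurable_fun [set: T] X ->
    \int[m]_w (h w * g (X w)) =
    \int[m]_w (h w * f (X w)) + M * \int[m]_w (h w * \1_setT (X w)).
  move=> ih mX.
  rewrite -RintegralZl//; last first.
    apply: (@integrableM_bounded _ _ _ m h _ 1) => //.
    by apply: measurableT_comp => //; exact: measurable_indic.
  rewrite -RintegralD//.
  - by apply: eq_Rintegral => w _; rewrite indicT /cst/= /g; ring.
  - by apply: (@integrableM_bounded _ _ _ m h _ M) => //; exact: measurableT_comp.
  - have := integrableZl measurableT M ih; apply: eq_integrable => // w _ /=.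
    by rewrite indicT /cst/= mulr1 EFinM.
move: eqg; rewrite (sub _ _ m1)// (sub _ _ m2)// eqX//.
by move/addIr.
Qed.

End weighted_law.

(** * The characteristic function of the normal law *)

Section gaussian_integral.
Variable R : realType.
Local Notation mu := (@lebesgue_measure R).

Lemma measurable_cosR : measurable_fun [set: R] (@cos R).
Proof. by apply: continuous_measurable_fun; exact: continuous_cos. Qed.

Lemma measurable_sinR : measurable_fun [set: R] (@sin R).
Proof. by apply: continuous_measurable_fun; exact: continuous_sin. Qed.

Lemma is_derive_continuous (K : R -> R) (x l : R) : is_derive x 1 K l ->
  {for x, continuous K}.
Proof. by move=> dK; apply/differentiable_continuous/derivable1_diffP. Qed.

(** Fundamental theorem of calculus on growing windows, with [|k|] as dominating function. The
    windows have integer ends, so limits of [K] along the integers are enough. *)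
Lemma Rintegral_derive_eq0 (K k : R -> R) :
    (forall x : R, is_derive x 1 K (k x)) -> continuous k ->
    mu.-integrable [set: R] (EFin \o k) ->
    K n%:R @[n --> \oo] --> (0 : R) -> K (- n%:R) @[n --> \oo] --> (0 : R) ->
  \int[mu]_x k x = 0.
Proof.
move=> dK ck ik Ky KNy.
have mk : measurable_fun [set: R] k by exact: continuous_measurable_fun.
have cK : continuous K by move=> x; exact: (is_derive_continuous (dK x)).
pose I n := `[- n.+1%:R, n.+1%:R]%classic : set R.
have [||||_ cvg1] := @Rdominated_convergence _ _ _ mu
  (fun n x => k x * \1_(I n) x) k (fun x => `|k x|).
- by move=> n; apply: measurable_funM => //; apply: measurable_indic; exact: measurable_itv.
- move=> x; apply: cvg_near_cst; near=> n => /=; rewrite indicE mem_set ?mulr1//=.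
  rewrite /I/= in_itv/= -ler_norml.
  have : (Num.truncn `|x| < n)%N by near: n; exact: nbhs_infty_gt.
  move=> /ltnW xn; apply/ltW/(lt_le_trans (truncnS_gt _)).
  by rewrite ler_nat ltnS.
- exact: (integrable_abse ik).
- move=> n x; rewrite normrM ler_piMr// indicE.
  by case: (_ \in _); rewrite ?normr1 ?normr0.
have E n : \int[mu]_x (k x * \1_(I n) x) = K n.+1%:R - K (- n.+1%:R).
  have -> : \int[mu]_x (k x * \1_(I n) x) = \int[mu]_(x in I n) k x.
    rewrite [RHS]Rintegral_mkcond; apply: eq_Rintegral => x _.
    by rewrite patchE indicE; case: ifP => _; rewrite ?mulr1 ?mulr0.
  have lt : - n.+1%:R < n.+1%:R :> R by rewrite gtrN.
  rewrite /Rintegral (@continuous_FTC2 _ k K _ _ lt)//.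
  - exact: continuous_subspaceT.
  - split=> [x _||]; first exact: ex_derive.
    + by apply: cvg_at_right_filter; exact: cK.
    + by apply: cvg_at_left_filter; exact: cK.
  - by move=> x _; rewrite derive1E; exact: derive_val.
have cvg2 : K n.+1%:R - K (- n.+1%:R) @[n --> \oo] --> (0 - 0 : R).
  by apply: cvgB; [move: Ky|move: KNy]; rewrite -cvg_shiftS.
rewrite subr0 in cvg2.
have e : (fun n => \int[mu]_x (k x * \1_(I n) x)) =
    (fun n => K n.+1%:R - K (- n.+1%:R)) by apply/funext.
by rewrite e in cvg1; exact: (cvg_unique _ cvg1 cvg2).
Unshelve. all: end_near. Qed.

Section charfun.
Variables (s : R) (s0 : 0 < s).

Let pdf := normal_pdf 0 s.
Let k : R := (s ^+ 2 *+ 2)^-1.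

Let pdfE x : pdf x = normal_peak s * expR (- (k * x ^+ 2)).
Proof.
rewrite /pdf normal_pdfE ?gt_eqF//= /normal_fun subr0 mulNr.
by congr (_ * expR (- _)); rewrite mulrC.
Qed.

Let ipdf : mu.-integrable [set: R] (EFin \o pdf).
Proof. exact: integrable_normal_pdf. Qed.

Let mpdf : measurable_fun [set: R] pdf.
Proof. exact: measurable_normal_pdf. Qed.

Let is_derive_pdf (x : R) : is_derive x 1 pdf (- (k * x *+ 2) * pdf x).
Proof.
have -> : pdf = normal_peak s *: (expR \o (fun x => - (k * x ^+ 2))).
  by apply/funext => y; rewrite pdfE.
apply: is_derive_eq.
rewrite /= !fctE /GRing.scale/=; ring.
Qed.

Variable th : R.
Let f (c x : R) : R := pdf x * cos (c * x + th).

Let cos1 (a : R) : `|cos a| <= 1. Proof. exact: cos_max. Qed.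

Let maff (c : R) : measurable_fun [set: R] (fun x : R => c * x + th).
Proof. by apply: measurable_funD => //; exact: measurable_funM. Qed.

Let if_ c : mu.-integrable [set: R] (EFin \o f c).
Proof.
apply: (@integrableM_bounded _ _ _ mu pdf _ 1) => //.
exact: (measurableT_comp measurable_cosR (maff c)).
Qed.

Let is_derive_cos_aff (x c : R) :
  is_derive c 1 (fun c => f c x) (- (x * pdf x * sin (c * x + th))).
Proof.
have -> : (fun c => f c x) = pdf x *: (cos \o (fun c => c * x + th)).
  by apply/funext.
by apply: is_derive_eq; rewrite /GRing.scale/=; ring.
Qed.

Let mM (h : R -> R) (c : R) : measurable_fun [set: R] h ->
  measurable_fun [set: R] (fun x => h (c * x + th)).
Proof. by move=> mh; exact: (measurableT_comp mh (maff c)). Qed.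

(* [y e^{-y^2/2} <= e^{-y^2/4}], which follows from [0 <= (y/2 - 1)^2]. *)
Let pdf_moment x : `|x| * pdf x <=
  s * (normal_peak s / normal_peak (s * Num.sqrt 2)) * normal_pdf 0 (s * Num.sqrt 2) x.
Proof.
have s2 : 0 < s * Num.sqrt 2 by rewrite mulr_gt0// sqrtr_gt0.
have s2' := gt_eqF s2.
rewrite (normal_pdfE _ (negbT s2')) pdfE /normal_fun subr0.
have P2 : normal_peak (s * Num.sqrt 2) != 0 by rewrite gt_eqF// normal_peak_gt0// negbT.
rewrite [leLHS]mulrCA (_ : s * _ * _ =
    normal_peak s * (s * expR (- x ^+ 2 / ((s * Num.sqrt 2) ^+ 2 *+ 2)))); last by field.
apply: ler_wpM2l; first exact: normal_peak_ge0.
rewrite exprMn sqr_sqrtr// -mulr_natr.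
set y := `|x| / s.
have ys : `|x| = s * y by rewrite /y mulrC divfK// gt_eqF.
have x2 : x ^+ 2 = s ^+ 2 * y ^+ 2 by rewrite -[LHS]real_normK ?num_real// ys exprMn.
have -> : k * x ^+ 2 = y ^+ 2 / 2.
  rewrite x2 /k -mulr_natr; field; exact/lt0r_neq0.
have -> : - x ^+ 2 / (s ^+ 2 * 2 * 2) = - (y ^+ 2 / 4).
  rewrite x2; field; exact/lt0r_neq0.
rewrite ys -mulrA ler_pM2l//.
have -> : - (y ^+ 2 / 4) = y ^+ 2 / 4 + - (y ^+ 2 / 2) by field.
rewrite expRD ler_wpM2r ?expR_ge0//.
apply: le_trans (expR_ge1Dx _).
have := sqr_ge0 (y / 2 - 1); lra.
Qed.

Let ixpdf : mu.-integrable [set: R] (EFin \o (fun x => `|x| * pdf x)).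
Proof.
set C := s * (normal_peak s / normal_peak (s * Num.sqrt 2)).
have ipdf2 := integrable_normal_pdf (0 : R) (s * Num.sqrt 2).
apply: (@le_integrable _ _ _ mu _ measurableT _ (EFin \o (fun x =>
  C * normal_pdf 0 (s * Num.sqrt 2) x))).
- by apply/measurable_EFinP/measurable_funM => //; exact: measurableT_comp.
- move=> x _ /=; rewrite lee_fin ger0_norm; last by rewrite mulr_ge0// normal_pdf_ge0.
  exact: le_trans (pdf_moment x) (ler_norm _).
- exact: (integrableZl measurableT C ipdf2).
Qed.

Let F (c : R) := \int[mu]_x f c x.

(** Gaussian integration by parts: the derivative of [sin (c x + th) * pdf x] has integral 0, and
    [pdf' x = - x / s^2 * pdf x]. It expresses the derivative of [F] through [F] itself. *)
Let by_parts c : \int[mu]_x (x * pdf x * sin (c * x + th)) = c * s ^+ 2 * F c.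
Proof.
pose K x := sin (c * x + th) * pdf x.
pose K' x := c * f c x - (s ^+ 2)^-1 * (x * pdf x * sin (c * x + th)).
have i2 : mu.-integrable [set: R] (EFin \o (fun x => x * pdf x * sin (c * x + th))).
  apply: (@integrableM_bounded _ _ _ mu (fun x => x * pdf x) _ 1).
  - apply: (@le_integrable _ _ _ mu _ measurableT _ _ _ _ ixpdf).
      by apply/measurable_EFinP/measurable_funM.
    by move=> x _ /=; rewrite lee_fin !normrM normr_id.
  - exact: (mM c measurable_sinR).
  - by move=> x; exact: sin_max.
have i1 := if_ c.
have iK' : mu.-integrable [set: R] (EFin \o K').
  exact: (integrableB measurableT (integrableZl measurableT c i1)
    (integrableZl measurableT (s ^+ 2)^-1 i2)).
have s2 : s ^+ 2 != 0 by rewrite expf_neq0// gt_eqF.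
have dK (x : R) : is_derive x 1 K (K' x).
  have dp := is_derive_pdf x.
  have -> : K = (sin \o (fun x => c * x + th)) * pdf by apply/funext.
  apply: is_derive_eq.
  rewrite /K' /f /= /k -mulr_natr /GRing.scale/=; field.
  exact: lt0r_neq0.
have K0 x : `|K x| <= pdf x.
  rewrite normrM -[leRHS]mul1r (ger0_norm (normal_pdf_ge0 _ _ _)).
  by rewrite ler_wpM2r ?normal_pdf_ge0// sin_max.
(* Completing the square, [n^2 / (2 s^2) = (n - s^2)^2 / (2 s^2) + n - s^2 / 2], compares the
   density at [n] and [- n] with [exp (- n)]; so the boundary terms vanish in the limit. *)
have pdfn (x : R) n : `|x| = n%:R ->
    pdf x <= normal_peak s * expR (s ^+ 2 / 2) * expR (- n%:R).
  move=> xn; rewrite pdfE -mulrA -expRD ler_wpM2l ?normal_peak_ge0//.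
  rewrite ler_expR -[x ^+ 2]real_normK ?num_real// xn.
  have -> : k * n%:R ^+ 2 = (n%:R - s ^+ 2) ^+ 2 / (s ^+ 2 * 2) + n%:R - s ^+ 2 / 2.
    by rewrite /k -mulr_natr; field; exact: lt0r_neq0.
  have : 0 <= (n%:R - s ^+ 2) ^+ 2 / (s ^+ 2 * 2).
    by rewrite divr_ge0 ?sqr_ge0// mulr_ge0// sqr_ge0.
  lra.
have cb : (normal_peak s * expR (s ^+ 2 / 2)) * expR (- n%:R) @[n --> \oo] --> (0 : R).
  by rewrite -[X in _ --> X](mulr0 (normal_peak s * expR (s ^+ 2 / 2))); apply: cvgM;
    [exact: cvg_cst|exact: cvgn_expR].
have cK (u : nat -> R) : (forall n, `|u n| = n%:R) -> K (u n) @[n --> \oo] --> (0 : R).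
  move=> un; apply: norm_cvg0.
  apply: (@squeeze_cvgr _ _ _ _ (cst 0) _ _ _ _ _ cb); last exact: cvg_cst.
  apply: nearW => n; rewrite normr_ge0/=.
  exact: le_trans (K0 _) (pdfn _ _ (un n)).
have := @Rintegral_derive_eq0 K K' dK _ iK' _ _.
rewrite /K' RintegralB//; last 2 first.
- exact: (integrableZl measurableT c i1).
- exact: (integrableZl measurableT _ i2).
rewrite !RintegralZl// => H.
have {}H : c * F c = (s ^+ 2)^-1 * \int[mu]_x (x * pdf x * sin (c * x + th)).
  apply/eqP; rewrite -subr_eq0; apply/eqP; apply: H.
  - move=> x; apply: cvgB; apply: cvgM; try exact: cvg_cst.
    + apply: cvgM; first exact: continuous_normal_pdf (negbT (gt_eqF s0)) x.
      apply: continuous_comp; last exact: continuous_cos.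
      by apply: cvgD; [apply: cvgM; [exact: cvg_cst|exact: cvg_id]|exact: cvg_cst].
    + apply: cvgM.
        apply: cvgM; first exact: cvg_id.
        exact: continuous_normal_pdf (negbT (gt_eqF s0)) x.
      apply: continuous_comp; last exact: continuous_sin.
      by apply: cvgD; [apply: cvgM; [exact: cvg_cst|exact: cvg_id]|exact: cvg_cst].
  - by apply: cK => n; rewrite ger0_norm.
  - by apply: cK => n; rewrite normrN ger0_norm.
have -> : c * s ^+ 2 * F c = c * F c * s ^+ 2 by ring.
by rewrite H mulrAC mulVf// mul1r.
Qed.

Let d1E (c x : R) : partial1of2 f c x = - (x * pdf x * sin (c * x + th)).
Proof. by have dc := is_derive_cos_aff x c; rewrite partial1of2E derive_val. Qed.

(** Differentiation under the integral, dominated by [|y| * pdf y] uniformly in the parameter. The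
    result is a linear differential equation for [F]. *)
Let is_derive_F (c : R) : is_derive c 1 F (- (c * s ^+ 2 * F c)).
Proof.
have Ic : `]c - 1, c + 1[%classic c by rewrite /= in_itv/= ltrBlDr ltrDl ltr01.
have ub : forall x y : R, `]c - 1, c + 1[%classic x -> [set: R] y ->
    `|partial1of2 f x y| <= `|y| * pdf y.
  move=> x y _ _; rewrite d1E normrN normrM.
  rewrite normrM (ger0_norm (normal_pdf_ge0 _ _ _)) ler_piMr ?sin_max//.
  by rewrite mulr_ge0// normal_pdf_ge0.
have int_f : forall x : R, `]c - 1, c + 1[%classic x -> mu.-integrable setT (EFin \o f x).
  by move=> x _; exact: if_.
have der_f : forall x y : R, `]c - 1, c + 1[%classic x -> [set: R] y ->
    derivable (f ^~ y) x 1.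
  by move=> x y _ _; have dc := is_derive_cos_aff y x; exact: ex_derive.
have g0 (y : R) : 0 <= `|y| * pdf y by rewrite mulr_ge0// normal_pdf_ge0.
have D := derivable_under_integral measurableT Ic int_f der_f g0 ixpdf ub.
have V := differentiation_under_integral measurableT Ic int_f der_f g0 ixpdf ub.
apply: DeriveDef => //; rewrite -derive1E V.
under eq_Rintegral do rewrite d1E -mulN1r.
rewrite RintegralZl//; first by rewrite by_parts mulN1r.
have mx : measurable_fun [set: R] (fun x => x * pdf x) by exact: measurable_funM.
apply: (@integrableM_bounded _ _ _ mu (fun x => x * pdf x) _ 1).
- apply: (@le_integrable _ _ _ mu _ measurableT _ _ _ _ ixpdf).
    exact/measurable_EFinP.
  by move=> x _ /=; rewrite lee_fin !normrM normr_id.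
- exact: (mM c measurable_sinR).
- by move=> x; exact: sin_max.
Qed.

Lemma Rintegral_normal_pdf_cos (c : R) :
  \int[mu]_x (normal_pdf 0 s x * cos (c * x + th)) =
  cos th * expR (- ((s * c) ^+ 2 / 2)).
Proof.
(* [G] is [F] times the integrating factor of its differential equation, hence constant. *)
pose G c := F c * expR (s ^+ 2 / 2 * c ^+ 2).
have dG (x : R) : is_derive x 1 G 0.
  have dF := is_derive_F x.
  have -> : G = F * (expR \o (fun c => s ^+ 2 / 2 * c ^+ 2)) by apply/funext.
  apply: is_derive_eq.
  by rewrite /= /GRing.scale/=; field.
have F0 : F 0 = cos th.
  rewrite /F /f; under eq_Rintegral do rewrite mul0r add0r mulrC.
  rewrite RintegralZl//.
  have -> : \int[mu]_x pdf x = 1 by rewrite /Rintegral integral_normal_pdf.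
  by rewrite mulr1.
have := @is_derive_0_is_cst _ G c 0 dG; rewrite /G F0 expr0n/= mulr0 expR0 mulr1.
move=> <-; rewrite -[RHS]mulrA -expRD exprMn.
by rewrite (_ : _ + _ = 0) ?expR0 ?mulr1//; field.
Qed.

End charfun.
End gaussian_integral.

(** * Sums of independent Gaussian variables *)

Section bounded_expectation.
Context d (O : measurableType d) (R : realType) (P : probability O R).

Lemma bounded_integrable (f : O -> R) (M : R) :
  measurable_fun [set: O] f -> (forall w, `|f w| <= M) ->
  P.-integrable [set: O] (EFin \o f).
Proof.
move=> mf fM; apply: measurable_bounded_integrable => //.
  by apply: (le_lt_trans (probability_le1 P measurableT)); rewrite ltry.
exists M; split; first exact: num_real.
by move=> x Mx w _; exact: le_trans (fM w) (ltW Mx).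
Qed.

Lemma Rintegral_indicE (A : set O) : measurable A ->
  \int[P]_w (\1_A w) = fine (P A).
Proof. by move=> mA; rewrite /Rintegral integral_indic// setIT. Qed.

Lemma Rintegral_indic_comp (X : O -> R) (B : set R) :
  measurable_fun [set: O] X -> measurable B ->
  \int[P]_w (\1_B (X w)) = fine (P (X @^-1` B)).
Proof.
move=> mX mB; rewrite -Rintegral_indicE; last by rewrite -[X @^-1` B]setTI; exact: mX.
by apply: eq_Rintegral => w _; rewrite !indicE.
Qed.

Lemma normr_indic_le1 (T : Type) (A : set T) x : `|\1_A x : R| <= 1.
Proof. by rewrite indicE; case: (_ \in _); rewrite ?normr0 ?normr1. Qed.

Lemma measurable_indic_comp d' (T : measurableType d') (X : O -> T) (B : set T) :
  measurable_fun [set: O] X -> measurable B ->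
  measurable_fun [set: O] (fun w => \1_B (X w) : R).
Proof. by move=> mX mB; apply: (measurableT_comp _ mX); exact: measurable_indic. Qed.

End bounded_expectation.

(* The characteristic function of [N(0, v)] in real form; [v = 0] is allowed. *)
Definition gaussian d (O : measurableType d) (R : realType)
    (P : probability O R) (Z : O -> R) (v : R) : Prop :=
  measurable_fun [set: O] Z /\
  forall th, \int[P]_w cos (Z w + th) = cos th * expR (- (v / 2)).

Section gaussian_theory.
Context d (O : measurableType d) (R : realType) (P : probability O R).

Lemma measurable_cosD (Z : O -> R) th : measurable_fun [set: O] Z ->
  measurable_fun [set: O] (fun w => cos (Z w + th)).
Proof.
move=> mZ; apply: (measurableT_comp (@measurable_cosR R)).
exact: measurable_funD.
Qed.

(** Cosines are bounded by 1, so the defining identity survives pointwise limits. This carries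
    Gaussianity from discretised stochastic integrals to the Levy areas. *)
Lemma gaussian_cvg (Z_ : nat -> O -> R) (v_ : nat -> R) (Z : O -> R) (v : R) :
    (forall n, gaussian P (Z_ n) (v_ n)) ->
    (forall w, Z_ n w @[n --> \oo] --> Z w) -> v_ n @[n --> \oo] --> v ->
  gaussian P Z v.
Proof.
move=> gZ cZ cv; split.
  apply: (@measurable_fun_cvg _ _ _ _ Z_) => [n|w _]; first exact: (gZ n).1.
  exact: cZ.
move=> th.
have [||||_ c1] := @Rdominated_convergence _ _ _ P
    (fun n w => cos (Z_ n w + th)) (fun w => cos (Z w + th)) (cst 1).
- by move=> n; apply: measurable_cosD; exact: (gZ n).1.
- move=> w; apply: (cvg_comp _ (@cos R)); last exact: continuous_cos.
  by apply: cvgD; [exact: cZ|exact: cvg_cst].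
- by apply: (@bounded_integrable _ _ _ P _ 1) => // w; rewrite normr1.
- by move=> n w; exact: cos_max.
have c2 : cos th * expR (- (v_ n / 2)) @[n --> \oo] --> cos th * expR (- (v / 2)).
  apply: cvgM; first exact: cvg_cst.
  apply: (cvg_comp _ (@expR R)); last exact: continuous_expR.
  by apply: cvgN; apply: cvgM; [exact: cv|exact: cvg_cst].
have e : (fun n => \int[P]_w cos (Z_ n w + th)) =
    (fun n => cos th * expR (- (v_ n / 2))).
  by apply/funext => n; exact: (gZ n).2.
by rewrite e in c1; exact: (cvg_unique _ c1 c2).
Qed.

(** [normal_prob] is Lebesgue measure weighted by the normal density, so the expectation becomes the
    integral [Rintegral_normal_pdf_cos], by comparing weight 1 under [P] with weight
    [normal_pdf 0 s]. *)
Lemma gaussian_normal (X : O -> R) (s c : R) : 0 < s ->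
    measurable_fun [set: O] X ->
    (forall B, measurable B -> P (X @^-1` B) = normal_prob 0 s B) ->
  gaussian P (fun w => c * X w) ((s * c) ^+ 2).
Proof.
move=> s0 mX XP; split; first exact: measurable_funM.
move=> th; rewrite -(Rintegral_normal_pdf_cos s0).
have := @weighted_law_ext _ _ _ _ _ P (@lebesgue_measure R) (cst 1)
  (normal_pdf 0 s) X id _ _ mX _ _ (fun x => cos (c * x + th)) 1.
have mcos : measurable_fun [set: R] (fun x => cos (c * x + th)).
  by apply: (measurableT_comp (@measurable_cosR R)); apply: measurable_funD => //;
    exact: measurable_funM.
move=> H; under eq_Rintegral do rewrite -[cos _]mul1r.
apply: H => //.
- by apply: (@bounded_integrable _ _ _ P _ 1) => // w; rewrite normr1.
- exact: integrable_normal_pdf.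
- move=> B mB; under eq_Rintegral do rewrite mul1r.
  rewrite Rintegral_indic_comp//.
  rewrite XP// /normal_prob -/(Rintegral _ _ _) Rintegral_mkcond.
  apply: eq_Rintegral => x _; rewrite patchE [\1_B _]indicE.
  by case: ifP => _; rewrite ?mulr1 ?mulr0.
- by move=> x; exact: cos_max.
Qed.

Section sum.
Variables (n : nat) (Z : 'I_n -> O -> R) (v : 'I_n -> R).
Hypothesis gZ : forall i, gaussian P (Z i) (v i).
Hypothesis indepZ : mutually_independent P [set: 'I_n] Z.

Let mZ i : measurable_fun [set: O] (Z i). Proof. exact: (gZ i).1. Qed.

Let J (B : 'I_n -> set R) (s : seq 'I_n) (w : O) : R :=
  \prod_(i | i \notin s) \1_(B i) (Z i w).

Let mJ B s : (forall i, measurable (B i)) -> measurable_fun [set: O] (J B s).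
Proof.
move=> mB; rewrite /J; under eq_fun do rewrite -big_filter.
by apply: measurable_prod => i _; exact: measurable_indic_comp.
Qed.

Let J_le1 B s w : `|J B s w| <= 1.
Proof.
rewrite normr_prod; apply: prodr_ile1 => i _.
by rewrite normr_ge0 normr_indic_le1.
Qed.

Let iJ B s (h : O -> R) : (forall i, measurable (B i)) ->
    measurable_fun [set: O] h -> (forall w, `|h w| <= 1) ->
  P.-integrable [set: O] (EFin \o (fun w => J B s w * h w)).
Proof.
move=> mB mh h1; apply: (@bounded_integrable _ _ _ P _ 1) => [|w].
  by apply: measurable_funM => //; exact: mJ.
by rewrite normrM mulr_ile1.
Qed.

(** Independence speaks of events, the claim of the cosine of a sum. The induction moves one
    variable at a time from the indicators into the sum; [B] stays arbitrary because the step
    replaces [B i0] by a test set [C]. Once [s] lists all indices, no indicator is left. *)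
Let key (s : seq 'I_n) : uniq s -> forall B : 'I_n -> set R,
  (forall i, measurable (B i)) -> forall th,
  \int[P]_w (J B s w * cos (\sum_(i <- s) Z i w + th)) =
  (\prod_(i | i \notin s) \int[P]_w \1_(B i) (Z i w)) *
  (cos th * expR (- ((\sum_(i <- s) v i) / 2))).
Proof.
have mZB B i : measurable (B i) -> measurable (Z i @^-1` B i).
  by move=> mB; rewrite -[Z i @^-1` B i]setTI; exact: mZ.
elim: s => [_ B mB th|i0 s IH /= /andP[i0s us] B mB th].
  under eq_Rintegral do rewrite big_nil add0r.
  rewrite RintegralZr//; last first.
    by apply: (@bounded_integrable _ _ _ P _ 1) => //; exact: mJ.
  rewrite big_nil mul0r oppr0 expR0 mulr1; congr (_ * _).
  transitivity (\int[P]_w \1_(\bigcap_(i in [set: 'I_n]) (Z i @^-1` B i)) w : R).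
    apply: eq_Rintegral => w _; rewrite /J indicE.
    case: (pselect (forall i, Z i w \in B i)) => H.
      rewrite big1 => [|i _]; last by rewrite indicE H.
      by rewrite mem_set// => i _ /=; rewrite -in_setE.
    rewrite memNset => [|/= H']; last by apply: H => i; rewrite in_setE; exact: H'.
    have /existsNP[i Hi] := H.
    by rewrite (bigD1 i)//= indicE; move/negP/negbTE: Hi => ->; rewrite mul0r.
  rewrite Rintegral_indicE; last first.
    by apply: fin_bigcap_measurable => // i _; exact: mZB.
  rewrite (indepZ (f := id))//.
  transitivity (fine (\prod_(i < n) (fine (P (Z i @^-1` B i)))%:E)%E).
    congr fine; apply: eq_bigr => i _; rewrite fineK//.
    by apply: fin_num_measure; exact: mZB.
  rewrite prodEFin/=; apply: eq_bigr => i _.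
  by rewrite Rintegral_indic_comp.
have mS t : measurable_fun [set: O] (fun w => \sum_(i <- s) Z i w + t).
  by apply: measurable_funD => //; exact: measurable_sum.
have mcS t := measurableT_comp (@measurable_cosR R) (mS t).
pose K t := (\prod_(i | i \notin i0 :: s) \int[P]_w \1_(B i) (Z i w)) *
  (cos t * expR (- ((\sum_(i <- s) v i) / 2))).
(* By induction, conditionally on the sum over [s] and the other events,
   the law of [Z i0] is the unconditional one. *)
have Kf t (f : R -> R) : measurable_fun [set: R] f -> (forall x, `|f x| <= 1) ->
    \int[P]_w (J B (i0 :: s) w * cos (\sum_(i <- s) Z i w + t) * f (Z i0 w)) =
    K t * \int[P]_w f (Z i0 w).
  move=> mf f1.
  rewrite -RintegralZl//; last first.
    by apply: (@bounded_integrable _ _ _ P _ 1) => //; exact: measurableT_comp.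
  apply: (@weighted_law_ext _ _ _ _ _ P P _ (cst (K t)) (Z i0) (Z i0) _ _ _ _ _ f 1) => //.
  - by apply: iJ => // [|w]; [exact: mcS|exact: cos_max].
  - exact: (@bounded_integrable _ _ _ P _ `|K t|).
  move=> C mC; pose B' i := if i == i0 then C else B i.
  have mB' i : measurable (B' i) by rewrite /B'; case: ifP.
  rewrite RintegralZl//; last first.
    by apply: (@bounded_integrable _ _ _ P _ 1) => [|w];
      [exact: measurable_indic_comp|exact: normr_indic_le1].
  have eB' (F : set R -> 'I_n -> R) : \prod_(i | i \notin s) F (B' i) i =
      F C i0 * \prod_(i | i \notin i0 :: s) F (B i) i.
    rewrite (bigD1 i0)//= {1}/B' eqxx; congr (_ * _).
    rewrite (eq_bigl (fun i => i \notin i0 :: s)) => [|i].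
      apply: eq_bigr => i; rewrite inE negb_or => /andP[/negbTE ii0 _].
      by rewrite /B' ii0.
    by rewrite inE negb_or andbC.
  have := IH us B' mB' t.
  rewrite (eB' (fun C i => \int[P]_w \1_C (Z i w))) => E.
  transitivity (\int[P]_w (J B' s w * cos (\sum_(i <- s) Z i w + t))).
    apply: eq_Rintegral => w _; rewrite /J (eB' (fun C i => \1_C (Z i w))); ring.
  by rewrite E /K; ring.
have [_ gZ0] := gZ i0.
have c0 : \int[P]_w cos (Z i0 w) = expR (- (v i0 / 2)).
  by have := gZ0 0; under eq_Rintegral do rewrite addr0; rewrite cos0 mul1r.
(* The phase - pi / 2 turns the cosine into a sine, and [cos (- pi / 2) = 0]. *)
have s0 : \int[P]_w sin (Z i0 w) = 0.
  have := gZ0 (- (pi / 2)); under eq_Rintegral do rewrite cosBpihalf.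
  by rewrite cosN cos_pihalf mul0r.
have Kc := Kf th _ (@measurable_cosR R) (@cos_max R).
have Ks := Kf (th - pi / 2) _ (@measurable_sinR R) (@sin_max R).
rewrite s0 mulr0 in Ks; rewrite c0 in Kc.
(* Addition formula for the cosine. The sine of the sum over [s] is written as a cosine of phase
   [th - pi / 2], the form to which [Kf] applies. *)
transitivity (\int[P]_w (J B (i0 :: s) w * cos (\sum_(i <- s) Z i w + th) * cos (Z i0 w)
   - J B (i0 :: s) w * cos (\sum_(i <- s) Z i w + (th - pi / 2)) * sin (Z i0 w))).
  apply: eq_Rintegral => w _; rewrite big_cons (addrA _ th) cosBpihalf -!mulrA -mulrBr.
  by rewrite -cosD; congr (_ * cos _); ring.
have iJ2 t (f : R -> R) : measurable_fun [set: R] f -> (forall x, `|f x| <= 1) ->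
  P.-integrable [set: O] (EFin \o (fun w =>
    J B (i0 :: s) w * cos (\sum_(i <- s) Z i w + t) * f (Z i0 w))).
  move=> mf f1; have := @iJ B (i0 :: s)
    (fun w => cos (\sum_(i <- s) Z i w + t) * f (Z i0 w)) mB.
  under [X in _ -> _ -> _.-integrable _ (_ \o X)]eq_fun do rewrite mulrA.
  apply; first by apply: measurable_funM; [exact: mcS|exact: measurableT_comp].
  by move=> w; rewrite normrM mulr_ile1// cos_max.
rewrite RintegralB//; first by rewrite Kc Ks subr0 /K big_cons mulrDl opprD expRD; ring.
- exact: (iJ2 _ _ (@measurable_cosR R) (@cos_max R)).
- exact: (iJ2 _ _ (@measurable_sinR R) (@sin_max R)).
Qed.

Lemma gaussian_sum : gaussian P (fun w => \sum_i Z i w) (\sum_i v i).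
Proof.
split; first exact: measurable_sum.
move=> th.
have := key (index_enum_uniq _) (fun=> measurableT) th.
rewrite [\prod_(i | _) _]big1 => [|i]; last by rewrite mem_index_enum.
rewrite mul1r => <-; apply: eq_Rintegral => w _.
by rewrite /J [\prod_(i | _) _]big1 ?mul1r// => i; rewrite mem_index_enum.
Qed.

End sum.
End gaussian_theory.

Section independence.
Context d (O : measurableType d) (R : realType) (P : probability O R).

Lemma mutually_independent_comp d1 (T1 : measurableType d1)
    d2 (T2 : measurableType d2) (I : Type) (D : set I)
    (X : I -> O -> T1) (phi : I -> T1 -> T2) :
    (forall i, measurable_fun [set: T1] (phi i)) ->
  mutually_independent P D X ->
  mutually_independent P D (fun i w => phi i (X i w)).
Proof.
move=> mphi indepX n f finj fD B mB.
apply: (indepX n f finj fD (fun i => phi (f i) @^-1` B i)) => i.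
by rewrite -[X in measurable X]setTI; exact: mphi.
Qed.

Lemma mutually_independent_inj d1 (T1 : measurableType d1) (I J : Type)
    (D : set I) (X : I -> O -> T1) (h : J -> I) :
    injective h -> (forall j, D (h j)) ->
  mutually_independent P D X ->
  mutually_independent P [set: J] (fun j => X (h j)).
Proof.
move=> hinj hD indepX n f finj _ B mB.
exact: (indepX n (h \o f) (inj_comp hinj finj) (fun i => hD (f i)) B mB).
Qed.

Lemma gaussian_isotropic k (X : O -> k.-tuple R) (v : R) (c : 'I_k -> R) :
    0 < v -> isotropic_normal P X v ->
  gaussian P (fun w => \sum_j c j * tnth (X w) j) (\sum_j c j ^+ 2 * v).
Proof.
move=> v0 [mX indepX nX].
apply: (@gaussian_sum _ _ _ P k (fun j w => c j * tnth (X w) j)).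
  move=> j; have mXj := (measurable_fun_tnthP X).1 mX j.
  have s0 : 0 < Num.sqrt v by rewrite sqrtr_gt0.
  have := gaussian_normal (c j) s0 mXj (nX j).
  by rewrite exprMn sqr_sqrtr ?ltW// mulrC.
apply: (mutually_independent_comp (phi := fun j x => c j * x)) => // j.
exact: measurable_funM.
Qed.

(** Serves both sides: the vectors are the noise of the sites, or the Brownian increments over a
    grid. Independence between vectors handles the outer sum, independence of the coordinates of one
    vector the inner sum. *)
Lemma gaussian_independent_sum k n (I : Type) (D : set I)
    (X : I -> O -> k.-tuple R) (v : I -> R) (f : 'I_n -> I)
    (c : 'I_n -> 'I_k -> R) :
    injective f -> (forall i, D (f i)) -> (forall i, D i -> 0 < v i) ->
    (forall i, D i -> isotropic_normal P (X i) (v i)) ->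
    mutually_independent P D X ->
  gaussian P (fun w => \sum_i \sum_j c i j * tnth (X (f i) w) j)
    (\sum_i \sum_j c i j ^+ 2 * v (f i)).
Proof.
move=> finj fD v0 nX indepX.
apply: (@gaussian_sum _ _ _ P n (fun i w => \sum_j c i j * tnth (X (f i) w) j)).
  by move=> i; apply: gaussian_isotropic; [exact: v0|exact: nX].
apply: (@mutually_independent_comp _ _ _ _ _ _ (fun i => X (f i))
  (fun i (x : k.-tuple R) => \sum_j c i j * tnth x j)).
  move=> i; apply: measurable_sum => j; apply: measurable_funM => //.
  exact: measurable_tnth.
exact: mutually_independent_inj indepX.
Qed.

End independence.

(** * Uniqueness of characteristic functions *)

Section fubini.
Context d (O : measurableType d) (R : realType) (P : probability O R).
Local Notation mu := (@lebesgue_measure R).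

(** A bound on the inner integral that is uniform in [w] gives integrability on the product, since
    [P] has mass 1. *)
Lemma Rfubini (F : O -> R -> R) (M : R) :
    measurable_fun [set: O * R] (fun z => F z.1 z.2) ->
    (forall u, P.-integrable [set: O] (EFin \o F ^~ u)) ->
    (forall w, mu.-integrable [set: R] (EFin \o F w)) ->
    (forall w, \int[mu]_u `|F w u| <= M) ->
  \int[P]_w \int[mu]_u F w u = \int[mu]_u \int[P]_w F w u.
Proof.
move=> mF iP imu FM.
have mF' : measurable_fun [set: O * R] (fun z => (F z.1 z.2)%:E).
  exact/measurable_EFinP.
have iF : (P \x mu)%E.-integrable [set: O * R] (fun z => (F z.1 z.2)%:E).
  apply/(integrable12ltyP P mu mF') => /=.
  apply: (@le_lt_trans _ _ (\int[P]_w M%:E)%E).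
    apply: ge0_le_integral => //.
    - by move=> w _; apply: integral_ge0.
    - apply: (measurable_fun_fubini_tonelli_F (m2 := mu) (fun z => `|F z.1 z.2|%:E)) => //.
      by apply/measurable_EFinP; exact: measurableT_comp.
    - move=> w _.
      have : (\int[mu]_u `|F w u|)%:E = (\int[mu]_y `|(F w y)%:E|)%E.
        rewrite /Rintegral fineK//.
        by have := integrable_fin_num measurableT (integrable_abse (imu w)).
      by move=> <-; rewrite lee_fin.
  by rewrite integral_cst//= -[X in (_ * X)%E]fineK ?fin_num_measure// -EFinM ltry.
have := Fubini iF; rewrite /= => E.
rewrite /Rintegral.
under eq_integral => w _ do rewrite fineK ?(integrable_fin_num measurableT (imu w))//.
rewrite E; congr fine; apply: eq_integral => u _.
by rewrite fineK ?(integrable_fin_num measurableT (iP u)).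
Qed.

End fubini.
Section approximate_identity.
Variable R : realType.
Local Notation mu := (@lebesgue_measure R).
Variable f : R -> R.
Hypothesis cf : continuous f.
Hypothesis f0 : forall x, 0 <= f x.
Hypothesis f1 : forall x, f x <= 1.

Let mf : measurable_fun [set: R] f. Proof. exact: continuous_measurable_fun. Qed.

Let f1' x : `|f x| <= 1. Proof. by rewrite ger0_norm. Qed.

Lemma Rintegral_normal_pdf_shift (x t : R) : 0 < t ->
  \int[mu]_y (f y * normal_pdf x t y) =
  \int[mu]_z (f (x + t * z) * normal_pdf 0 1 z).
Proof.
move=> t0; have tn0 : t != 0 by rewrite gt_eqF.
pose F (z : R) : R := x + t * z.
have dF (z : R) : is_derive z 1 F t.
  have -> : F = cst x \+ t \*: id by [].
  apply: (is_derive_eq (is_deriveD (is_derive_cst x z 1) (is_deriveZ t (is_derive_id z 1)))).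
  by rewrite add0r; exact: mulr1.
have F'E : F^`()%classic = cst t.
  by apply/funext => z; rewrite derive1E derive_val.
rewrite /Rintegral; apply: (congr1 fine).
rewrite (@increasing_ge0_integration_by_substitutionT _ F
  (fun y => f y * normal_pdf x t y)).
- apply: eq_integral => z _; congr EFin.
  rewrite /= F'E [LHS]/GRing.mul/= /F -mulrA; congr (_ * _).
  rewrite !normal_pdfE// ?oner_neq0// /normal_fun /normal_peak subr0 mulrAC.
  have -> : Num.sqrt (t ^+ 2 * pi *+ 2) = t * Num.sqrt (1 ^+ 2 * pi *+ 2).
    by rewrite expr1n mul1r -mulrnAr sqrtrM ?sqr_ge0// sqrtr_sqr gtr0_norm.
  have p0 : Num.sqrt (1 ^+ 2 * pi *+ 2) != 0 :> R.
    by rewrite expr1n mul1r gt_eqF// sqrtr_gt0 mulrn_wgt0// pi_gt0.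
  have -> : (t * Num.sqrt (1 ^+ 2 * pi *+ 2))^-1 * t = (Num.sqrt (1 ^+ 2 * pi *+ 2))^-1.
    by field; apply/andP.
  congr (_ * expR _); rewrite expr1n -mulr_natr.
  by field.
- by move=> a b ab; rewrite /F ltrD2l ltr_pM2l.
- by rewrite F'E => z; exact: cvg_cst.
- by rewrite F'E; exact: is_cvg_cst.
- by rewrite F'E; exact: is_cvg_cst.
- by move=> z; exact: ex_derive.
- by apply: (cvg_comp _ (fun z => x + z)); [exact: gt0_cvgMrNy cvg_id|exact: cvg_addrl_Ny].
- by apply: (cvg_comp _ (fun z => x + z)); [exact: gt0_cvgMry cvg_id|exact: cvg_addrl].
- by move=> y; apply: cvgM; [exact: cf|exact: continuous_normal_pdf].
- by move=> y; rewrite mulr_ge0// normal_pdf_ge0.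
Qed.

(** After the substitution [y = x + t z] the normal density is free of [t] and dominates the
    integrand, because [f <= 1]; continuity of [f] at [x] gives the pointwise limit. *)
Lemma approximate_identity (x : R) :
  \int[mu]_y (f y * normal_pdf x n.+1%:R^-1 y) @[n --> \oo] --> f x.
Proof.
have ipdf : mu.-integrable [set: R] (EFin \o normal_pdf 0 1).
  exact: integrable_normal_pdf.
have mpdf := measurable_normal_pdf (0 : R) 1.
have mfx (t : R) : measurable_fun [set: R] (fun z => f (x + t * z)).
  apply: (measurableT_comp mf); apply: measurable_funD; first exact: measurable_cst.
  by apply: measurable_funM; [exact: measurable_cst|exact: measurable_id].
have [||||_] := @Rdominated_convergence _ _ _ mu
  (fun n z => f (x + n.+1%:R^-1 * z) * normal_pdf 0 1 z)
  (fun z => f x * normal_pdf 0 1 z) (normal_pdf 0 1).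
- by move=> n; exact: (measurable_funM (mfx _) mpdf).
- move=> z; apply: cvgM; last exact: cvg_cst.
  apply: continuous_cvg; first exact: cf.
  rewrite -[X in _ --> X]addr0; apply: cvgD; first exact: cvg_cst.
  rewrite -(mul0r z); apply: cvgM; last exact: cvg_cst.
  exact: cvg_harmonic.
- exact: ipdf.
- move=> n z; rewrite normrM [X in _ * X]ger0_norm ?normal_pdf_ge0//.
  by rewrite ler_piMl ?normal_pdf_ge0.
rewrite RintegralZl// (_ : \int[mu]_z _ = 1); last first.
  by rewrite /Rintegral integral_normal_pdf.
rewrite mulr1.
have -> : (fun n => \int[mu]_y (f y * normal_pdf x n.+1%:R^-1 y)) =
    (fun n => \int[mu]_z (f (x + n.+1%:R^-1 * z) * normal_pdf 0 1 z)).
  by apply/funext => n; rewrite Rintegral_normal_pdf_shift// invr_gt0.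
by [].
Qed.

End approximate_identity.

(* The density, computed by Fourier inversion from [A u a = E (cos (u X + a))],
   of [X] plus an independent centred normal of standard deviation [t]. *)
Definition char_smooth (R : realType) (A : R -> R -> R) (t y : R) : R :=
  normal_peak t * \int[@lebesgue_measure R]_u
    (normal_pdf 0 t^-1 u * A u (- (u * y))).

Section smoothing.
Context d (O : measurableType d) (R : realType) (P : probability O R).
Local Notation mu := (@lebesgue_measure R).
Variables (g X : O -> R).
Hypothesis mg : measurable_fun [set: O] g.
Hypothesis g1 : forall w, `|g w| <= 1.
Hypothesis mX : measurable_fun [set: O] X.

Let A (u a : R) := \int[P]_w (g w * cos (u * X w + a)).

(** The Gaussian is its own Fourier transform up to scale: the density of deviation [t] is a
    multiple of the characteristic function of deviation [1 / t]. *)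
Lemma normal_pdf_charfun (t x y : R) : 0 < t ->
  normal_pdf x t y =
  normal_peak t * \int[mu]_u (normal_pdf 0 t^-1 u * cos ((x - y) * u + 0)).
Proof.
move=> t0; rewrite Rintegral_normal_pdf_cos ?invr_gt0// cos0 mul1r.
rewrite normal_pdfE ?gt_eqF// /normal_fun; congr (_ * expR _).
rewrite -mulr_natr; field; exact: lt0r_neq0.
Qed.

Lemma measurable_normal_pdf_mean (t y : R) : 0 < t ->
  measurable_fun [set: O] (fun w => normal_pdf (X w) t y).
Proof.
move=> t0; have -> : (fun w => normal_pdf (X w) t y) = normal_pdf y t \o X.
  apply/funext => w /=; rewrite !normal_pdfE ?gt_eqF// /normal_fun.
  by rewrite -(opprB (X w) y) sqrrN.
by apply: measurableT_comp => //; exact: measurable_normal_pdf.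
Qed.

(** Writing the density as a Fourier integral and exchanging it with the expectation leaves an
    expression in [A] alone. This is how [A] determines the smoothed law of [X] under the weight
    [g]. *)
Let expectation_pdf (t y : R) : 0 < t ->
  \int[P]_w (g w * normal_pdf (X w) t y) = char_smooth A t y.
Proof.
move=> t0; have ipdf := integrable_normal_pdf (0 : R) t^-1.
have mpdf : measurable_fun [set: R] (normal_pdf (0 : R) t^-1).
  exact: measurable_normal_pdf.
pose F w u := g w * (normal_pdf 0 t^-1 u * cos ((X w - y) * u + 0)).
have ic c : mu.-integrable [set: R]
    (EFin \o (fun u => normal_pdf 0 t^-1 u * cos (c * u + 0))).
  apply: (@integrableM_bounded _ _ _ mu (normal_pdf 0 t^-1) _ 1) => //.
    apply: (measurableT_comp (@measurable_cosR R)).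
    by apply: measurable_funD => //; exact: measurable_funM.
  by move=> x; exact: cos_max.
have iw w : mu.-integrable [set: R] (EFin \o F w).
  exact: (integrableZl measurableT (g w) (ic (X w - y))).
have EF w : \int[mu]_u F w u = (normal_peak t)^-1 * (g w * normal_pdf (X w) t y).
  rewrite normal_pdf_charfun// (RintegralZl (g w) measurableT (ic (X w - y))).
  by field; rewrite gt_eqF// normal_peak_gt0// gt_eqF.
have ih : P.-integrable [set: O] (EFin \o (fun w => g w * normal_pdf (X w) t y)).
  apply: (@bounded_integrable _ _ _ P _ (normal_peak t)) => [|w].
    by apply: measurable_funM => //; exact: measurable_normal_pdf_mean.
  rewrite normrM (ger0_norm (normal_pdf_ge0 _ _ _)).
  apply: le_trans (normal_pdf_ub (X w) y (lt0r_neq0 t0)).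
  by rewrite ler_piMl ?normal_pdf_ge0.
transitivity (normal_peak t * \int[P]_w \int[mu]_u F w u).
  under [in RHS]eq_Rintegral do rewrite EF.
  rewrite RintegralZl// mulrA divff ?mul1r//.
  by rewrite gt_eqF// normal_peak_gt0// gt_eqF.
congr (_ * _); rewrite (@Rfubini _ _ _ P F 1)//.
- apply: eq_Rintegral => u _.
  rewrite /A -RintegralZl//.
    by apply: eq_Rintegral => w _; rewrite /F mulrCA; congr (_ * (_ * cos _)); ring.
  apply: (@bounded_integrable _ _ _ P _ 1) => [|w].
    by apply: measurable_funM => //; apply: measurable_cosD; exact: measurable_funM.
  by rewrite normrM mulr_ile1// cos_max.
- apply: measurable_funM; first exact: (measurableT_comp mg measurable_fst).
  apply: measurable_funM; first exact: (measurableT_comp mpdf measurable_snd).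
  apply: measurable_cosD; apply: measurable_funM => //.
  by apply: measurable_funB => //; exact: (measurableT_comp mX measurable_fst).
- move=> u; apply: (@bounded_integrable _ _ _ P _ (normal_pdf 0 t^-1 u)) => [|w].
    apply: measurable_funM => //; apply: measurable_funM => //.
    by apply: measurable_cosD; apply: measurable_funM => //; exact: measurable_funB.
  rewrite normrM (le_trans (ler_piMl _ (g1 w)))// normrM.
  by rewrite (ger0_norm (normal_pdf_ge0 _ _ _)) ler_piMr ?cos_max// normal_pdf_ge0.
- move=> w; rewrite -[leRHS](_ : \int[mu]_u normal_pdf 0 t^-1 u = 1).
    apply: le_Rintegral => // [|u _]; first exact: (integrable_abse (iw w)).
    rewrite normrM (le_trans (ler_piMl _ (g1 w)))// normrM.
    by rewrite (ger0_norm (normal_pdf_ge0 _ _ _)) ler_piMr ?cos_max// normal_pdf_ge0.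
  by rewrite /Rintegral integral_normal_pdf.
Qed.

(** By Fubini the left side is the expectation of [g] times the Gaussian smoothing of [f] at [X].
    The smoothing is bounded by 1 and tends to [f (X w)]. *)
Lemma char_smooth_cvg (f : R -> R) : continuous f ->
    (forall x, 0 <= f x) -> (forall x, f x <= 1) ->
  \int[mu]_y (f y * char_smooth A n.+1%:R^-1 y) @[n --> \oo] -->
  \int[P]_w (g w * f (X w)).
Proof.
move=> cf f0 f1.
have f1' x : `|f x| <= 1 by rewrite ger0_norm.
have mf : measurable_fun [set: R] f by exact: continuous_measurable_fun.
have mpdf (t : R) := measurable_normal_pdf (0 : R) t.
pose s (x t : R) := \int[mu]_y (f y * normal_pdf x t y).
have ifp (x t : R) : mu.-integrable [set: R] (EFin \o (fun y => f y * normal_pdf x t y)).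
  have -> : (fun y => f y * normal_pdf x t y) = (fun y => normal_pdf x t y * f y).
    by apply/funext => y; rewrite mulrC.
  apply: (@integrableM_bounded _ _ _ mu (normal_pdf x t) _ 1) => //.
  exact: integrable_normal_pdf.
have s1 (x t : R) : `|s x t| <= 1.
  apply: le_trans (le_normr_Rintegral _ (ifp x t)) _ => //.
  have <- : \int[mu]_y normal_pdf x t y = 1.
    by rewrite /Rintegral integral_normal_pdf.
  apply: le_Rintegral => //.
  - exact: (integrable_abse (ifp x t)).
  - exact: integrable_normal_pdf.
  - by move=> y _; rewrite normrM (ger0_norm (normal_pdf_ge0 _ _ _)) ler_piMl ?normal_pdf_ge0.
have mfp t : 0 < t ->
    measurable_fun [set: O * R] (fun z => f z.2 * normal_pdf (X z.1) t z.2).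
  move=> t0; apply: measurable_funM; first exact: (measurableT_comp mf measurable_snd).
  have -> : (fun z : O * R => normal_pdf (X z.1) t z.2) =
      normal_pdf 0 t \o (fun z : O * R => z.2 - X z.1).
    by apply/funext => z /=; rewrite !normal_pdfE ?gt_eqF// /normal_fun subr0.
  apply: (measurableT_comp (mpdf t)); apply: measurable_funB; first exact: measurable_snd.
  exact: (measurableT_comp mX measurable_fst).
have E t : 0 < t -> \int[mu]_y (f y * char_smooth A t y) = \int[P]_w (g w * s (X w) t).
  move=> t0; pose F w y := g w * (f y * normal_pdf (X w) t y).
  have iw w : mu.-integrable [set: R] (EFin \o F w).
    exact: (integrableZl measurableT (g w) (ifp (X w) t)).
  have mXt y := measurable_normal_pdf_mean y t0.
  transitivity (\int[mu]_y \int[P]_w F w y).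
    apply: eq_Rintegral => y _; rewrite -expectation_pdf// -RintegralZl//.
      by apply: eq_Rintegral => w _; rewrite /F mulrCA.
    apply: (@bounded_integrable _ _ _ P _ (normal_peak t)) => [|w].
      exact: measurable_funM.
    rewrite normrM (ger0_norm (normal_pdf_ge0 _ _ _)).
    apply: le_trans (normal_pdf_ub (X w) y (lt0r_neq0 t0)).
    by rewrite ler_piMl ?normal_pdf_ge0.
  rewrite -(@Rfubini _ _ _ P F 1).
  - by apply: eq_Rintegral => w _; exact: (RintegralZl (g w) measurableT (ifp (X w) t)).
  - apply: measurable_funM; first exact: (measurableT_comp mg measurable_fst).
    exact: mfp.
  - move=> y; apply: (@bounded_integrable _ _ _ P _ (normal_peak t)) => [|w].
      by apply: measurable_funM => //; exact: measurable_funM.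
    rewrite normrM (le_trans (ler_piMl _ (g1 w)))// normrM.
    rewrite (ger0_norm (normal_pdf_ge0 _ _ _)).
    apply: le_trans (normal_pdf_ub (X w) y (lt0r_neq0 t0)).
    by rewrite ler_piMl ?normal_pdf_ge0.
  - exact: iw.
  - move=> w; rewrite -[leRHS](_ : \int[mu]_y normal_pdf (X w) t y = 1).
      apply: le_Rintegral => // [||y _]; first exact: (integrable_abse (iw w)).
        exact: integrable_normal_pdf.
      rewrite normrM (le_trans (ler_piMl _ (g1 w)))// normrM.
      by rewrite (ger0_norm (normal_pdf_ge0 _ _ _)) ler_piMl// normal_pdf_ge0.
    by rewrite /Rintegral integral_normal_pdf.
have ms t : 0 < t -> measurable_fun [set: O] (fun w => s (X w) t).
  move=> t0; apply: (@measurableT_comp _ _ _ _ _ _ (@fine R)) => //.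
  apply: (@measurable_fun_fubini_tonelli_F _ _ _ _ _ mu
    (fun z : O * R => (f z.2 * normal_pdf (X z.1) t z.2)%:E)) => [|z].
    by apply/measurable_EFinP; exact: mfp.
  by rewrite lee_fin mulr_ge0// normal_pdf_ge0.
have [||||_] := @Rdominated_convergence _ _ _ P
  (fun n w => g w * s (X w) n.+1%:R^-1) (fun w => g w * f (X w)) (cst 1).
- by move=> n; apply: measurable_funM => //; apply: ms; rewrite invr_gt0.
- move=> w; apply: cvgM; first exact: cvg_cst.
  exact: (approximate_identity cf f0 f1).
- by apply: (@bounded_integrable _ _ _ P _ 1) => // w; rewrite normr1.
- by move=> n w; rewrite normrM mulr_ile1.
have -> : (fun n => \int[mu]_y (f y * char_smooth A n.+1%:R^-1 y)) =
    (fun n => \int[P]_w (g w * s (X w) n.+1%:R^-1)).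
  by apply/funext => n; rewrite E// invr_gt0.
by [].
Qed.

End smoothing.

Section weighted_law_unique.
Context d1 (O1 : measurableType d1) d2 (O2 : measurableType d2) (R : realType).
Variables (P1 : probability O1 R) (P2 : probability O2 R).
Variables (g1 X1 : O1 -> R) (g2 X2 : O2 -> R).
Hypothesis mg1 : measurable_fun [set: O1] g1.
Hypothesis mg2 : measurable_fun [set: O2] g2.
Hypothesis g1_le1 : forall w, `|g1 w| <= 1.
Hypothesis g2_le1 : forall w, `|g2 w| <= 1.
Hypothesis mX1 : measurable_fun [set: O1] X1.
Hypothesis mX2 : measurable_fun [set: O2] X2.
Hypothesis eq_char : forall u a : R,
  \int[P1]_w (g1 w * cos (u * X1 w + a)) = \int[P2]_w (g2 w * cos (u * X2 w + a)).

Let eq_continuous (f : R -> R) : continuous f ->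
    (forall x, 0 <= f x) -> (forall x, f x <= 1) ->
  \int[P1]_w (g1 w * f (X1 w)) = \int[P2]_w (g2 w * f (X2 w)).
Proof.
move=> cf f0 f1.
have c1 := char_smooth_cvg (P := P1) mg1 g1_le1 mX1 cf f0 f1.
have c2 := char_smooth_cvg (P := P2) mg2 g2_le1 mX2 cf f0 f1.
have e : (fun u a => \int[P1]_w (g1 w * cos (u * X1 w + a))) =
    (fun u a => \int[P2]_w (g2 w * cos (u * X2 w + a))).
  by apply/funext => u; apply/funext => a; exact: eq_char.
by rewrite e in c1; exact: (cvg_unique _ c1 c2).
Qed.

(** Since [|x - b| + (x - b)] is twice the positive part of [x - b], these continuous functions
    increase with [n] to the indicator of the open ray starting at [b]. *)
Let f_ (b : R) (n : nat) (x : R) : R := 1 - expR (- (n%:R * (`|x - b| + (x - b)))).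

Let f_0 b n x : 0 <= f_ b n x.
Proof.
rewrite subr_ge0 -expR0 ler_expR oppr_le0 mulr_ge0//.
by have := ler_norm (b - x); rewrite distrC; lra.
Qed.

Let f_1 b n x : f_ b n x <= 1.
Proof. by rewrite gerBl expR_ge0. Qed.

Let cf_ b n : continuous (f_ b n).
Proof.
move=> x; apply: cvgB; first exact: cvg_cst.
apply: continuous_cvg; first exact: continuous_expR.
apply: cvgN; apply: cvgM; first exact: cvg_cst.
have c : y - b @[y --> x] --> x - b by apply: cvgB; [exact: cvg_id|exact: cvg_cst].
by apply: cvgD => //; exact: cvg_norm.
Qed.

Let f_cvg b x : f_ b n x @[n --> \oo] --> (\1_(`]b, +oo[%classic) x : R).
Proof.
rewrite indicE; case: (ltP b x) => bx.
  rewrite mem_set/=; last by rewrite in_itv/= bx.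
  have xb : 0 < x - b by rewrite subr_gt0.
  rewrite -[X in _ --> X]subr0; apply: cvgB; first exact: cvg_cst.
  have -> : (fun n => expR (- (n%:R * (`|x - b| + (x - b))))) =
      (fun n => expR (- ((x - b) + (x - b))) ^+ n).
    by apply/funext => n; rewrite gtr0_norm// -mulrN expRM_natl.
  apply: cvg_expr; rewrite ger0_norm ?expR_ge0// expR_lt1 oppr_lt0.
  exact: addr_gt0.
rewrite memNset/=; last by rewrite in_itv/= andbT; apply/negP; rewrite -leNgt.
apply: cvg_near_cst; apply: nearW => n.
by rewrite /f_ ler0_norm ?subr_le0// addNr mulr0 oppr0 expR0 subrr.
Qed.

Let int_indic d (O : measurableType d) (P : probability O R) (g X : O -> R) B :
    measurable_fun [set: O] g -> (forall w, `|g w| <= 1) ->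
    measurable_fun [set: O] X -> measurable B ->
  P.-integrable [set: O] (EFin \o (fun w => g w * \1_B (X w))).
Proof.
move=> mg g_le1 mX mB; apply: (@bounded_integrable _ _ _ P _ 1) => [|w].
  by apply: measurable_funM => //; exact: measurable_indic_comp.
by rewrite normrM mulr_ile1// normr_indic_le1.
Qed.

Let eq_ray b : \int[P1]_w (g1 w * \1_(`]b, +oo[%classic) (X1 w)) =
  \int[P2]_w (g2 w * \1_(`]b, +oo[%classic) (X2 w)).
Proof.
have H d (O : measurableType d) (P : probability O R) (g X : O -> R) :
    measurable_fun [set: O] g -> (forall w, `|g w| <= 1) ->
    measurable_fun [set: O] X ->
  \int[P]_w (g w * f_ b n (X w)) @[n --> \oo] -->
  \int[P]_w (g w * \1_(`]b, +oo[%classic) (X w)).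
  move=> mg g_le1 mX.
  have [||||_] := @Rdominated_convergence _ _ _ P
    (fun n w => g w * f_ b n (X w))
    (fun w => g w * \1_(`]b, +oo[%classic) (X w)) (cst 1) => //.
  - move=> n; apply: measurable_funM => //; apply: measurableT_comp => //.
    exact: continuous_measurable_fun.
  - by move=> w; apply: cvgM; [exact: cvg_cst|exact: f_cvg].
  - by apply: (@bounded_integrable _ _ _ P _ 1) => // w; rewrite normr1.
  - by move=> n w; rewrite normrM mulr_ile1// ger0_norm.
have c1 := H _ _ P1 _ _ mg1 g1_le1 mX1.
have c2 := H _ _ P2 _ _ mg2 g2_le1 mX2.
have e : (fun n => \int[P1]_w (g1 w * f_ b n (X1 w))) =
    (fun n => \int[P2]_w (g2 w * f_ b n (X2 w))).
  by apply/funext => n; apply: eq_continuous; [exact: cf_|exact: f_0|exact: f_1].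
by rewrite e in c1; exact: (cvg_unique _ c1 c2).
Qed.

(** As the weights may change sign, the Dynkin induction from open rays is carried out on the
    integrals themselves, with dominated convergence for disjoint unions. *)
Lemma weighted_law_unique (B : set R) : measurable B ->
  \int[P1]_w (g1 w * \1_B (X1 w)) = \int[P2]_w (g2 w * \1_B (X2 w)).
Proof.
(* Frequency 0 and phase 0 make the cosine equal to 1. Complements need this equality of total
   weights. *)
have totT : \int[P1]_w (g1 w * \1_setT (X1 w)) = \int[P2]_w (g2 w * \1_setT (X2 w)).
  transitivity (\int[P1]_w (g1 w * cos (0 * X1 w + 0))).
    by apply: eq_Rintegral => w _; rewrite mul0r addr0 cos0 indicT.
  rewrite eq_char; apply: eq_Rintegral => w _.
  by rewrite mul0r addr0 cos0 indicT.
have mE : @measurable _ R = <<s @RGenOInfty.G R >> by exact: RGenOInfty.measurableE.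
rewrite mE; move: B; apply: dynkin_induction.
- exact: mE.
- move=> _ _ [x ->] [y ->]; exists (Num.max x y).
  apply/seteqP; split=> z /=; rewrite !in_itv/= !andbT gt_max.
    by case=> -> ->.
  by move=> /andP.
- exact: totT.
- by move=> _ [x ->]; exact: eq_ray.
- move=> B mB EB.
  have H d (O : measurableType d) (P : probability O R) (g X : O -> R) :
      measurable_fun [set: O] g -> (forall w, `|g w| <= 1) ->
      measurable_fun [set: O] X ->
    \int[P]_w (g w * \1_(~` B) (X w)) =
    \int[P]_w (g w * \1_setT (X w)) - \int[P]_w (g w * \1_B (X w)).
    move=> mg g_le1 mX; rewrite -RintegralB//; [|exact: int_indic|exact: int_indic].
    apply: eq_Rintegral => w _; rewrite -mulrBr; congr (_ * _).
    rewrite !indicE in_setT in_setC; case: (_ \in B); first by rewrite subrr.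
    by rewrite subr0.
  by rewrite H// H// totT EB.
- move=> F mF tF EF.
  have H d (O : measurableType d) (P : probability O R) (g X : O -> R) :
      measurable_fun [set: O] g -> (forall w, `|g w| <= 1) ->
      measurable_fun [set: O] X ->
    \sum_(0 <= k < n) \int[P]_w (g w * \1_(F k) (X w)) @[n --> \oo] -->
    \int[P]_w (g w * \1_(\bigcup_k F k) (X w)).
    move=> mg g_le1 mX.
    (* Disjointness makes each partial sum an indicator, hence bounded by 1 uniformly in [n]. *)
    have S01 n x : \sum_(0 <= k < n) \1_(F k) x = \1_(\big[setU/set0]_(k < n) F k) x :> R.
      rewrite big_mkord; elim: n => [|n IH]; first by rewrite !big_ord0 indic0.
      rewrite !big_ord_recr/= IH !indicE in_setU.
      case: (boolP (x \in F n)) => xF; last by rewrite orbF addr0.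
      rewrite orbT; case: (boolP (x \in \big[setU/set0]_(i < n) F i)) => [/set_mem|_]; last by rewrite add0r.
      rewrite -bigcup_mkord => -[k kn xk].
      have kn' : k = n.
        by apply: tF => //; exists x; split => //; exact: set_mem xF.
      by move: kn; rewrite /= kn' ltnn.
    have [||||_] := @Rdominated_convergence _ _ _ P
      (fun n w => g w * \sum_(0 <= k < n) \1_(F k) (X w))
      (fun w => g w * \1_(\bigcup_k F k) (X w)) (cst 1).
    + move=> n; apply: measurable_funM => //; apply: measurable_sum => k.
      exact: measurable_indic_comp.
    + move=> w; apply: cvgM; first exact: cvg_cst.
      rewrite indicE; case: (boolP (X w \in \bigcup_k F k)).
        move=> /set_mem[k _ Fk]; apply: cvg_near_cst; near=> n.
        rewrite S01 indicE mem_set// -bigcup_mkord; exists k => //=.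
        by near: n; exact: nbhs_infty_gt.
      move=> nF; apply: cvg_near_cst; apply: nearW => n.
      rewrite S01 indicE memNset// -bigcup_mkord => -[k _ Fk].
      by move/negP: nF; apply; apply: mem_set; exists k.
    + by apply: (@bounded_integrable _ _ _ P _ 1) => // w; rewrite normr1.
    + by move=> n w; rewrite S01 normrM mulr_ile1// normr_indic_le1.
    have -> : (fun n => \int[P]_w (g w * \sum_(0 <= k < n) \1_(F k) (X w))) =
        (fun n => \sum_(0 <= k < n) \int[P]_w (g w * \1_(F k) (X w))).
      apply/funext => n; rewrite -Rintegral_sum.
        by apply: eq_Rintegral => w _; rewrite mulr_sumr.
      by move=> k; exact: int_indic.
    by [].
  have c1 := H _ _ P1 _ _ mg1 g1_le1 mX1.
  have c2 := H _ _ P2 _ _ mg2 g2_le1 mX2.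
  have e : (fun n => \sum_(0 <= k < n) \int[P1]_w (g1 w * \1_(F k) (X1 w))) =
      (fun n => \sum_(0 <= k < n) \int[P2]_w (g2 w * \1_(F k) (X2 w))).
    by apply/funext => n; apply: eq_bigr => k _; exact: EF.
  by rewrite e in c1; exact: (cvg_unique _ c1 c2).
Unshelve. all: end_near. Qed.

End weighted_law_unique.

(** * Joint laws from the laws of linear combinations *)

Section joint_law.
Context d1 (O1 : measurableType d1) d2 (O2 : measurableType d2) (R : realType).
Variables (P1 : probability O1 R) (P2 : probability O2 R).
Variables (I : eqType) (X1 : I -> O1 -> R) (X2 : I -> O2 -> R).
Hypothesis mX1 : forall i, measurable_fun [set: O1] (X1 i).
Hypothesis mX2 : forall i, measurable_fun [set: O2] (X2 i).

(** A list in which an index may occur repeatedly, so that a further frequency is simply put in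
    front. *)
Definition lincomb (O : Type) (X : I -> O -> R) (l : seq (I * R)) (w : O) : R :=
  \sum_(a <- l) a.2 * X a.1 w.

Hypothesis eq_char : forall l th,
  \int[P1]_w cos (lincomb X1 l w + th) = \int[P2]_w cos (lincomb X2 l w + th).

Let J (B : I -> set R) (O : Type) (X : I -> O -> R) (s : seq I) (w : O) : R :=
  \prod_(i <- s) \1_(B i) (X i w).

(** The statement is kept for all [l] and [th] during the induction on [s]: the weight is the
    indicators already present times a cosine, and its characteristic integrals against the next
    component reduce to the inductive statement for longer lists [l]. *)
Let eq_boxes_char (B : I -> set R) (s : seq I) : (forall i, measurable (B i)) ->
  forall l th, \int[P1]_w (J B X1 s w * cos (lincomb X1 l w + th)) =
    \int[P2]_w (J B X2 s w * cos (lincomb X2 l w + th)).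
Proof.
move=> mB; elim: s => [|i s IH] l th.
  rewrite /J; under eq_Rintegral do rewrite big_nil mul1r.
  under [RHS]eq_Rintegral do rewrite big_nil mul1r.
  exact: eq_char.
pose g (O : Type) (X : I -> O -> R) w := J B X s w * cos (lincomb X l w + th).
have E (O : Type) (X : I -> O -> R) w :
    J B X (i :: s) w * cos (lincomb X l w + th) = g O X w * \1_(B i) (X i w).
  by rewrite /g /J big_cons; ring.
under eq_Rintegral do rewrite E; under [RHS]eq_Rintegral do rewrite E.
have mJ d (O : measurableType d) (X : I -> O -> R) :
    (forall i, measurable_fun [set: O] (X i)) ->
    measurable_fun [set: O] (J B X s) /\
    forall k t, measurable_fun [set: O] (fun w => cos (lincomb X k w + t)).
  move=> mX; split.
    by apply: measurable_prod => j _; exact: measurable_indic_comp.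
  move=> k t; apply: measurable_cosD; apply: measurable_sum => a.
  exact: measurable_funM.
have J1 (O : Type) (X : I -> O -> R) w : `|J B X s w| <= 1.
  by rewrite normr_prod prodr_ile1// => j _; rewrite normr_ge0 normr_indic_le1.
have g1 (O : Type) (X : I -> O -> R) w : `|g O X w| <= 1.
  by rewrite normrM mulr_ile1// cos_max.
have mg d (O : measurableType d) (X : I -> O -> R) :
    (forall i, measurable_fun [set: O] (X i)) -> measurable_fun [set: O] (g O X).
  by move=> mX; have [mJX mcX] := mJ _ _ _ mX; exact: measurable_funM.
apply: weighted_law_unique => //; [exact: mg|exact: mg|move=> u a].
(* A product of cosines is half a sum of cosines, so the new component joins [l] with the
   coefficients [u] and [- u]. *)
have S d (O : measurableType d) (P : probability O R) (X : I -> O -> R) :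
    (forall i, measurable_fun [set: O] (X i)) ->
  \int[P]_w (g O X w * cos (u * X i w + a)) =
  2^-1 * (\int[P]_w (J B X s w * cos (lincomb X ((i, u) :: l) w + (th + a))) +
  \int[P]_w (J B X s w * cos (lincomb X ((i, - u) :: l) w + (th - a)))).
  move=> mX; have [mJX mcX] := mJ _ _ _ mX.
  have iJ k t : P.-integrable [set: O] (EFin \o
      (fun w => J B X s w * cos (lincomb X k w + t))).
    apply: (@bounded_integrable _ _ _ P _ 1) => [|w].
      exact: measurable_funM.
    by rewrite normrM mulr_ile1// cos_max.
  rewrite -RintegralD// -RintegralZl//; last first.
    exact: (integrableD measurableT (iJ _ _) (iJ _ _)).
  apply: eq_Rintegral => w _; rewrite /g /lincomb !big_cons/=.
  set S := \sum_(_ <- _) _; set x := X i w.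
  have -> : u * x + S + (th + a) = (S + th) + (u * x + a) by ring.
  have -> : - u * x + S + (th - a) = (S + th) - (u * x + a) by ring.
  by move: (S + th) (u * x + a) => p q; rewrite cosD cosB; field.
by rewrite (S _ _ P1)// (S _ _ P2)// !IH.
Qed.

Lemma eq_boxes (s : seq I) (B : I -> set R) : (forall i, measurable (B i)) ->
  P1 [set w | forall i, i \in s -> B i (X1 i w)] =
  P2 [set w | forall i, i \in s -> B i (X2 i w)].
Proof.
move=> mB; have := eq_boxes_char s mB [::] 0.
have H d (O : measurableType d) (P : probability O R) (X : I -> O -> R) :
    (forall i, measurable_fun [set: O] (X i)) ->
  (\int[P]_w (J B X s w * cos (lincomb X [::] w + 0)))%:E =
  P [set w | forall i, i \in s -> B i (X i w)].
  move=> mX.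
  have mA : measurable [set w | forall i, i \in s -> B i (X i w)].
    elim: s => [|i s' IH].
      by rewrite [X in measurable X](_ : _ = setT)//; apply/seteqP; split.
    rewrite [X in measurable X](_ : _ =
      (X i @^-1` B i) `&` [set w | forall i, i \in s' -> B i (X i w)]).
      by apply: measurableI => //; rewrite -[X in measurable X]setTI; exact: mX.
    apply/seteqP; split=> [w H|w [/= H1 H2] j].
      by split=> [|j js /=]; apply: H; rewrite inE ?eqxx// js orbT.
    by rewrite inE => /orP[/eqP ->|/H2].
  rewrite -[RHS]fineK; last exact: fin_num_measure.
  rewrite -Rintegral_indicE//; congr EFin; apply: eq_Rintegral => w _.
  rewrite /lincomb big_nil addr0 cos0 mulr1 /J indicE.
  have [wB|wB] := pselect (forall i, i \in s -> B i (X i w)).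
    rewrite mem_set// big_seq big1// => i is_; rewrite indicE mem_set//.
    exact: wB.
  rewrite memNset//.
  have [i [is_ Bi]] : exists i, i \in s /\ ~ B i (X i w).
    apply: contrapT => H; apply: wB => i is_; apply: contrapT => Bi.
    by apply: H; exists i.
  apply/eqP; rewrite prodf_seq_eq0; apply/hasP.
  by exists i => //=; rewrite indicE memNset.
by rewrite -(H _ _ P1)// -(H _ _ P2)// => ->.
Qed.

End joint_law.

Section tuple_boxes.
Context d (T : measurableType d) (n : nat).
Variable G : set (set T).

(** Relative to a class [G] so that it can be iterated: for nested tuples the sides of a box are
    themselves boxes. *)
Definition tuple_boxes : set (set (n.-tuple T)) :=
  [set A | exists2 B : 'I_n -> set T, (forall i, G (B i)) &
     A = [set x | forall i, B i (tnth x i)]].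

Lemma setI_closed_tuple_boxes : setI_closed G -> setI_closed tuple_boxes.
Proof.
move=> GI _ _ [B GB ->] [C GC ->]; exists (fun i => B i `&` C i).
  by move=> i; exact: GI.
apply/seteqP; split=> x /=; first by move=> [HB HC] i; split.
by move=> H; split=> i; have [] := H i.
Qed.

Lemma tuple_boxes_setT : G setT -> tuple_boxes setT.
Proof.
by move=> GT; exists (fun=> setT) => //; apply/seteqP; split.
Qed.

Lemma measurable_tuple_boxes : G setT -> @measurable _ T = <<s G >> ->
  @measurable _ (n.-tuple T) = <<s tuple_boxes >>.
Proof.
move=> GT mG; apply/seteqP; split.
  apply: smallest_sub; first exact: smallest_sigma_algebra.
  move=> A; rewrite -bigcup_seq => -[i _ [B mB <-]]; rewrite setTI.
  move: mB; rewrite mG.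
  pose H := [set C : set T | <<s tuple_boxes >> ((fun x : n.-tuple T => tnth x i) @^-1` C)].
  suff : <<s G >> `<=` H by apply.
  apply: smallest_sub.
    split; rewrite /H /=.
    - by rewrite preimage_set0; exact: sigma_algebra0.
    - move=> C HC; rewrite setTD preimage_setC -setTD.
      by have [_ + _] := smallest_sigma_algebra setT tuple_boxes; apply.
    - move=> F HF; rewrite preimage_bigcup.
      by have [_ _] := smallest_sigma_algebra setT tuple_boxes; apply.
  move=> C GC; apply: sub_sigma_algebra.
  (* A cylinder is a box because [G] contains the whole space. *)
  exists (fun j => if j == i then C else setT).
    by move=> j; case: ifP.
  apply/seteqP; split=> x /=; first by move=> Cx j; case: eqP => // ->.
  by move/(_ i); rewrite eqxx.
apply: smallest_sub; first exact: sigma_algebra_measurable.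
move=> _ [B GB ->].
have -> : [set x : n.-tuple T | forall i, B i (tnth x i)] =
    \bigcap_(i in [set: 'I_n]) ((fun x : n.-tuple T => tnth x i) @^-1` B i).
  by apply/seteqP; split=> x H i //=; exact: H.
apply: fin_bigcap_measurable => // i _.
rewrite -[X in measurable X]setTI; apply: measurable_tnth => //.
by rewrite mG; exact: sub_sigma_algebra.
Qed.

End tuple_boxes.

Lemma pi_system_eq_distribution (R : realType)
    d1 (O1 : measurableType d1) (P1 : probability O1 R)
    d2 (O2 : measurableType d2) (P2 : probability O2 R)
    d (T : measurableType d) (X1 : O1 -> T) (X2 : O2 -> T) (G : set (set T)) :
    @measurable _ T = <<s G >> -> setI_closed G ->
    measurable_fun [set: O1] X1 -> measurable_fun [set: O2] X2 ->
    (forall A, G A -> P1 (X1 @^-1` A) = P2 (X2 @^-1` A)) ->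
  eq_distribution P1 P2 X1 X2.
Proof.
move=> mG GI mX1 mX2 eqG; split=> // B; rewrite mG; move: B.
have m1 B : measurable B -> measurable (X1 @^-1` B).
  by move=> mB; rewrite -[X in measurable X]setTI; exact: mX1.
have m2 B : measurable B -> measurable (X2 @^-1` B).
  by move=> mB; rewrite -[X in measurable X]setTI; exact: mX2.
apply: (dynkin_induction mG GI) => //.
- by rewrite !preimage_setT !probability_setT.
- move=> B mB EB.
  rewrite (_ : X1 @^-1` (~` B) = ~` (X1 @^-1` B))// (_ : X2 @^-1` (~` B) = ~` (X2 @^-1` B))//.
  by rewrite (probability_setC P1 (m1 _ mB)) (probability_setC P2 (m2 _ mB)) EB.
- move=> F mF tF EF; rewrite !preimage_bigcup.
  have tX (O : Type) (X : O -> T) : trivIset [set: nat] (fun k => X @^-1` F k).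
    by move=> i j _ _ [w [Fi Fj]]; apply: tF => //; exists (X w).
  rewrite (measure_bigcup P1 setT (fun k => X1 @^-1` F k) _ (tX _ X1)).
    rewrite (measure_bigcup P2 setT (fun k => X2 @^-1` F k) _ (tX _ X2)).
      by apply: eq_eseriesr => k _; exact: EF.
    by move=> k _; exact: m2.
  by move=> k _; exact: m1.
Qed.

Section nested_tuples.
Context d1 (O1 : measurableType d1) d2 (O2 : measurableType d2) (R : realType).
Variables (P1 : probability O1 R) (P2 : probability O2 R).
Variables a b c : nat.
Local Notation I := ('I_a * 'I_b * 'I_c)%type.

Definition nested_tuple (x : I -> R) : a.-tuple (b.-tuple (c.-tuple R)) :=
  [tuple [tuple [tuple x (n, i, j) | j < c] | i < b] | n < a].

Lemma measurable_nested_tuple d (O : measurableType d) (X : I -> O -> R) :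
  (forall i, measurable_fun [set: O] (X i)) ->
  measurable_fun [set: O] (fun w => nested_tuple (X ^~ w)).
Proof.
move=> mX; apply/measurable_fun_tnthP => n.
rewrite [X in measurable_fun _ X](_ : _ = fun w =>
  [tuple [tuple X (n, i, j) w | j < c] | i < b]); last first.
  by apply/funext => w /=; rewrite tnth_mktuple.
apply/measurable_fun_tnthP => i.
rewrite [X in measurable_fun _ X](_ : _ = fun w => [tuple X (n, i, j) w | j < c]);
  last by apply/funext => w /=; rewrite tnth_mktuple.
apply/measurable_fun_tnthP => j.
rewrite [X in measurable_fun _ X](_ : _ = X (n, i, j)) //.
by apply/funext => w /=; rewrite tnth_mktuple.
Qed.

Lemma eq_distribution_lincomb (X1 : I -> O1 -> R) (X2 : I -> O2 -> R) :
    (forall i, measurable_fun [set: O1] (X1 i)) ->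
    (forall i, measurable_fun [set: O2] (X2 i)) ->
    (forall l th, \int[P1]_w cos (lincomb X1 l w + th) =
       \int[P2]_w cos (lincomb X2 l w + th)) ->
  eq_distribution P1 P2 (fun w => nested_tuple (X1 ^~ w))
    (fun w => nested_tuple (X2 ^~ w)).
Proof.
move=> mX1 mX2 eq_char.
pose G1 : set (set (c.-tuple R)) := tuple_boxes measurable.
pose G2 : set (set (b.-tuple (c.-tuple R))) := tuple_boxes G1.
pose G3 : set (set (a.-tuple (b.-tuple (c.-tuple R)))) := tuple_boxes G2.
have G1T : G1 setT by exact: tuple_boxes_setT.
have G2T : G2 setT by exact: tuple_boxes_setT.
have mE : @measurable _ R = <<s @measurable _ R >>.
  by rewrite sigma_algebra_id//; exact: sigma_algebra_measurable.
have mG1 := measurable_tuple_boxes c measurableT mE.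
have mG2 := measurable_tuple_boxes b G1T mG1.
have mG3 := measurable_tuple_boxes a G2T mG2.
apply: (pi_system_eq_distribution mG3).
- do 3 apply: setI_closed_tuple_boxes.
  by move=> A B; exact: measurableI.
- exact: measurable_nested_tuple.
- exact: measurable_nested_tuple.
move=> A [B GB AE].
(* Choice on two levels flattens the nested boxes into one family [F] of real sets indexed by the
   components. *)
have /choice[C HC] : forall n, exists C : 'I_b -> set (c.-tuple R),
    (forall i, G1 (C i)) /\ B n = [set x | forall i, C i (tnth x i)].
  by move=> n; have [C] := GB n; exists C.
have /choice[D HD] : forall ni : 'I_a * 'I_b, exists D : 'I_c -> set R,
    (forall j, measurable (D j)) /\ C ni.1 ni.2 = [set x | forall j, D j (tnth x j)].
  by move=> [n i]; have [D] := (HC n).1 i; exists D.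
pose F (i : I) := D (i.1.1, i.1.2) i.2.
have E (O : Type) (X : I -> O -> R) : (fun w => nested_tuple (X ^~ w)) @^-1` A =
    [set w | forall i, i \in enum {: I} -> F i (X i w)].
  rewrite AE; apply/seteqP; split=> w /= H.
    move=> [[n i] j] _; have := H n; rewrite (HC n).2 => /(_ i).
    rewrite (HD (n, i)).2 => /(_ j).
    by rewrite !tnth_mktuple.
  move=> n; rewrite (HC n).2 => i /=; rewrite (HD (n, i)).2 => j /=.
  rewrite !tnth_mktuple; apply: (H (n, i, j)).
  by rewrite mem_enum.
rewrite !E; apply: eq_boxes => //.
by move=> i; exact: (HD _).1.
Qed.

End nested_tuples.

(** * Linear functionals of the triples (W, \bar H, \bar K) *)

Section levy_triples.
Variable R : realType.
Implicit Types (u v y z : R * R * R) (p q h s r : R).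

Definition dot u y : R := u.1.1 * y.1.1 + u.1.2 * y.1.2 + u.2 * y.2.

Definition addt u v : R * R * R := (u.1.1 + v.1.1, u.1.2 + v.1.2, u.2 + v.2).

(* Variance of [dot u (W, \bar H, \bar K)] over an interval of length [h]. *)
Definition levy_var h u : R :=
  h * u.1.1 ^+ 2 + h ^+ 3 / 12 * u.1.2 ^+ 2 + h ^+ 5 / 720 * u.2 ^+ 2.

(* The transposes of rule (C) joining intervals of lengths [p] and [q]. *)
Definition pullL p q u : R * R * R :=
  (u.1.1 + u.1.2 * q / 2 + u.2 * (q - p) * q / 12, u.1.2 + u.2 * q / 2, u.2).

Definition pullR p q u : R * R * R :=
  (u.1.1 - u.1.2 * p / 2 - u.2 * (q - p) * p / 12, u.1.2 - u.2 * p / 2, u.2).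

Lemma dot_concat p q u y z :
  dot u (stt_concat p (p + q) y z) = dot (pullL p q u) y + dot (pullR p q u) z.
Proof.
case: y => -[W H] K; case: z => -[W' H'] K'.
by rewrite /dot /= /pullL /pullR /=; field.
Qed.

Lemma dotDl u v y : dot (addt u v) y = dot u y + dot v y.
Proof. by rewrite /dot /addt /=; ring. Qed.

(* Variance of [dot b (Y on the whole) + dot a (Y on the left part)]. *)
Definition joint_var p q b a : R :=
  levy_var p (addt (pullL p q b) a) + levy_var q (pullR p q b).

(** The restriction is put on coefficient vectors because the Brownian triples are complete in every
    mode; only components that the mode generates may be tested. *)
Definition masked (m : mode) u : Prop :=
  match m with
  | NoLevyArea => u.1.2 = 0 /\ u.2 = 0
  | SpaceTime => u.2 = 0
  | SpaceTimeTime => True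
  end.

Variable g : site -> nat -> R.

Definition vbt_interval (m : mode) (l k : nat) : R * R * R :=
  match m with
  | NoLevyArea => (none_time g l k.+1 - none_time g l k, 0, 0)
  | SpaceTime => (st_interval g l k, 0)
  | SpaceTimeTime => stt_interval g l k
  end.

(** The final interpolation before rule (C), with the leaf as a separate argument in place of the
    one determined by the query. *)
Definition vbt_partial (m : mode) (A : 'M[R]_3) (L k : nat) (x : R) : R * R * R :=
  let h := 2 ^- L in
  let p := x - k%:R / 2 ^+ L in
  let q := k.+1%:R / 2 ^+ L - x in
  match m with
  | NoLevyArea =>
      (p / h * (none_time g L k.+1 - none_time g L k)
        + Num.sqrt (p * q / h) * g (Leaf k) 0%N, 0, 0)
  | SpaceTime =>
      let X1 := g (Leaf k) 0%N in
      let X2 := g (Leaf k) 1%N in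
      let delta := Num.sqrt (p ^+ 3 + q ^+ 3) in
      let a := p `^ (7 / 2) * q `^ (1 / 2) / (2 * h * delta) in
      let b := p `^ (1 / 2) * q `^ (7 / 2) / (2 * h * delta) in
      let c := Num.sqrt 3 * p `^ (3 / 2) * q `^ (3 / 2) / (6 * delta) in
      let: (Wsu, Hsu) := st_interval g L k in
      (p / h * Wsu + 6 * p * q / h ^+ 3 * Hsu + 2 * (a + b) / h * X1,
       p ^+ 3 / h ^+ 3 * Hsu - a * X1 + c * X2, 0)
  | SpaceTimeTime =>
      let hat : 'cV[R]_3 := A *m \col_i g (Leaf k) i in
      let hatW := hat (inord 0) ord0 in
      let hatH := hat (inord 1) ord0 in
      let hatK := hat (inord 2) ord0 in
      let: (Wsu, bHsu, bKsu) := stt_interval g L k in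
      let Hsu := bHsu / h in
      let Ksu := bKsu / h ^+ 2 in
      (p / h * Wsu + 6 * p * q / h ^+ 2 * Hsu
         + 60 * p * q * (q - p) / h ^+ 3 * Ksu + hatW,
       p * (p ^+ 2 / h ^+ 2 * Hsu + 30 * p ^+ 2 * q / h ^+ 3 * Ksu + hatH),
       p ^+ 2 * (p ^+ 3 / h ^+ 3 * Ksu + hatK))
  end.

Lemma none_time_even l k : none_time g l.+1 k.*2 = none_time g l k.
Proof. by rewrite /= odd_double doubleK. Qed.

Lemma none_time_odd l k : none_time g l.+1 k.*2.+1 =
  (none_time g l k + none_time g l k.+1) / 2 + Num.sqrt (2 ^- l) / 2 * g (Node l k) 0%N.
Proof. by rewrite /= odd_double/= uphalf_double. Qed.

Lemma tree_interval_even (Y : Type) (root : Y) split l k :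
  tree_interval root split l.+1 k.*2 = (split l k (tree_interval root split l k)).1.
Proof. by rewrite /= odd_double doubleK. Qed.

Lemma tree_interval_odd (Y : Type) (root : Y) split l k :
  tree_interval root split l.+1 k.*2.+1 = (split l k (tree_interval root split l k)).2.
Proof. by rewrite /= odd_double/= uphalf_double. Qed.

End levy_triples.

Section noise_decomposition.
Variable R : realType.

Lemma exprV2S (l : nat) : (2 ^- l.+1 : R) = 2 ^- l / 2.
Proof. by rewrite exprS invfM mulrC. Qed.

Lemma exprV2_gt0 (l : nat) : 0 < (2 ^- l : R).
Proof. by rewrite invr_gt0 exprn_gt0. Qed.

Lemma root_decomposition (m : mode) (u : R * R * R) : masked m u ->
  exists n : nat -> R,
    (forall g, dot u (vbt_interval g m 0 0) = \sum_(i < ncomp m) n i * g Root i) /\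
    \sum_(i < ncomp m) n i ^+ 2 * noise_variance R m Root i = levy_var 1 u.
Proof.
case: u => -[a b] c; case: m => /= [[-> ->]|->|_];
  (exists (fun i => nth 0 [:: a; b; c] i); split; [move=> g|];
  rewrite !big_ord_recr big_ord0 /= add0r /dot /levy_var /= ?expr1n); by field.
Qed.

(** [t] and [n] are the transpose of the midpoint step applied to [(u, v)]: they collect the
    coefficients of the parent triple and of each noise. The last equation says that the halves
    behave like independent intervals of half the length. *)
Lemma split_decomposition (m : mode) (l k : nat) (u v : R * R * R) :
    masked m u -> masked m v ->
  exists (t : R * R * R) (n : nat -> R), [/\ masked m t,
    forall g, dot u (vbt_interval g m l.+1 k.*2) + dot v (vbt_interval g m l.+1 k.*2.+1) =
      dot t (vbt_interval g m l k) + \sum_(i < ncomp m) n i * g (Node l k) i &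
    levy_var (2 ^- l) t + \sum_(i < ncomp m) n i ^+ 2 * noise_variance R m (Node l k) i =
    levy_var (2 ^- l.+1) u + levy_var (2 ^- l.+1) v].
Proof.
have h0 := exprV2_gt0 l; set h : R := 2 ^- l; have hn0 : h != 0 by rewrite gt_eqF.
rewrite exprV2S -/h.
case: u => -[a b] c; case: v => -[a' b'] c'; case: m.
- move=> [b0 c0] [b0' c0']; rewrite (b0 : b = 0) (c0 : c = 0) (b0' : b' = 0) (c0' : c' = 0).
  exists ((a + a') / 2, 0, 0), (fun i => Num.sqrt h / 2 * (a - a')); split=> // [g|].
    rewrite /dot /vbt_interval -doubleS !none_time_even none_time_odd [ncomp _]/= !big_ord_recr big_ord0 /= add0r -/h.
    by field.
  rewrite [ncomp _]/= !big_ord_recr big_ord0 /= add0r /levy_var /= !exprMn sqr_sqrtr ?ltW//.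
  by field.
- move=> c0 c0'; rewrite (c0 : c = 0) (c0' : c' = 0).
  exists ((a + a') / 2, 3 / (2 * h) * (a - a') + (b + b') / 8, 0),
    (fun i => nth 0 [:: a - a' - h / 4 * (b + b'); h / 4 * (b - b')] i).
  split=> // [g|].
    rewrite /dot /vbt_interval /st_interval tree_interval_even tree_interval_odd.
    case: (tree_interval _ _ l k) => W H; rewrite [ncomp _]/= !big_ord_recr big_ord0 /= add0r -/h.
    by field.
  by rewrite [ncomp _]/= !big_ord_recr big_ord0 /= add0r /levy_var /= -/h; field.
- move=> _ _; exists ((a + a') / 2, 3 / (2 * h) * (a - a') + (b + b') / 8,
      15 / (8 * h) * (b - b') + (c + c') / 32),
    (fun i => nth 0 [:: a - a' - h / 4 * (b + b');
       h / 2 * (b - b') - h ^+ 2 / 8 * (c + c'); h ^+ 2 / 4 * (c - c')] i).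
  split=> // [g|].
    rewrite /dot /vbt_interval /stt_interval tree_interval_even tree_interval_odd.
    case: (tree_interval _ _ l k) => -[W H] K; rewrite [ncomp _]/= !big_ord_recr big_ord0 /= add0r -/h.
    by field.
  by rewrite [ncomp _]/= !big_ord_recr big_ord0 /= add0r /levy_var /= -/h; field.
Qed.

Lemma sum_ord3 (F : 'I_3 -> R) :
  \sum_i F i = F (inord 0) + F (inord 1) + F (inord 2).
Proof.
rewrite !big_ord_recr big_ord0 /= add0r.
by congr (F _ + F _ + F _); apply/val_inj; rewrite /= inordK.
Qed.

Lemma powR_half (p : R) (n : nat) : 0 < p ->
  p `^ (n.*2.+1%:R / 2) = p ^+ n * Num.sqrt p.
Proof.
move=> p0; have -> : n.*2.+1%:R / 2 = n%:R + 2^-1 :> R.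
  by rewrite -addn1 -muln2 natrD natrM; field.
rewrite powRD; last by rewrite gt_eqF ?implybT.
by rewrite powR_mulrn ?ltW// -powR12_sqrt ?ltW.
Qed.

(** Transpose of the final interpolation. The query cuts the leaf into lengths [p] and [q], and
    [joint_var] is the variance of two independent pieces joined by rule (C). *)
Lemma leaf_decomposition (m : mode) (L k : nat) (x : R) (A : 'M[R]_3)
    (b a : R * R * R) :
  let p := x - k%:R / 2 ^+ L in let q := k.+1%:R / 2 ^+ L - x in
    0 < p -> 0 < q ->
    (m = SpaceTimeTime -> A *m A^T = stt_cov (2 ^- L) p q) ->
    masked m b -> masked m a ->
  exists (t : R * R * R) (n : nat -> R), [/\ masked m t,
    forall g, dot b (vbt_interval g m L k) + dot a (vbt_partial g m A L k x) =
      dot t (vbt_interval g m L k) + \sum_(i < ncomp m) n i * g (Leaf k) i &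
    levy_var (2 ^- L) t + \sum_(i < ncomp m) n i ^+ 2 = joint_var p q b a].
Proof.
move=> p q p0 q0.
have hE : 2 ^- L = p + q.
  by rewrite /p /q -natr1; field; rewrite expf_neq0.
have h0 : p + q != 0 by rewrite gt_eqF// addr_gt0.
case: b => -[b0 b1] b2; case: a => -[a0 a1] a2; case: m.
- move=> _ [z1 z2] [z3 z4].
  rewrite (z1 : b1 = 0) (z2 : b2 = 0) (z3 : a1 = 0) (z4 : a2 = 0).
  exists (b0 + a0 * (p / (p + q)), 0, 0), (fun i => a0 * Num.sqrt (p * q / (p + q))).
  split=> // [g|].
    rewrite /dot /vbt_partial /vbt_interval -/p -/q hE.
    rewrite [ncomp _]/= !big_ord_recr big_ord0 /= add0r.
    move: (none_time _ _ _) (none_time _ _ _) (Num.sqrt _) => X Y Z /=.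
    by field.
  rewrite [ncomp _]/= !big_ord_recr big_ord0 /= add0r exprMn sqr_sqrtr; last first.
    by apply/ltW/divr_gt0; [exact: mulr_gt0|exact: addr_gt0].
  rewrite hE /joint_var /levy_var /=.
  by field.
- move=> _ z1 z2; rewrite (z1 : b2 = 0) (z2 : a2 = 0).
  pose D := p ^+ 3 + q ^+ 3.
  have D0 : 0 < D by rewrite addr_gt0// exprn_gt0.
  pose d := Num.sqrt D.
  have d0 : d != 0 by rewrite gt_eqF// sqrtr_gt0.
  have d2 : d ^+ 2 = D by rewrite sqr_sqrtr ?ltW.
  (* With [h = p + q], [d = delta] and [e = sqrt (p q)] the fractional powers become
     [a = p^3 e / (2 h d)], [b = q^3 e / (2 h d)] and [c = sqrt 3 p q e / (6 d)]. As
     [p^3 + q^3 = d^2], the factor [2 (a + b) / h] equals [e d / h^2]. *)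
  pose e := Num.sqrt p * Num.sqrt q.
  have e2 : e ^+ 2 = p * q by rewrite exprMn !sqr_sqrtr ?ltW.
  exists (b0 + a0 * (p / (p + q)),
      b1 + a0 * (6 * p * q / (p + q) ^+ 3) + a1 * (p ^+ 3 / (p + q) ^+ 3), 0),
    (fun i => nth 0 [:: a0 * (e * d / (p + q) ^+ 2) - a1 * (p ^+ 3 * e / (2 * (p + q) * d));
       a1 * (Num.sqrt 3 * p * q * e / (6 * d))] i).
  split=> // [g|].
    rewrite /dot /vbt_partial /vbt_interval -/p -/q hE.
    have P7 := @powR_half p 3 p0; have Q7 := @powR_half q 3 q0.
    have P1 := @powR_half p 0 p0; have Q1 := @powR_half q 0 q0.
    have P3 := @powR_half p 1 p0; have Q3 := @powR_half q 1 q0.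
    rewrite /= in P7 P1 P3 Q7 Q1 Q3; rewrite P7 P1 P3 Q7 Q1 Q3 -/D -/d.
    rewrite [ncomp _]/= !big_ord_recr big_ord0 /= add0r.
    case: (st_interval g L k) => W H /=.
    (* Writing [d] as [d^2 / d] brings in [d^2], which can be replaced by [p^3 + q^3]. *)
    have dE : e * d / (p + q) ^+ 2 = e * d ^+ 2 / ((p + q) ^+ 2 * d).
      by field; rewrite h0 d0.
    rewrite dE d2 /D /e; move: (g _ _) (g _ _) (Num.sqrt 3) => X Y Z.
    by field; rewrite h0 d0.
  rewrite [ncomp _]/= !big_ord_recr big_ord0 /= add0r /=.
  have -> : (a0 * (e * d / (p + q) ^+ 2) - a1 * (p ^+ 3 * e / (2 * (p + q) * d))) ^+ 2 +
      (a1 * (Num.sqrt 3 * p * q * e / (6 * d))) ^+ 2 =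
    e ^+ 2 * (a0 ^+ 2 * d ^+ 2 / (p + q) ^+ 4 - a0 * a1 * p ^+ 3 / (p + q) ^+ 3
       + a1 ^+ 2 * p ^+ 6 / (4 * (p + q) ^+ 2 * d ^+ 2))
    + a1 ^+ 2 * Num.sqrt 3 ^+ 2 * p ^+ 2 * q ^+ 2 * e ^+ 2 / (36 * d ^+ 2).
    by field; rewrite h0 d0.
  rewrite e2 d2 sqr_sqrtr// hE /joint_var /levy_var /= /D.
  by field; rewrite h0 -/D gt_eqF.
- move=> /(_ erefl); rewrite hE => AE _ _.
  exists (b0 + a0 * (p / (p + q)),
      b1 + a0 * (6 * p * q / (p + q) ^+ 3) + a1 * (p ^+ 3 / (p + q) ^+ 3),
      b2 + a0 * (60 * p * q * (q - p) / (p + q) ^+ 5)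
        + a1 * (30 * p ^+ 3 * q / (p + q) ^+ 5) + a2 * (p ^+ 5 / (p + q) ^+ 5)),
    (* The interpolation multiplies [\hat H] by [p] and [\hat K] by [p ^+ 2], whence the weights of
       the rows. *)
    (fun i => a0 * A (inord 0) (inord i) + p * a1 * A (inord 1) (inord i)
       + p ^+ 2 * a2 * A (inord 2) (inord i)).
  split=> // [g|].
    rewrite /dot /vbt_partial /vbt_interval -/p -/q hE.
    rewrite !mxE !sum_ord3 !mxE !inordK//.
    case: (stt_interval g L k) => -[W H] K /=.
    move: (g _ 0%N) (g _ 1%N) (g _ 2%N) => X Y Z.
    by field.
  (* The variance involves [A] only through inner products of its rows; these are entries of
     [A A^T], the same for every square root. *)
  have C (i j : nat) : (i < 3)%N -> (j < 3)%N ->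
      A (inord i) (inord 0) * A (inord j) (inord 0) +
      A (inord i) (inord 1) * A (inord j) (inord 1) +
      A (inord i) (inord 2) * A (inord j) (inord 2) =
      stt_cov (p + q) p q (inord i) (inord j).
    by move=> i3 j3; rewrite -AE mxE sum_ord3 !mxE.
  have C00 := C 0 0 isT isT; have C01 := C 0 1 isT isT; have C02 := C 0 2 isT isT.
  have C11 := C 1 1 isT isT; have C12 := C 1 2 isT isT; have C22 := C 2 2 isT isT.
  rewrite !mxE !inordK//= in C00 C01 C02 C11 C12 C22.
  rewrite [ncomp _]/= !big_ord_recr big_ord0 /= add0r /=.
  move: C00 C01 C02 C11 C12 C22.
  move: (A (inord 0) (inord 0)) (A (inord 0) (inord 1)) (A (inord 0) (inord 2)).
  move: (A (inord 1) (inord 0)) (A (inord 1) (inord 1)) (A (inord 1) (inord 2)).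
  move: (A (inord 2) (inord 0)) (A (inord 2) (inord 1)) (A (inord 2) (inord 2)).
  move=> z0 z1 z2 y0 y1 y2 x0 x1 x2 C00 C01 C02 C11 C12 C22.
  rewrite (_ : (a0 * x0 + p * a1 * y0 + p ^+ 2 * a2 * z0) ^+ 2 +
     (a0 * x1 + p * a1 * y1 + p ^+ 2 * a2 * z1) ^+ 2 +
     (a0 * x2 + p * a1 * y2 + p ^+ 2 * a2 * z2) ^+ 2 =
     a0 ^+ 2 * (x0 * x0 + x1 * x1 + x2 * x2)
     + 2 * a0 * (p * a1) * (x0 * y0 + x1 * y1 + x2 * y2)
     + 2 * a0 * (p ^+ 2 * a2) * (x0 * z0 + x1 * z1 + x2 * z2)
     + (p * a1) ^+ 2 * (y0 * y0 + y1 * y1 + y2 * y2)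
     + 2 * (p * a1) * (p ^+ 2 * a2) * (y0 * z0 + y1 * z1 + y2 * z2)
     + (p ^+ 2 * a2) ^+ 2 * (z0 * z0 + z1 * z1 + z2 * z2)); last by ring.
  rewrite C00 C01 C02 C11 C12 C22 /joint_var /levy_var /=.
  by field.
Qed.

End noise_decomposition.

(** * Gaussianity of the Virtual Brownian Tree *)

Definition site_code (s : site) : option (nat * nat + nat) :=
  match s with Root => None | Node l k => Some (inl (l, k)) | Leaf k => Some (inr k) end.

Definition site_decode (c : option (nat * nat + nat)) : site :=
  match c with
  | None => Root | Some (inl (l, k)) => Node l k | Some (inr k) => Leaf k
  end.

Lemma site_codeK : cancel site_code site_decode.
Proof. by case. Qed.

HB.instance Definition _ := Equality.copy site (can_type site_codeK).

(** These are the sites on which the tree intervals of level [l] depend. Nodes of level [l] itself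
    are absent, so their coefficients can be chosen afterwards. *)
Fixpoint node_sites (l : nat) : seq site :=
  if l is l'.+1 then node_sites l' ++ [seq Node l' k | k <- iota 0 (2 ^ l')]
  else [:: Root].

Definition sites (L : nat) : seq site :=
  node_sites L ++ [seq Leaf k | k <- iota 0 (2 ^ L)].

Lemma mem_node_sites l s : s \in node_sites l ->
  match s with Root => true | Node l' k => (l' < l)%N && (k < 2 ^ l')%N | Leaf _ => false end.
Proof.
elim: l s => [|l IH] s /=; first by rewrite inE => /eqP ->.
rewrite mem_cat => /orP[/IH|/mapP[k]].
  by case: s => // l' k /andP[ll ->]; rewrite ltnS ltnW.
by rewrite mem_iota add0n => /= kl ->; rewrite ltnSn.
Qed.

Lemma mem_sites L s : s \in sites L -> valid_site L s.
Proof.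
rewrite mem_cat => /orP[/mem_node_sites|/mapP[k]]; first by case: s.
by rewrite mem_iota add0n => /= kl ->.
Qed.

Lemma uniq_sites L : uniq (sites L).
Proof.
rewrite cat_uniq; apply/and3P; split.
- elim: L => //= l IH; rewrite cat_uniq IH /=; apply/andP; split.
    by apply/hasPn => _ /mapP[k _ ->]; apply/negP => /mem_node_sites; rewrite ltnn.
  by rewrite map_inj_uniq ?iota_uniq// => k k' [].
- by apply/hasPn => _ /mapP[k _ ->]; apply/negP => /mem_node_sites.
- by rewrite map_inj_uniq ?iota_uniq// => k k' [].
Qed.

Section vbt_decomposition.
Variables (R : realType) (m : mode).

Definition noise_sum (S : seq site) (F : site -> nat -> R) : R :=
  \sum_(s <- S) \sum_(i < ncomp m) F s i.

Lemma noise_sum_cat S S' F : noise_sum (S ++ S') F = noise_sum S F + noise_sum S' F.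
Proof. exact: big_cat. Qed.

Lemma noise_sum_map (f : nat -> site) (t : seq nat) F :
  noise_sum [seq f k | k <- t] F = \sum_(k <- t) \sum_(i < ncomp m) F (f k) i.
Proof. exact: big_map. Qed.

Lemma eq_noise_sum S F F' : (forall s i, s \in S -> F s i = F' s i) ->
  noise_sum S F = noise_sum S F'.
Proof.
by move=> FF; apply: eq_big_seq => s sS; apply: eq_bigr => i _; exact: FF.
Qed.

Lemma sum_iota_double (V : nmodType) (n : nat) (F : nat -> V) :
  \sum_(k <- iota 0 n.*2) F k = \sum_(k <- iota 0 n) (F k.*2 + F k.*2.+1).
Proof.
elim: n => [|n IH]; first by rewrite !big_nil.
have -> : iota 0 n.+1.*2 = iota 0 n.*2 ++ [:: n.*2; n.*2.+1].
  by rewrite doubleS -(addn2 n.*2) iotaD add0n.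
have -> : iota 0 n.+1 = iota 0 n ++ [:: n] by rewrite -[n.+1]addn1 iotaD.
by rewrite !big_cat/= IH big_cons !big_seq1.
Qed.

(** Siblings of level [l.+1] are merged in pairs: [split_decomposition] trades their two vectors for
    one masked vector on the parent and coefficients at the node, without changing the total
    variance. *)
Lemma tree_decomposition (l : nat) (u : nat -> R * R * R) :
    (forall k, masked m (u k)) ->
  exists c : site -> nat -> R,
    (forall g, \sum_(k <- iota 0 (2 ^ l)) dot (u k) (vbt_interval g m l k) =
       noise_sum (node_sites l) (fun s i => c s i * g s i)) /\
    noise_sum (node_sites l) (fun s i => c s i ^+ 2 * noise_variance R m s i) =
      \sum_(k <- iota 0 (2 ^ l)) levy_var (2 ^- l) (u k).
Proof.
elim: l u => [|l IH] u mu.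
  have [n [nE nV]] := root_decomposition (mu 0%N).
  exists (fun=> n); split=> [g|]; rewrite /noise_sum !big_seq1 //.
  by rewrite nV expr0 invr1.
have /choice[tn tnP] : forall k, exists tn : (R * R * R) * (nat -> R), [/\ masked m tn.1,
    forall g, dot (u k.*2) (vbt_interval g m l.+1 k.*2)
        + dot (u k.*2.+1) (vbt_interval g m l.+1 k.*2.+1) =
      dot tn.1 (vbt_interval g m l k) + \sum_(i < ncomp m) tn.2 i * g (Node l k) i &
    levy_var (2 ^- l) tn.1
      + \sum_(i < ncomp m) tn.2 i ^+ 2 * noise_variance R m (Node l k) i =
    levy_var (2 ^- l.+1) (u k.*2) + levy_var (2 ^- l.+1) (u k.*2.+1)].
  move=> k; have [t [n H]] := split_decomposition l k (mu k.*2) (mu k.*2.+1).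
  by exists (t, n).
have [c [cE cV]] := IH (fun k => (tn k).1) (fun k => let: And3 h _ _ := tnP k in h).
(* The inductive [c] is arbitrary at level [l]. Overwriting it there leaves the earlier sum
   unchanged, since [node_sites l] has no node of that level. *)
pose c' s := if s is Node l' k then (if l' == l then (tn k).2 else c s) else c s.
have cc' s i : s \in node_sites l -> c' s i = c s i.
  by move=> /mem_node_sites; case: s => //= l' k /andP[ll _]; rewrite ltn_eqF.
exists c'; split=> [g|].
  rewrite expnS mul2n sum_iota_double noise_sum_cat noise_sum_map.
  rewrite (@eq_noise_sum _ _ (fun s i => c s i * g s i)); last by move=> s i /cc' ->.
  rewrite -cE -big_split/=; apply: eq_bigr => k _.
  by rewrite /= eqxx; have [_ -> _] := tnP k.
rewrite expnS mul2n sum_iota_double noise_sum_cat noise_sum_map.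
rewrite (@eq_noise_sum _ _ (fun s i => c s i ^+ 2 * noise_variance R m s i)); last first.
  by move=> s i /cc' ->.
rewrite cV -big_split/=; apply: eq_bigr => k _.
by rewrite /= eqxx; have [_ _ ->] := tnP k.
Qed.

Lemma vbt_data_decomposition (L : nat) (rho : nat -> R) (A : R -> 'M[R]_3)
    (b a : nat -> R * R * R) :
    (forall k, k%:R / 2 ^+ L < rho k < k.+1%:R / 2 ^+ L) ->
    (forall k, (k < 2 ^ L)%N -> m = SpaceTimeTime -> A (rho k) *m (A (rho k))^T =
       stt_cov (2 ^- L) (rho k - k%:R / 2 ^+ L) (k.+1%:R / 2 ^+ L - rho k)) ->
    (forall k, masked m (b k)) -> (forall k, masked m (a k)) ->
  exists c : site -> nat -> R,
    (forall g, \sum_(k <- iota 0 (2 ^ L)) (dot (b k) (vbt_interval g m L k)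
         + dot (a k) (vbt_partial g m (A (rho k)) L k (rho k))) =
       noise_sum (sites L) (fun s i => c s i * g s i)) /\
    noise_sum (sites L) (fun s i => c s i ^+ 2 * noise_variance R m s i) =
      \sum_(k <- iota 0 (2 ^ L))
        joint_var (rho k - k%:R / 2 ^+ L) (k.+1%:R / 2 ^+ L - rho k) (b k) (a k).
Proof.
move=> rhoI AE mb ma.
have /choice[tn tnP] : forall k, exists tn : (R * R * R) * (nat -> R),
    masked m tn.1 /\ ((k < 2 ^ L)%N ->
    (forall g, dot (b k) (vbt_interval g m L k)
        + dot (a k) (vbt_partial g m (A (rho k)) L k (rho k)) =
      dot tn.1 (vbt_interval g m L k) + \sum_(i < ncomp m) tn.2 i * g (Leaf k) i) /\
    levy_var (2 ^- L) tn.1 + \sum_(i < ncomp m) tn.2 i ^+ 2 =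
    joint_var (rho k - k%:R / 2 ^+ L) (k.+1%:R / 2 ^+ L - rho k) (b k) (a k)).
  move=> k; case: (ltnP k (2 ^ L)) => kL; last first.
    (* Beyond the last leaf any masked vector will do; choice only asks that there be one. *)
    by exists (b k, fun=> 0); split; first exact: mb.
  have /andP[r1 r2] := rhoI k; rewrite -subr_gt0 in r1; rewrite -subr_gt0 in r2.
  have [t [n [H1 H2 H3]]] := leaf_decomposition r1 r2 (AE k kL) (mb k) (ma k).
  by exists (t, n).
have [c [cE cV]] := tree_decomposition L (fun k => (tnP k).1).
pose c' s := if s is Leaf k then (tn k).2 else c s.
have cc' s i : s \in node_sites L -> c' s i = c s i.
  by move=> /mem_node_sites; case: s.
exists c'; split=> [g|].
  rewrite noise_sum_cat noise_sum_map.
  rewrite (@eq_noise_sum _ _ (fun s i => c s i * g s i)); last by move=> s i /cc' ->.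
  rewrite -cE -big_split/=; apply: eq_big_seq => k; rewrite mem_iota add0n => /= kL.
  by rewrite ((tnP k).2 kL).1.
rewrite noise_sum_cat noise_sum_map.
rewrite (@eq_noise_sum _ _ (fun s i => c s i ^+ 2 * noise_variance R m s i)); last first.
  by move=> s i /cc' ->.
rewrite cV -big_split/=; apply: eq_big_seq => k; rewrite mem_iota add0n => /= kL.
rewrite -((tnP k).2 kL).2; congr (_ + _).
by apply: eq_bigr => i _; rewrite mulr1.
Qed.

End vbt_decomposition.

Lemma noise_variance_gt0 (R : realType) (m : mode) (s : site) (i : nat) :
  (i < ncomp m)%N -> 0 < noise_variance R m s i.
Proof.
have n0 (n : nat) : 0 < n.+1%:R :> R by rewrite ltr0n.
case: s => [|l k|k] iD; last exact: ltr01.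
  have : (i < 3)%N by apply: leq_trans iD _; case: m.
  case: i {iD} => [|[|[|i]]] // _; rewrite [noise_variance _ _ _ _]/=.
  - by rewrite invr_gt0; exact: n0.
  - by rewrite invr_gt0; exact: n0.
have h := exprV2_gt0 R l.
case: m iD; first by move=> _; exact: ltr01.
  case: i => [|[|i]] // _; rewrite [noise_variance _ _ _ _]/=;
    by apply: divr_gt0 => //; exact: n0.
case: i => [|[|[|i]]] // _; rewrite [noise_variance _ _ _ _]/=;
  by apply: divr_gt0 => //; exact: n0.
Qed.

(** All coordinates [j] read the same noise vectors. The sum is therefore reordered, with the slots
    [(s, i)] outside, where the vectors are independent, and the coordinates inside. *)
Lemma gaussian_noise_sum d (O : measurableType d) (R : realType)
    (P : probability O R) (m : mode) (L n : nat)
    (xi : site -> nat -> O -> n.-tuple R) (c : 'I_n -> site -> nat -> R) :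
    vbt_noise m L P xi ->
  gaussian P
    (fun w => \sum_j noise_sum m (sites L) (fun s i => c j s i * tnth (xi s i w) j))
    (\sum_j noise_sum m (sites L) (fun s i => c j s i ^+ 2 * noise_variance R m s i)).
Proof.
move=> [nxi indepxi].
pose sl := [seq (s, i) | s <- sites L, i <- iota 0 (ncomp m)].
pose f := tnth (in_tuple sl).
have E (F : 'I_n -> site -> nat -> R) : \sum_j noise_sum m (sites L) (F j) =
    \sum_(k < size sl) \sum_j F j (f k).1 (f k).2.
  rewrite -(big_tnth _ _ sl xpredT (fun a => \sum_j F j a.1 a.2)) [RHS]exchange_big/=.
  apply: eq_bigr => j _; rewrite big_allpairs_dep /noise_sum.
  by apply: eq_bigr => s _; rewrite -(big_mkord xpredT) /index_iota subn0.
have := @gaussian_independent_sum _ _ _ P n (size sl) (site * nat)%type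
  [set a : site * nat | valid_site L a.1 /\ (a.2 < ncomp m)%N]
  (fun a => xi a.1 a.2) (fun a => noise_variance R m a.1 a.2) f
  (fun k j => c j (f k).1 (f k).2).
rewrite -(E (fun j s i => c j s i ^+ 2 * noise_variance R m s i)).
under [X in _ -> _ -> _ -> _ -> _ -> gaussian _ X _]eq_fun => w.
  rewrite -(E (fun j s i => c j s i * tnth (xi s i w) j)). over.
apply.
- apply/tuple_uniqP; apply: allpairs_uniq_dep => [|s _|]; first exact: uniq_sites.
    exact: iota_uniq.
  by move=> [s i] [s' i'] _ _ /= [-> ->].
- move=> k; have := mem_tnth k (in_tuple sl); rewrite -/f => /allpairsPdep[s [i [sS iI ->]]] /=.
  split; first exact: mem_sites.
  by move: iI; rewrite mem_iota add0n.
- by move=> a [_]; exact: noise_variance_gt0.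
- by move=> a; exact: nxi.
- exact: indepxi.
Qed.

Lemma gaussian_vbt_data d (O : measurableType d) (R : realType)
    (P : probability O R) (m : mode) (L n : nat)
    (xi : site -> nat -> O -> n.-tuple R) (rho : nat -> R) (A : R -> 'M[R]_3)
    (b a : 'I_n -> nat -> R * R * R) :
    vbt_noise m L P xi ->
    (forall k, k%:R / 2 ^+ L < rho k < k.+1%:R / 2 ^+ L) ->
    (forall k, (k < 2 ^ L)%N -> m = SpaceTimeTime -> A (rho k) *m (A (rho k))^T =
       stt_cov (2 ^- L) (rho k - k%:R / 2 ^+ L) (k.+1%:R / 2 ^+ L - rho k)) ->
    (forall j k, masked m (b j k)) -> (forall j k, masked m (a j k)) ->
  gaussian P
    (fun w => \sum_j \sum_(k <- iota 0 (2 ^ L))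
      let g s i := tnth (xi s i w) j in
      (dot (b j k) (vbt_interval g m L k)
       + dot (a j k) (vbt_partial g m (A (rho k)) L k (rho k))))
    (\sum_j \sum_(k <- iota 0 (2 ^ L))
      joint_var (rho k - k%:R / 2 ^+ L) (k.+1%:R / 2 ^+ L - rho k) (b j k) (a j k)).
Proof.
move=> nxi rhoI AE mb ma.
have /choice[c cP] : forall j, exists c : site -> nat -> R, _ :=
  fun j => vbt_data_decomposition rhoI AE (mb j) (ma j).
have := gaussian_noise_sum c nxi.
rewrite (eq_bigr _ (fun j _ => (cP j).2)).
congr (gaussian _ _ _); apply/funext => w; apply: eq_bigr => j _.
by rewrite -(cP j).1.
Qed.

(** * Dyadic times *)

Section dyadic_times.
Variable R : realType.
Implicit Types (y z : R * R * R).

Lemma leaf_indexE (L k : nat) (x : R) :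
  k%:R / 2 ^+ L < x <= k.+1%:R / 2 ^+ L -> leaf_index L x = k.
Proof.
have h : 0 < 2 ^+ L :> R by rewrite exprn_gt0.
rewrite ltr_pdivrMr// ler_pdivlMr// /leaf_index => /andP[k1 k2].
have -> : Num.ceil (x * 2 ^+ L) = k.+1%:Z; last by [].
apply/le_anti/andP; split; first by rewrite ceil_le_int.
by rewrite -addn1 PoszD lezD1 ceil_gt_int.
Qed.

Lemma leaf_index_itv (L : nat) (x : R) : 0 < x <= 1 ->
  (leaf_index L x < 2 ^ L)%N /\
  (leaf_index L x)%:R / 2 ^+ L < x <= (leaf_index L x).+1%:R / 2 ^+ L.
Proof.
move=> /andP[x0 x1]; have h : 0 < 2 ^+ L :> R by rewrite exprn_gt0.
rewrite ltr_pdivrMr// ler_pdivlMr//.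
have c0 : 0 < Num.ceil (x * 2 ^+ L) by rewrite ceil_gt0 mulr_gt0.
have cE : Num.ceil (x * 2 ^+ L) = (leaf_index L x).+1%:Z.
  by rewrite /leaf_index prednK ?absz_gt0 ?gt_eqF// gez0_abs// ltW.
have k1 : (leaf_index L x)%:R < x * 2 ^+ L.
  by rewrite -[ltLHS]/((leaf_index L x)%:Z%:~R) -ceil_gt_int cE ltz_nat.
have k2 : x * 2 ^+ L <= (leaf_index L x).+1%:R.
  by rewrite -[leRHS]/((leaf_index L x).+1%:Z%:~R) -ceil_le_int cE.
split; last by rewrite k1.
by rewrite -(ltr_nat R) natrX (lt_le_trans k1)// ler_piMl// ltW.
Qed.

Definition trunc (m : mode) y : R * R * R :=
  match m with
  | NoLevyArea => (y.1.1, 0, 0)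
  | SpaceTime => (y.1, 0)
  | SpaceTimeTime => y
  end.

(** Rule (C) is triangular: W uses W only, and [\bar H] uses W and [\bar H] only. Hence padding the
    absent components does not affect the others. *)
Lemma trunc_concat (m : mode) (s r : R) y z :
  trunc m (stt_concat s r y z) = trunc m (stt_concat s r (trunc m y) (trunc m z)).
Proof. by case: m; case: y => -[W H] K; case: z => -[W' H'] K'. Qed.

Lemma truncK (m : mode) y : trunc m (trunc m y) = trunc m y.
Proof. by case: m. Qed.

Lemma dot_trunc (m : mode) u y : masked m u -> dot u (trunc m y) = dot u y.
Proof. by case: m => //= [[u1 u2]|u2]; rewrite /dot /= ?u1 u2; ring. Qed.

(** Proceeds leaf by leaf from 0, whereas the tree reaches [k] through coarser levels. In this form
    one function of the leaf triples serves the tree and the Brownian path. *)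
Fixpoint time_of (L : nat) (D : nat -> R * R * R) (k : nat) : R * R * R :=
  if k is k'.+1 then
    stt_concat (k'%:R / 2 ^+ L) (k'.+1%:R / 2 ^+ L) (time_of L D k') (D k')
  else (0, 0, 0).

Lemma double_div (l j : nat) : j.*2%:R / 2 ^+ l.+1 = j%:R / 2 ^+ l :> R.
Proof. by rewrite exprS -muln2 natrM; field; rewrite expf_neq0. Qed.

(** If [k.+1] is odd, this is the definition. If it is even, its value comes from the coarser level,
    and crossing the two halves must agree with crossing the parent: that is the second hypothesis,
    the compatibility of rule (C) with the midpoint step. *)
Lemma tree_time_succ (Y : Type) (zero root : Y) split concat (l k : nat) :
    concat 0 1 zero root = root ->
    (forall l j (y Y0 : Y),
      concat (j.*2.+1%:R / 2 ^+ l.+1) (j.+1%:R / 2 ^+ l)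
        (concat (j%:R / 2 ^+ l) (j.*2.+1%:R / 2 ^+ l.+1) y (split l j Y0).1)
        (split l j Y0).2 =
      concat (j%:R / 2 ^+ l) (j.+1%:R / 2 ^+ l : R) y Y0) ->
    (k < 2 ^ l)%N ->
  let tt := tree_time zero (tree_interval root split) concat in
  tt l k.+1 = concat (k%:R / 2 ^+ l) (k.+1%:R / 2 ^+ l) (tt l k)
    (tree_interval root split l k).
Proof.
move=> concat0 concatS kl /=; elim: l k kl => [|l IH] k kl.
  by move: kl; rewrite expn0; case: k => //= _; rewrite expr0 mul0r divr1.
move: kl; have [j [->|->]] : exists j, k = j.*2 \/ k = j.*2.+1.
  exists k./2; rewrite -{1 3}(odd_double_half k).
  by case: (odd k); [right|left].
  by move=> _; rewrite [in RHS]double_div /= odd_double /= uphalf_double doubleK.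
move=> kl; have jl : (j < 2 ^ l)%N.
  by move: kl; rewrite expnS mul2n -[(j < _)%N]ltn_double => /ltnW.
rewrite -doubleS double_div.
transitivity (concat (j%:R / 2 ^+ l) (j.+1%:R / 2 ^+ l)
  (tree_time zero (tree_interval root split) concat l j) (tree_interval root split l j)).
  by rewrite -IH// /= odd_double doubleK.
by rewrite -concatS /= odd_double /= uphalf_double doubleK.
Qed.

Section vbt.
Variable g : site -> nat -> R.

Definition vbt_time (m : mode) (l k : nat) : R * R * R :=
  match m with
  | NoLevyArea => (none_time g l k, 0, 0)
  | SpaceTime => (st_time g l k, 0)
  | SpaceTimeTime => stt_time g l k
  end.

Lemma none_time0 l : none_time g l 0 = 0.
Proof. by elim: l. Qed.

Lemma tree_time0 (Y : Type) (zero : Y) interval concat l :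
  @tree_time R Y zero interval concat l 0 = zero.
Proof. by elim: l. Qed.

Lemma vbt_timeE (m : mode) (L k : nat) : (k <= 2 ^ L)%N ->
  vbt_time m L k = trunc m (time_of L (vbt_interval g m L) k).
Proof.
elim: k => [_|k IH kL].
  by case: m => /=; rewrite ?none_time0 // /st_time /stt_time tree_time0.
rewrite [time_of _ _ _]/= trunc_concat -IH; last exact: ltnW.
case: m {IH} => /=.
- by rewrite addrC subrK.
- rewrite /st_time tree_time_succ//.
  + rewrite -/(st_interval g) -/(st_time g).
    by case: (st_time g L k) => W H; case: (st_interval g L k) => W' H'.
  + by rewrite /=; congr (_, _); ring.
  + move=> l j [W H] [W' H'] /=.
    rewrite -(natr1 j) -(natr1 j.*2) -muln2 natrM exprS.
    have h : 2 ^+ l != 0 :> R by rewrite expf_neq0.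
    by congr (_, _); field.
- rewrite /stt_time tree_time_succ//.
  + by rewrite /=; congr (_, _, _); ring.
  + move=> l j [[W H] K] [[W' H'] K'] /=.
    rewrite -(natr1 j) -(natr1 j.*2) -muln2 natrM exprS.
    have h : 2 ^+ l != 0 :> R by rewrite expf_neq0.
    by congr (_, _, _); field.
Qed.

Lemma vbt_queryE (m : mode) (A : R -> 'M[R]_3) (L : nat) (x : R) (i : nat) :
  let k := leaf_index L x in
  let y := stt_concat (k%:R / 2 ^+ L) x (vbt_time m L k) (vbt_partial g m (A x) L k x) in
  (i < ncomp m)%N ->
  nth 0 (vbt_query m g A L x) i = nth 0 [:: y.1.1; y.1.2; y.2] i.
Proof.
case: m => /=.
- by case: i => //= _; rewrite /none_query addrA.
- rewrite /st_query; case: (st_interval _ _ _) => W H; case: (st_time _ _ _) => W' H'.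
  by case: i => [|[|i]].
- rewrite /stt_query; case: (stt_interval _ _ _) => -[W H] K.
  by case: (stt_time _ _ _) => -[W' H'] K'; case: i => [|[|[|i]]].
Qed.

(** A dyadic query is the right end of its leaf, so it undergoes the final interpolation with
    [q = 0], where every noise coefficient vanishes. In mode [SpaceTimeTime] the covariance then has
    zero diagonal, so the rows of any square root have norm 0. *)
Lemma vbt_partial_end (m : mode) (A : 'M[R]_3) (L k : nat) :
  (m = SpaceTimeTime -> A *m A^T = stt_cov (2 ^- L) (2 ^- L) 0) ->
  vbt_partial g m A L k (k.+1%:R / 2 ^+ L) = vbt_interval g m L k.
Proof.
have h0 : 2 ^+ L != 0 :> R by rewrite expf_neq0.
have pE : k.+1%:R / 2 ^+ L - k%:R / 2 ^+ L = 2 ^- L :> R.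
  by rewrite -natr1; field.
rewrite /vbt_partial subrr pE; case: m => /= [_|_|/(_ erefl) AA].
- by rewrite mulr0 mul0r sqrtr0 mul0r addr0; congr (_, _, _); field.
- case: (st_interval g L k) => W H; rewrite !powR0 ?mulf_neq0 ?invr_neq0//.
  rewrite !(mulr0, mul0r, addr0, subr0).
  by congr (_, _, _); field.
- have A0 : A = 0.
    apply/matrixP => i j; rewrite mxE.
    have : (A *m A^T) i i = 0.
      rewrite AA mxE; case: i => -[|[|[|i]]] //= _; field; done.
    rewrite mxE => /eqP; rewrite psumr_eq0 => [/allP/(_ j)|k' _]; last first.
      by rewrite mxE -expr2 sqr_ge0.
    by rewrite mem_index_enum mxE -expr2 sqrf_eq0 => /(_ isT)/eqP.
  case: (stt_interval g L k) => -[W H] K; rewrite A0 mul0mx !mxE.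
  by congr (_, _, _); field.
Qed.

End vbt.
End dyadic_times.

(** * Levy areas as limits of Riemann sums *)

Section riemann_sums.
Variable R : realType.
Local Notation mu := (@lebesgue_measure R).

Lemma continuous_integrable_itv (f : R -> R) (s t : R) : continuous f ->
  mu.-integrable `[s, t] (EFin \o f).
Proof.
move=> cf; apply: continuous_compact_integrable; first exact: segment_compact.
exact: continuous_subspaceT.
Qed.

Lemma continuous_bounded_itv (f : R -> R) (s t : R) : continuous f ->
  exists M, forall r, s <= r <= t -> `|f r| <= M.
Proof.
move=> cf; have [st|st] := leP s t; last first.
  by exists 0 => r /andP[sr rt]; have := le_trans sr rt; rewrite leNgt st.
have cn : {within `[s, t], continuous (fun r => `|f r|)}.
  by apply: continuous_subspaceT => r; apply: cvg_norm; exact: cf.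
have [c _ fc] := EVT_max st cn.
by exists `|f c| => r rst; apply: fc; rewrite in_itv.
Qed.

Lemma harmonic_scale_cvg0 (a : R) : a * n.+1%:R^-1 @[n --> \oo] --> (0 : R).
Proof.
rewrite -[X in _ --> X](mulr0 a); apply: cvgM; first exact: cvg_cst.
exact: cvg_harmonic.
Qed.

(** The sums are integrals of the step functions [phi n], which converge pointwise by continuity and
    are bounded by a bound of [|f|] on the interval. *)
Lemma riemann_cvg (f : R -> R) (s t : R) : continuous f -> s < t ->
  (t - s) / n.+1%:R * \sum_(m < n.+1) f (s + (t - s) * (m%:R / n.+1%:R))
    @[n --> \oo] --> \int[mu]_(r in `[s, t]) f r.
Proof.
move=> cf st; have h0 : 0 < t - s by rewrite subr_gt0.
pose h := t - s; rewrite -/h.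
pose pt (n m : nat) : R := s + h * (m%:R / n.+1%:R).
pose J n m : set R := `[pt n m, pt n m.+1[%classic.
have mJ n m : measurable (J n m) by exact: measurable_itv.
pose phi n (r : R) : R := \sum_(m < n.+1) f (pt n m) * \1_(J n m) r.
have ptS n m : pt n m.+1 = pt n m + h / n.+1%:R.
  have N0 : n.+1%:R != 0 :> R by rewrite pnatr_eq0.
  by rewrite /pt -(natr1 m); move: N0; move: (n.+1%:R) => N N0; field.
have lt_pt n m : pt n m < pt n m.+1.
  by rewrite ptS ltrDl divr_gt0.
have [C fC] := continuous_bounded_itv s t cf.
have C0 : 0 <= C by apply: le_trans (fC s _) => //; rewrite lexx ltW.
have pt_itv n m : (m <= n.+1)%N -> s <= pt n m <= t.
  move=> mn; have N0 : 0 < n.+1%:R :> R by rewrite ltr0n.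
  have m0 : 0 <= m%:R / n.+1%:R :> R by rewrite divr_ge0.
  have m1 : m%:R / n.+1%:R <= 1 :> R by rewrite ler_pdivrMr// mul1r ler_nat.
  rewrite /pt; apply/andP; split; first by rewrite lerDl mulr_ge0// ltW.
  by rewrite -lerBrDl -/h ler_piMr// ltW.
have le_pt n m m' : (m <= m')%N -> pt n m <= pt n m'.
  move=> mm; rewrite lerD2l ler_pM2l// ler_pM2r ?invr_gt0 ?ltr0n//.
  by rewrite ler_nat.
have phiE n (r : R) (m0 : 'I_n.+1) : J n m0 r -> phi n r = f (pt n m0).
  move=> Jr; rewrite /phi (bigD1 m0)//= [\1_(J n m0) r]indicE mem_set// mulr1 big1 ?addr0//.
  move=> m mm0; rewrite indicE memNset ?mulr0//.
  move: Jr; rewrite /J /= !in_itv/= => /andP[r1 r2] /andP[r3 r4].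
  move: mm0; rewrite -(inj_eq val_inj)/= neq_ltn => /orP[mm|mm].
    by have := le_pt n _ _ mm; rewrite leNgt (le_lt_trans r1 r4).
  by have := le_pt n _ _ mm; rewrite leNgt (le_lt_trans r3 r2).
(* The cell containing [r] is numbered by the integer part of [(r - s) / h * n.+1]. *)
have inJ n (r : R) : s <= r < t -> exists m0 : 'I_n.+1, J n m0 r.
  move=> /andP[sr rt]; pose y := (r - s) / h * n.+1%:R.
  have y0 : 0 <= y by rewrite mulr_ge0// divr_ge0// ?subr_ge0// ltW.
  have yn : y < n.+1%:R.
    by rewrite -[ltRHS]mul1r ltr_pM2r ?ltr0n// ltr_pdivrMr// mul1r ltrD2r.
  have m0n : (Num.truncn y < n.+1)%N.
    by rewrite -(ltr_nat R); apply: le_lt_trans yn; rewrite truncn_le.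
  exists (Ordinal m0n); rewrite /J /= in_itv/=.
  have rE : r = s + h * (y / n.+1%:R).
    have N0 : n.+1%:R != 0 :> R by rewrite pnatr_eq0.
    rewrite /y; move: N0; move: (n.+1%:R) => N N0; field.
    by rewrite N0 gt_eqF.
  suff : pt n (Num.truncn y) <= s + h * (y / n.+1%:R) < pt n (Num.truncn y).+1.
    by rewrite -rE.
  rewrite /pt.
  rewrite lerD2l ltrD2l !ler_pM2l// !ltr_pM2l// ler_pM2r ?invr_gt0 ?ltr0n//.
  rewrite ltr_pM2r ?invr_gt0 ?ltr0n// truncn_le//=.
  by rewrite y0 truncnS_gt.
have out n (r : R) : ~ s <= r < t -> phi n r = 0.
  move=> nr; rewrite /phi big1// => m _; rewrite indicE memNset ?mulr0// /J /= in_itv/=.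
  move=> /andP[r1 r2]; apply: nr; apply/andP; split.
    by apply: le_trans r1; have /andP[] := pt_itv n m (ltnW (ltn_ord m)).
  by apply: lt_le_trans r2 _; have /andP[] := pt_itv n m.+1 (ltn_ord m).
have iJ n m : mu.-integrable [set: R] (EFin \o (\1_(J n m) : R -> R)).
  exact: integrable_indic_itv.
(* The half-open cells leave out the end [t], a null set. *)
pose I : set R := `[s, t[%classic.
have mI : measurable I by exact: measurable_itv.
have iI : mu.-integrable [set: R] (EFin \o (fun r => C * \1_I r)).
  exact: (integrableZl measurableT C (integrable_indic_itv s t true true)).
have mf : measurable_fun [set: R] f by exact: continuous_measurable_fun.
have [||||_ c1] := @Rdominated_convergence _ _ _ mu phi
  (fun r => f r * \1_I r) (fun r => C * \1_I r).
- move=> n; apply: measurable_sum => m; apply: measurable_funM => //.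
  by apply: measurable_indic; exact: mJ.
- move=> r; have [rst|rst] := pselect (s <= r < t); last first.
    rewrite indicE memNset ?mulr0; last by rewrite /I /= in_itv.
    by apply: cvg_near_cst; apply: nearW => n; exact: out.
  rewrite indicE mem_set ?mulr1; last by rewrite /I /= in_itv.
  apply/cvgrPdist_lt => e e0.
  have /cvgrPdist_lt/(_ e e0) := cf r.
  move=> /nbhs_ballP[dl /= dl0 Hdl].
  have /cvgrPdist_lt/(_ dl dl0) := harmonic_scale_cvg0 h.
  apply: filterS => n; rewrite sub0r normrN => hn.
  have [m0 Jm0] := inJ n r rst; rewrite (phiE n r m0)//.
  apply: Hdl; rewrite /ball/=; apply: le_lt_trans hn.
  move: Jm0; rewrite /J /= in_itv/= ptS => /andP[r1 r2].
  by rewrite ger0_norm ?subr_ge0// ler_normr; apply/orP; left; rewrite lerBlDl ltW.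
- exact: iI.
- move=> n r; have [rst|rst] := pselect (s <= r < t); last first.
    by rewrite out// normr0 mulr_ge0// indicE ler0n.
  have [m0 Jm0] := inJ n r rst; rewrite (phiE n r m0)// indicE mem_set ?mulr1.
    by apply: fC; exact: pt_itv (ltnW (ltn_ord m0)).
  by rewrite /I /= in_itv.
have -> : \int[mu]_(r in `[s, t]) f r = \int[mu]_r (f r * \1_I r).
  rewrite -(Rintegral_itv_bndo_bndc (r := t)).
    rewrite Rintegral_mkcond; apply: eq_Rintegral => r _.
    by rewrite patchE [\1_I r]indicE; case: ifP => _; rewrite ?mulr1 ?mulr0.
  have := continuous_integrable_itv s t cf; apply: integrableS => //.
  by move=> r /=; rewrite !in_itv/= => /andP[-> /ltW ->].
have -> : (fun n => h / n.+1%:R * \sum_(m < n.+1) f (s + h * (m%:R / n.+1%:R))) =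
    (fun n => \int[mu]_r phi n r).
  apply/funext => n; rewrite Rintegral_sum.
    rewrite mulr_sumr; apply: eq_bigr => m _.
    rewrite (RintegralZl (f (pt n m)) measurableT (iJ n m)).
    rewrite mulrC; congr (_ * _).
    rewrite /Rintegral integral_indic//; last exact: mJ.
    transitivity (fine (mu (J n m))); last first.
      by apply: (congr1 fine); apply: (congr1 mu); exact/esym/setIT.
    rewrite lebesgue_measure_itv/= lte_fin lt_pt.
    by rewrite -EFinB/= ptS addrC addKr.
  by move=> m; exact: (integrableZl measurableT (f (pt n m)) (iJ n m)).
exact: c1.
Qed.

End riemann_sums.

Section levy_areas.
Variable R : realType.
Local Notation mu := (@lebesgue_measure R).

Lemma Rintegral_quadratic (a b c s t : R) : s < t ->
  \int[mu]_(r in `[s, t]) (a + b * r + c * r ^+ 2) =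
  a * (t - s) + b * (t ^+ 2 - s ^+ 2) / 2 + c * (t ^+ 3 - s ^+ 3) / 3.
Proof.
move=> st; pose F (r : R) := a * r + b / 2 * r ^+ 2 + c / 3 * r ^+ 3.
have dF (r : R) : is_derive r 1 F (a + b * r + c * r ^+ 2).
  have -> : F = (a \*: id) \+ ((b / 2) \*: (fun r => r ^+ 2)) \+ ((c / 3) \*: (fun r => r ^+ 3)) by [].
  by apply: is_derive_eq; rewrite /GRing.scale/=; field.
rewrite /Rintegral (@continuous_FTC2 _ _ F _ _ st).
- by rewrite -EFinB /= /F; field.
- apply: continuous_subspaceT => r.
  apply: cvgD; first (apply: cvgD; first exact: cvg_cst).
    by apply: cvgM; [exact: cvg_cst|exact: cvg_id].
  by apply: cvgM; [exact: cvg_cst|exact: exprn_continuous].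
- have cF r : {for r, continuous F} by exact: (is_derive_continuous (dF r)).
  split=> [r _||]; first exact: ex_derive.
    by apply: cvg_at_right_filter; exact: cF.
  by apply: cvg_at_left_filter; exact: cF.
- by move=> r _; rewrite derive1E; exact: derive_val.
Qed.

Lemma Rintegral_itv_cat (f : R -> R) (s r t : R) : continuous f ->
  s <= r <= t ->
  \int[mu]_(v in `[s, t]) f v = \int[mu]_(v in `[s, r]) f v + \int[mu]_(v in `[r, t]) f v.
Proof.
move=> cf /andP[sr rt]; have ci := @continuous_integrable_itv R f.
rewrite -(@Rintegral_itv_obnd_cbnd _ r (BRight t)).
  rewrite -(@Rintegral_itvB _ f (BLeft s) (BRight t) r) ?bnd_simp//.
    by rewrite addrC subrK.
  exact: ci.
have := ci r t cf; apply: integrableS => //.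
by move=> v /=; rewrite !in_itv/= => /andP[/ltW -> ->].
Qed.

Variable x : R -> R.
Hypothesis cx : continuous x.

(* (W, \bar H, \bar K) over the interval [s, t]. *)
Definition levy_triple (y : R -> R) (s t : R) : R * R * R :=
  (y t - y s, (t - s) * levyH y s t, (t - s) ^+ 2 * levyK y s t).

Let I0 (s t : R) := \int[mu]_(r in `[s, t]) x r.
Let I1 (s t : R) := \int[mu]_(r in `[s, t]) (r * x r).

Let cx1 : continuous (fun r : R => r * x r).
Proof. by move=> r; apply: cvgM; [exact: cvg_id|exact: cx]. Qed.

Let cq (a b c : R) : continuous (fun r : R => a + b * r + c * r ^+ 2).
Proof.
move=> r; apply: cvgD; first (apply: cvgD; first exact: cvg_cst).
  by apply: cvgM; [exact: cvg_cst|exact: cvg_id].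
by apply: cvgM; [exact: cvg_cst|exact: exprn_continuous].
Qed.

(** The bridge is the path minus its chord, so its integrals reduce to the moments [I0] and [I1] of
    the path and integrals of polynomials of degree at most 2. As these moments are additive over
    adjacent intervals, rule (C) becomes an algebraic identity. *)
Lemma levy_tripleE (s t : R) : s < t ->
  levy_triple x s t =
  (x t - x s, I0 s t - (t - s) * (x s + x t) / 2,
   (s + t) / 2 * I0 s t - I1 s t + (t - s) ^+ 2 / 12 * (x t - x s)).
Proof.
move=> st; have h0 : t - s != 0 by rewrite subr_eq0 gt_eqF.
have ci (f : R -> R) : continuous f -> mu.-integrable `[s, t] (EFin \o f).
  exact: continuous_integrable_itv.
rewrite /levy_triple /levyH /levyK lt_eqF//; congr (_, _, _).
  rewrite mulrA divff// mul1r.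
  (* Chosen so that [bridge x s t r = x r + a + b * r]. *)
  pose b := - (x t - x s) / (t - s); pose a := - x s - s * b.
  transitivity (\int[mu]_(r in `[s, t]) (x r + (a + b * r + 0 * r ^+ 2))).
    by apply: eq_Rintegral => r _; rewrite /bridge /a /b; field.
  rewrite RintegralD//; [|exact: ci|exact: ci].
  rewrite Rintegral_quadratic// -/(I0 s t) /a /b.
  by field.
rewrite mulrA divff ?expf_neq0// mul1r.
pose m := (t + s) / 2.
pose b := - (x t - x s) / (t - s); pose a := - x s - s * b.
transitivity (\int[mu]_(r in `[s, t])
    (m * x r + (- 1 * (r * x r) + (a * m + (b * m - a) * r + - b * r ^+ 2)))).
  by apply: eq_Rintegral => r _; rewrite /bridge /a /b /m; field.
have cm : continuous (fun r : R => m * x r).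
  by move=> r; apply: cvgM; [exact: cvg_cst|exact: cx].
have c1 : continuous (fun r : R => - 1 * (r * x r)).
  by move=> r; apply: cvgM; [exact: cvg_cst|exact: cx1].
rewrite RintegralD//; [|exact: ci|]; last first.
  by apply: ci => r; apply: cvgD; [exact: c1|exact: cq].
rewrite RintegralD//; [|exact: ci|exact: ci].
rewrite Rintegral_quadratic// !RintegralZl//; [|exact: ci|exact: ci].
rewrite -/(I0 s t) -/(I1 s t) /a /b /m.
by field.
Qed.

Lemma levy_triplexx (s : R) : levy_triple x s s = (0, 0, 0).
Proof. by rewrite /levy_triple /levyH /levyK eqxx !subrr !mulr0. Qed.

(** Times are counted from [s], whence the arguments [r - s] and [t - s]. Empty intervals are
    treated apart because [levyH] and [levyK] take the default value 0 there. *)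
Lemma levy_triple_concat (s r t : R) : s <= r <= t ->
  levy_triple x s t =
  stt_concat (r - s) (t - s) (levy_triple x s r) (levy_triple x r t).
Proof.
move=> /andP[]; rewrite !le_eqVlt => /orP[/eqP <-|sr] /orP[/eqP <-|rt].
- by rewrite levy_triplexx /= subrr; congr (_, _, _); field.
- rewrite levy_triplexx subrr levy_tripleE//=.
  by congr (_, _, _); field.
- rewrite levy_triplexx levy_tripleE//=.
  by congr (_, _, _); field.
have srt : s <= r <= t by rewrite !ltW.
have st := lt_trans sr rt.
rewrite !levy_tripleE// /I0 /I1 !(Rintegral_itv_cat _ srt)//=.
by congr (_, _, _); field.
Qed.

(* Discretisation of the Legendre kernels 1, (s + t) / 2 - r and
   h^2 / 12 - (r - s) (t - r) / 2, for which [dot u (levy_triple x s t)] is the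
   integral against dx; [e] is the inverse of the number of steps. *)
Definition levy_kernel (u : R * R * R) (h e : R) (m : nat) : R :=
  u.1.1 + u.1.2 * h * (1 / 2 - e * m.+1%:R)
  + u.2 * h ^+ 2 * (1 / 12 - e * m%:R * (1 - e * m.+1%:R) / 2).

(** Summation by parts leaves Riemann sums of the path and of the path times [r]. Thanks to the
    mixture of [m] and [m.+1] in the kernel, the only error is the last term, of order [e]. *)
Lemma levy_kernel_abel (u : R * R * R) (s h : R) (y : nat -> R) (n : nat) :
  let e := n.+1%:R^-1 in
  \sum_(m < n.+1) levy_kernel u h e m * (y m.+1 - y m) =
  u.1.1 * (y n.+1 - y 0%N)
  + u.1.2 * (h / n.+1%:R * \sum_(m < n.+1) y m - h * (y 0%N + y n.+1) / 2)
  + u.2 * ((s + (s + h)) / 2 * (h / n.+1%:R * \sum_(m < n.+1) y m)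
     - h / n.+1%:R * \sum_(m < n.+1) ((s + h * (m%:R / n.+1%:R)) * y m)
     + h ^+ 2 / 12 * (y n.+1 - y 0%N) - h ^+ 2 * y 0%N / 2 * e).
Proof.
move=> e.
(* The number of terms is separated from [e] for the induction; [e = 1 / n.+1] is substituted at the
   end. *)
have A (N : nat) : \sum_(m < N) levy_kernel u h e m * (y m.+1 - y m) =
    u.1.1 * (y N - y 0%N)
    + u.1.2 * h * ((y N - y 0%N) / 2 - e * (N%:R * y N - \sum_(m < N) y m))
    + u.2 * h ^+ 2 * ((y N - y 0%N) / 12
        - e / 2 * ((N%:R - 1) * y N - \sum_(m < N) y m + y 0%N)
        + e ^+ 2 / 2 * (N%:R * (N%:R - 1) * y N - 2 * \sum_(m < N) m%:R * y m)).
  elim: N => [|N IH]; first by rewrite !big_ord0; field.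
  by rewrite !big_ord_recr/= IH /levy_kernel -(natr1 N); field.
have N0 : n.+1%:R != 0 :> R by rewrite pnatr_eq0.
have -> : \sum_(m < n.+1) (s + h * (m%:R / n.+1%:R)) * y m =
    s * \sum_(m < n.+1) y m + h * e * \sum_(m < n.+1) m%:R * y m.
  by rewrite !mulr_sumr -big_split/=; apply: eq_bigr => m _; rewrite /e; ring.
rewrite A /e; move: (\sum_(_ < _) _) (\sum_(_ < _) _) N0 => S1 S2.
by move: (n.+1%:R) => N N0; field.
Qed.

Lemma levy_kernel_cvg (u : R * R * R) (s t : R) : s < t ->
  \sum_(m < n.+1) levy_kernel u (t - s) n.+1%:R^-1 m *
     (x (s + (t - s) * (m.+1%:R / n.+1%:R)) - x (s + (t - s) * (m%:R / n.+1%:R)))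
    @[n --> \oo] --> dot u (levy_triple x s t).
Proof.
move=> st; rewrite levy_tripleE// /dot/=.
have c0 := riemann_cvg cx st; have c1 := riemann_cvg cx1 st.
have -> : (fun n => \sum_(m < n.+1) levy_kernel u (t - s) n.+1%:R^-1 m *
     (x (s + (t - s) * (m.+1%:R / n.+1%:R)) - x (s + (t - s) * (m%:R / n.+1%:R)))) =
  (fun n => u.1.1 * (x t - x s)
  + u.1.2 * ((t - s) / n.+1%:R * \sum_(m < n.+1) x (s + (t - s) * (m%:R / n.+1%:R))
      - (t - s) * (x s + x t) / 2)
  + u.2 * ((s + t) / 2 * ((t - s) / n.+1%:R
        * \sum_(m < n.+1) x (s + (t - s) * (m%:R / n.+1%:R)))
     - (t - s) / n.+1%:R * \sum_(m < n.+1) ((s + (t - s) * (m%:R / n.+1%:R))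
        * x (s + (t - s) * (m%:R / n.+1%:R)))
     + (t - s) ^+ 2 / 12 * (x t - x s) - (t - s) ^+ 2 * x s / 2 * n.+1%:R^-1)).
  apply/funext => n.
  have N0 : n.+1%:R != 0 :> R by rewrite pnatr_eq0.
  have := @levy_kernel_abel u s (t - s)
    (fun m => x (s + (t - s) * (m%:R / n.+1%:R))) n.
  by rewrite /= => ->; rewrite mul0r mulr0 addr0 divff// mulr1 (subrKC s t).
apply: cvgD.
  apply: cvgD; first exact: cvg_cst.
  by apply: cvgM; [exact: cvg_cst|apply: cvgB; [exact: c0|exact: cvg_cst]].
apply: cvgM; first exact: cvg_cst.
rewrite -[X in _ --> X]subr0; apply: cvgB; last exact: harmonic_scale_cvg0.
apply: cvgD; last exact: cvg_cst.
by apply: cvgB; [apply: cvgM; [exact: cvg_cst|exact: c0]|exact: c1].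
Qed.

End levy_areas.

Section levy_variance.
Variable R : realType.

(** The kernel at step [m] is [a0 + a1 x + a2 x^2] with [x = e m], so the closed forms for sums of
    powers up to the fourth apply. *)
Lemma levy_kernel_variance (u : R * R * R) (h : R) (n : nat) :
  let e := n.+1%:R^-1 in
  let a0 := u.1.1 + u.1.2 * h * (1 / 2 - e) + u.2 * h ^+ 2 / 12 in
  let a1 := - (u.1.2 * h) - u.2 * h ^+ 2 * (1 - e) / 2 in
  let a2 := u.2 * h ^+ 2 / 2 in
  \sum_(m < n.+1) levy_kernel u h e m ^+ 2 * (h / n.+1%:R) =
  h * (a0 ^+ 2 + a0 * a1 * (1 - e)
    + (a1 ^+ 2 + 2 * a0 * a2) * ((1 - e) * (2 - e) / 6)
    + 2 * a1 * a2 * ((1 - e) ^+ 2 / 4)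
    + a2 ^+ 2 * ((1 - e) * (2 - e) * (3 - 3 * e - e ^+ 2) / 30)).
Proof.
move=> e a0 a1 a2.
have A (N : nat) : \sum_(m < N) levy_kernel u h e m ^+ 2 =
    a0 ^+ 2 * N%:R + a0 * a1 * e * (N%:R * (N%:R - 1))
    + (a1 ^+ 2 + 2 * a0 * a2) * e ^+ 2 * ((N%:R - 1) * N%:R * (2 * N%:R - 1) / 6)
    + 2 * a1 * a2 * e ^+ 3 * (N%:R * (N%:R - 1)) ^+ 2 / 4
    + a2 ^+ 2 * e ^+ 4 * ((N%:R - 1) * N%:R * (2 * N%:R - 1)
        * (3 * N%:R ^+ 2 - 3 * N%:R - 1) / 30).
  elim: N => [|N IH]; first by rewrite !big_ord0; field.
  rewrite !big_ord_recr/= IH.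
  have -> : levy_kernel u h e N = a0 + a1 * (e * N%:R) + a2 * (e * N%:R) ^+ 2.
    by rewrite /levy_kernel /a0 /a1 /a2 -(natr1 N); field.
  by clear IH; move: a0 a1 a2 => a0 a1 a2; rewrite -(natr1 N); field.
rewrite -mulr_suml A.
have N0 : n.+1%:R != 0 :> R by rewrite pnatr_eq0.
move: a0 a1 a2 {A} => a0 a1 a2; rewrite /e; move: (n.+1%:R) N0 => N N0.
by field.
Qed.

(** The sum is a polynomial in [e], and its value at [e = 0] is the integral of the squared kernel;
    orthogonality removes the cross terms. *)
Lemma levy_kernel_variance_cvg (u : R * R * R) (h : R) :
  \sum_(m < n.+1) levy_kernel u h n.+1%:R^-1 m ^+ 2 * (h / n.+1%:R)
    @[n --> \oo] --> levy_var h u.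
Proof.
pose v (e : R) : R :=
  let a0 := u.1.1 + u.1.2 * h * (1 / 2 - e) + u.2 * h ^+ 2 / 12 in
  let a1 := - (u.1.2 * h) - u.2 * h ^+ 2 * (1 - e) / 2 in
  let a2 := u.2 * h ^+ 2 / 2 in
  h * (a0 * a0 + a0 * a1 * (1 - e)
    + (a1 * a1 + 2 * a0 * a2) * ((1 - e) * (2 - e) / 6)
    + 2 * a1 * a2 * ((1 - e) * (1 - e) / 4)
    + a2 ^+ 2 * ((1 - e) * (2 - e) * (3 - 3 * e - e * e) / 30)).
have -> : (fun n => \sum_(m < n.+1) levy_kernel u h n.+1%:R^-1 m ^+ 2 * (h / n.+1%:R)) =
    (fun n => v n.+1%:R^-1).
  by apply/funext => n; rewrite levy_kernel_variance /v /=; ring.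
have -> : levy_var h u = v 0.
  by rewrite /levy_var /v /=; field.
pose e n : R := n.+1%:R^-1.
have ce : e @ \oo --> (0 : R) by exact: cvg_harmonic.
have ccst (a : R) : (cst a : nat -> R) @ \oo --> a by exact: cvg_cst.
have cM (f g : nat -> R) (a b : R) : f @ \oo --> a -> g @ \oo --> b ->
  (fun n => f n * g n) @ \oo --> a * b by exact: cvgM.
have cD (f g : nat -> R) (a b : R) : f @ \oo --> a -> g @ \oo --> b ->
  (fun n => f n + g n) @ \oo --> a + b by exact: cvgD.
have cB (f g : nat -> R) (a b : R) : f @ \oo --> a -> g @ \oo --> b ->
  (fun n => f n - g n) @ \oo --> a - b by exact: cvgB.
have c1 (a : R) := cB _ _ _ _ (ccst a) ce.
pose A0 (e : R) := u.1.1 + u.1.2 * h * (1 / 2 - e) + u.2 * h ^+ 2 / 12.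
pose A1 (e : R) := - (u.1.2 * h) - u.2 * h ^+ 2 * (1 - e) / 2.
pose a2 := u.2 * h ^+ 2 / 2.
have cA0 : (A0 \o e) @ \oo --> A0 0.
  exact: (cD _ _ _ _ (cD _ _ _ _ (ccst _) (cM _ _ _ _ (ccst _) (c1 _))) (ccst _)).
have cA1 : (A1 \o e) @ \oo --> A1 0.
  exact: (cB _ _ _ _ (ccst _) (cM _ _ _ _ (cM _ _ _ _ (ccst _) (c1 _)) (ccst _))).
have cA2 := ccst a2.
have t2 := cM _ _ _ _ (cM _ _ _ _ cA0 cA1) (c1 1).
have t3 := cM _ _ _ _ (cD _ _ _ _ (cM _ _ _ _ cA1 cA1) (cM _ _ _ _ (cM _ _ _ _ (ccst 2) cA0) cA2))
  (cM _ _ _ _ (cM _ _ _ _ (c1 1) (c1 2)) (ccst (6^-1))).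
have t4 := cM _ _ _ _ (cM _ _ _ _ (cM _ _ _ _ (ccst 2) cA1) cA2) (cM _ _ _ _ (cM _ _ _ _ (c1 1) (c1 1)) (ccst 4^-1)).
have q := cB _ _ _ _ (cB _ _ _ _ (ccst 3) (cM _ _ _ _ (ccst 3) ce)) (cM _ _ _ _ ce ce).
have t5 := cM _ _ _ _ (ccst (a2 ^+ 2)) (cM _ _ _ _ (cM _ _ _ _ (cM _ _ _ _ (c1 1) (c1 2)) q) (ccst 30^-1)).
exact: (cM _ _ _ _ (ccst h) (cD _ _ _ _ (cD _ _ _ _ (cD _ _ _ _ (cD _ _ _ _ (cM _ _ _ _ cA0 cA0) t2) t3) t4) t5)).
Qed.

End levy_variance.

(** * Gaussianity of the Brownian Levy areas *)

Section brownian_levy_areas.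
Context d (O : measurableType d) (R : realType) (P : probability O R).
Variables (n : nat) (W : R -> O -> n.-tuple R).
Hypothesis bmW : brownian_motion P W.

Let path (j : 'I_n) (w : O) (t : R) : R := tnth (W t w) j.

(* The path is only continuous on [0, +oo[. *)
Let path0 (j : 'I_n) (w : O) (t : R) : R := path j w (Num.max 0 t).

(** The clamp [Num.max 0] is 1-Lipschitz with values in [0, +oo[, so continuity within that
    half-line yields continuity everywhere. *)
Let continuous_path0 j w : continuous (path0 j w).
Proof.
move=> t; have := @bm_continuous _ _ _ _ _ _ bmW w j => /subspace_continuousP.
have m0 (r : R) : 0 <= Num.max 0 r by rewrite le_max lexx.
move=> /(_ (Num.max 0 t) (m0 t)) c.
apply/cvgrPdist_lt => e e0.
have /cvgrPdist_lt/(_ e e0) := c; rewrite near_withinE => /nbhs_ballP[dl /= dl0 H].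
apply/nbhs_ballP; exists dl => //= r; rewrite /ball/= => tr.
apply: H; last exact: m0.
rewrite /ball/=; apply: le_lt_trans tr.
have := ler_norm (t - r); have := ler_norm (- (t - r)); rewrite normrN => h1 h2.
rewrite ler_norml.
by case: (leP 0 t) => t0; case: (leP 0 r) => r0; apply/andP; split; lra.
Qed.

Lemma levy_triple_path0 j w (s t : R) : 0 <= s -> s <= t ->
  levy_triple (path j w) s t = levy_triple (path0 j w) s t.
Proof.
move=> s0; have E (r : R) : 0 <= r -> path0 j w r = path j w r.
  by move=> r0; rewrite /path0 max_r.
rewrite le_eqVlt => /orP[/eqP <-|st]; first by rewrite !levy_triplexx.
have t0 : 0 <= t by rewrite (le_trans s0)// ltW.
rewrite /levy_triple /levyH /levyK /bridge !E// lt_eqF//.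
congr (_, _ * (_ * _), _ * (_ * _)); apply: eq_Rintegral => r /set_mem;
  rewrite /= in_itv/= => /andP[sr _]; rewrite E//; exact: le_trans sr.
Qed.

Lemma levy_triple_path_concat j w (s r t : R) : 0 <= s -> s <= r <= t ->
  levy_triple (path j w) s t =
  stt_concat (r - s) (t - s) (levy_triple (path j w) s r) (levy_triple (path j w) r t).
Proof.
move=> s0 /andP[sr rt]; have st := le_trans sr rt; have r0 := le_trans s0 sr.
rewrite !levy_triple_path0//; apply: levy_triple_concat; first exact: continuous_path0.
by rewrite sr.
Qed.

Lemma sum_ord_mul (V : nmodType) (F : nat -> V) (K M : nat) :
  \sum_(i < K * M) F i = \sum_(p < K) \sum_(m < M) F (p * M + m)%N.
Proof.
elim: K => [|K IH]; first by rewrite !big_ord0.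
by rewrite mulSnr big_split_ord/= IH big_ord_recr.
Qed.

Lemma cvg_sum_ord (K : nat) (F : nat -> 'I_K -> R) (l : 'I_K -> R) :
    (forall i, F^~ i @ \oo --> l i) ->
  (fun M => \sum_i F M i) @ \oo --> \sum_i l i.
Proof.
move=> Fl; elim: K F l Fl => [|K IH] F l Fl.
  by rewrite big_ord0; under eq_fun do rewrite big_ord0; exact: cvg_cst.
rewrite big_ord_recr; under eq_fun do rewrite big_ord_recr.
by apply: cvgD; [apply: (IH (fun M i => F M (widen_ord (leqnSn K) i)))|exact: Fl].
Qed.

(** All intervals are refined together into [M.+1] steps each, so one use of independence of the
    increments over the whole grid makes the discretised sums Gaussian. Then [M] tends to infinity,
    for each path in the sums and numerically in the variances. *)
Lemma gaussian_levy_triples (K : nat) (tau : nat -> R) (u : 'I_n -> nat -> R * R * R) :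
    0 <= tau 0%N -> (forall p, tau p < tau p.+1) ->
  gaussian P
    (fun w => \sum_j \sum_(p < K) dot (u j p) (levy_triple (path j w) (tau p) (tau p.+1)))
    (\sum_j \sum_(p < K) levy_var (tau p.+1 - tau p) (u j p)).
Proof.
move=> tau0 tauS.
have tau_ge0 p : 0 <= tau p.
  by elim: p => // p IH; apply: le_trans IH _; exact: ltW.
pose pt (M i : nat) : R := tau (i %/ M.+1)%N +
  (tau (i %/ M.+1).+1 - tau (i %/ M.+1)%N) * ((i %% M.+1)%N%:R / M.+1%:R).
(* For [m = M.+1] the Euclidean division passes to the next interval, whose left end is the right
   end of the current one. *)
have ptE M p m : (m <= M.+1)%N ->
    pt M (p * M.+1 + m)%N = tau p + (tau p.+1 - tau p) * (m%:R / M.+1%:R).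
  rewrite leq_eqVlt => /orP[/eqP ->|mM].
    rewrite -mulSnr /pt mulnK// modnMl mul0r mulr0 addr0 divff ?pnatr_eq0// mulr1.
    by rewrite subrKC.
  by rewrite /pt divnMDl// divn_small// addn0 modnMDl modn_small.
have ptS M p m : (m < M.+1)%N -> pt M (p * M.+1 + m).+1 - pt M (p * M.+1 + m)%N =
    (tau p.+1 - tau p) / M.+1%:R.
  move=> mM; rewrite -addnS !ptE//; last exact: ltnW.
  have N0 : M.+1%:R != 0 :> R by rewrite pnatr_eq0.
  by rewrite -(natr1 m); move: (M.+1%:R) N0 => N N0; field.
have pt_lt M i : pt M i < pt M i.+1.
  rewrite -subr_gt0 {1 2}(divn_eq i M.+1) ptS ?ltn_mod//.
  by rewrite divr_gt0 ?subr_gt0.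
have pt_ge0 M i : 0 <= pt M i.
  by rewrite addr_ge0// mulr_ge0 ?divr_ge0// subr_ge0 ltW.
pose Z (M : nat) w := \sum_j \sum_(p < K) \sum_(m < M.+1)
  levy_kernel (u j p) (tau p.+1 - tau p) M.+1%:R^-1 m *
  (path j w (pt M (p * M.+1 + m).+1) - path j w (pt M (p * M.+1 + m)%N)).
pose v (M : nat) := \sum_j \sum_(p < K) \sum_(m < M.+1)
  levy_kernel (u j p) (tau p.+1 - tau p) M.+1%:R^-1 m ^+ 2 * ((tau p.+1 - tau p) / M.+1%:R).
apply: (@gaussian_cvg _ _ _ P Z v).
- move=> M; pose c (i : nat) (j : 'I_n) := levy_kernel (u j (i %/ M.+1)%N)
    (tau (i %/ M.+1).+1 - tau (i %/ M.+1)%N) M.+1%:R^-1 (i %% M.+1).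
  have H := @gaussian_independent_sum _ _ _ P n (K * M.+1) 'I_(K * M.+1) setT
    (fun i => increment W (pt M i) (pt M i.+1)) (fun i => pt M i.+1 - pt M i) id
    (fun i => c i) (@inj_id _) (fun=> Logic.I).
  have {H} := H _ _ _.
  rewrite (_ : (\sum_(i < K * M.+1) _) = v M); last first.
    rewrite (sum_ord_mul (fun i => \sum_j c i j ^+ 2 * (pt M i.+1 - pt M i))).
    under eq_bigr do rewrite exchange_big.
    rewrite exchange_big; apply: eq_bigr => j _; apply: eq_bigr => p _.
    apply: eq_bigr => m _; rewrite /c divnMDl// divn_small// addn0 modnMDl modn_small//.
    by rewrite ptS.
  rewrite (_ : (fun w => _) = Z M); last first.
    apply/funext => w.
    rewrite (sum_ord_mul (fun i => \sum_j c i j *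
      tnth (increment W (pt M i) (pt M i.+1) w) j)).
    under eq_bigr do rewrite exchange_big.
    rewrite exchange_big; apply: eq_bigr => j _; apply: eq_bigr => p _.
    apply: eq_bigr => m _; rewrite /c divnMDl// divn_small// addn0 modnMDl modn_small//.
    by rewrite tnth_mktuple.
  apply.
  + by move=> i _; rewrite subr_gt0.
  + by move=> i _; exact: (bm_normal bmW).
  + by apply: (bm_independent bmW) => // i _; exact: ltW.
- move=> w; apply: cvg_sum_ord => j; apply: cvg_sum_ord => p.
  rewrite levy_triple_path0//; last exact: ltW.
  have := @levy_kernel_cvg _ _ (@continuous_path0 j w) (u j p) _ _ (tauS p).
  have path0E (r : R) : 0 <= r -> path0 j w r = path j w r.
    by move=> r0; rewrite /path0 max_r.
  set f := (fun M => _) => cf; set g := (fun M => _).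
  rewrite (_ : g = f)//; apply/funext => M; apply: eq_bigr => m _.
  rewrite -!path0E// -addnS !ptE//; exact: ltnW.
- apply: (@cvg_sum_ord _ (fun M j => \sum_(p < K) \sum_(m < M.+1)
    levy_kernel (u j p) (tau p.+1 - tau p) M.+1%:R^-1 m ^+ 2 * ((tau p.+1 - tau p) / M.+1%:R))).
  by move=> j; apply: cvg_sum_ord => p; exact: levy_kernel_variance_cvg.
Qed.

End brownian_levy_areas.

(** * Values at the query times *)

Section query_values.
Variables (R : realType) (m : mode) (L n : nat).
Implicit Types (u y z : R * R * R) (D E : 'I_n -> nat -> R * R * R).

Definition coord (i : nat) : R * R * R := ((i == 0%N)%:R, (i == 1%N)%:R, (i == 2%N)%:R).

Lemma masked_coord i : (i < ncomp m)%N -> masked m (coord i).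
Proof. by case: m; case: i => [|[|[|i]]]. Qed.

Lemma nth_dot i y : nth 0 [:: y.1.1; y.1.2; y.2] i = dot (coord i) y.
Proof.
by case: i => [|[|[|i]]]; rewrite /dot /coord/= ?nth_nil; ring.
Qed.

(* Triple at the time [x], from the triples [D k] of the leaves and the triples
   [E k] of the parts of the leaves which precede the query. *)
Definition query_value (x : R) (D E : nat -> R * R * R) : R * R * R :=
  let k := leaf_index L x in
  if x == 0 then (0, 0, 0)
  else if x == k.+1%:R / 2 ^+ L then time_of L D k.+1
  else stt_concat (k%:R / 2 ^+ L) x (time_of L D k) (E k).

(** The coefficients come before the quantification over [D] and [E], so the same [b] and [a], and
    hence the same [joint_var], apply to the tree and to the Brownian path. *)
Definition leaf_linear (F : ('I_n -> nat -> R * R * R) -> ('I_n -> nat -> R * R * R) -> R) :=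
  exists b a : 'I_n -> nat -> R * R * R,
    [/\ forall j k, masked m (b j k), forall j k, masked m (a j k) &
    forall D E, F D E = \sum_j \sum_(k <- iota 0 (2 ^ L))
      (dot (b j k) (D j k) + dot (a j k) (E j k))].

Lemma masked0 : masked m ((0, 0, 0) : R * R * R).
Proof. by case: m. Qed.

Lemma leaf_linear0 : leaf_linear (fun _ _ => 0).
Proof.
exists (fun _ _ => (0, 0, 0)), (fun _ _ => (0, 0, 0)); split=> [j k|j k|D E].
- exact: masked0.
- exact: masked0.
- rewrite big1// => j _; rewrite big1// => k _.
  by rewrite /dot/= !mul0r !addr0.
Qed.

Lemma leaf_linearD F G c : leaf_linear F -> leaf_linear G ->
  leaf_linear (fun D E => c * F D E + G D E).
Proof.
move=> [b [a [mb ma FE]]] [b' [a' [mb' ma' GE]]].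
pose comb u v : R * R * R := (c * u.1.1 + v.1.1, c * u.1.2 + v.1.2, c * u.2 + v.2).
have mc u v : masked m u -> masked m v -> masked m (comb u v).
  by rewrite /comb; case: m => //= [[-> ->] [-> ->]|-> ->]; rewrite mulr0 addr0.
exists (fun j k => comb (b j k) (b' j k)), (fun j k => comb (a j k) (a' j k)).
split=> [j k|j k|D E]; [exact: mc|exact: mc|].
rewrite FE GE mulr_sumr -big_split; apply: eq_bigr => j _.
rewrite mulr_sumr -big_split; apply: eq_bigr => k _.
by rewrite /dot /comb/=; ring.
Qed.

Lemma eq_leaf_linear F G : leaf_linear F -> (forall D E, G D E = F D E) ->
  leaf_linear G.
Proof.
by move=> [b [a [mb ma FE]]] GF; exists b, a; split=> // D E; rewrite GF.
Qed.

Lemma leaf_linear_dot (j : 'I_n) k u v : (k < 2 ^ L)%N -> masked m u -> masked m v ->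
  leaf_linear (fun D E => dot u (D j k) + dot v (E j k)).
Proof.
move=> kL mu mv; pose e w j' k' : R * R * R := if (j' == j) && (k' == k) then w else (0, 0, 0).
have me w j' k' : masked m w -> masked m (e w j' k').
  by rewrite /e; case: ifP => // _ _; exact: masked0.
exists (e u), (e v); split=> [j' k'|j' k'|D E]; [exact: me|exact: me|].
rewrite (bigD1 j)//= [X in _ = _ + X]big1 ?addr0; last first.
  move=> j' /negPf jj; rewrite big1// => k' _.
  by rewrite /e jj /= /dot/= !mul0r !addr0.
rewrite (bigD1_seq k) ?iota_uniq ?mem_iota//= [X in _ = _ + X]big1 ?addr0; last first.
  move=> k' /negPf kk.
  by rewrite /e kk andbF /dot/= !mul0r !addr0.
by rewrite /e !eqxx.
Qed.

Lemma masked_pullL p q u : masked m u -> masked m (pullL p q u).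
Proof.
case: m => //= -[-> ->].
by rewrite !mul0r addr0.
Qed.

Lemma masked_pullR p q u : masked m u -> masked m (pullR p q u).
Proof.
case: m => //= -[-> ->].
by rewrite !mul0r subr0.
Qed.

Lemma dot_stt_concat (s r : R) u y z : dot u (stt_concat s r y z) =
  dot (pullL s (r - s) u) y + dot (pullR s (r - s) u) z.
Proof. by rewrite -dot_concat subrKC. Qed.

(** The transposes [pullL] and [pullR] of rule (C) peel off the last leaf and pass the rest to the
    shorter prefix. *)
Lemma leaf_linear_time (j : 'I_n) k u : (k <= 2 ^ L)%N -> masked m u ->
  leaf_linear (fun D _ => dot u (time_of L (D j) k)).
Proof.
elim: k u => [|k IH] u kL mu.
  by apply: eq_leaf_linear leaf_linear0 _ => D E; rewrite /dot/= !mulr0 !addr0.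
have mL := masked_pullL (k%:R / 2 ^+ L) (k.+1%:R / 2 ^+ L - k%:R / 2 ^+ L) mu.
have mR := masked_pullR (k%:R / 2 ^+ L) (k.+1%:R / 2 ^+ L - k%:R / 2 ^+ L) mu.
apply: eq_leaf_linear (leaf_linearD 1 (IH _ (ltnW kL) mL)
  (leaf_linear_dot j kL mR masked0)) _ => D E /=.
rewrite dot_stt_concat mul1r; congr (_ + _).
by rewrite [X in _ = _ + X]/dot/= !mul0r !addr0.
Qed.

Lemma leaf_linear_query (j : 'I_n) x u : 0 <= x <= 1 -> masked m u ->
  leaf_linear (fun D E => dot u (query_value x (D j) (E j))).
Proof.
move=> /andP[x0 x1] mu; rewrite /query_value; have [xE|xn0] := eqVneq x 0.
  by apply: eq_leaf_linear leaf_linear0 _ => D E; rewrite /dot/= !mulr0 !addr0.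
have [|kL _] := @leaf_index_itv R L x; first by rewrite lt_neqAle eq_sym xn0 x0.
case: (x == (leaf_index L x).+1%:R / 2 ^+ L); first exact: leaf_linear_time.
set k := leaf_index L x in kL *.
apply: eq_leaf_linear (leaf_linearD 1
  (leaf_linear_time j (ltnW kL) (masked_pullL (k%:R / 2 ^+ L) (x - k%:R / 2 ^+ L) mu))
  (leaf_linear_dot j kL masked0 (masked_pullR (k%:R / 2 ^+ L) (x - k%:R / 2 ^+ L) mu))) _.
move=> D E /=; rewrite dot_stt_concat mul1r; congr (_ + _).
by rewrite [X in _ = X + _]/dot/= !mul0r !add0r.
Qed.

End query_values.

Section vbt_query_value.
Variables (R : realType) (m : mode) (L : nat) (A : R -> 'M[R]_3) (rho : nat -> R).
Hypothesis rootA : m = SpaceTimeTime -> stt_roots L A.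

(** At a dyadic query the interpolation returns the whole leaf, and one more concatenation gives
    [time_of] at [k.+1]. Any other nonzero query lies strictly inside its leaf, where [rho k] is the
    query. *)
Lemma vbt_component_query (g : site -> nat -> R) (t0 t1 r : R) (i : nat) :
  let x := (r - t0) / (t1 - t0) in
    t0 < t1 -> t0 <= r <= t1 -> (i < ncomp m)%N ->
    (forall k, k%:R / 2 ^+ L < x < k.+1%:R / 2 ^+ L -> rho k = x) ->
  vbt_component m g A L t0 t1 r i = Num.sqrt (t1 - t0) * x ^- i *
    dot (coord R i) (query_value L x (vbt_interval g m L)
      (fun k => vbt_partial g m (A (rho k)) L k (rho k))).
Proof.
move=> x t01 /andP[r0 r1] im rhox.
have T0 : 0 < t1 - t0 by rewrite subr_gt0.
rewrite /vbt_component /query_value -/x.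
have -> : (x == 0) = (r == t0).
  by rewrite mulf_eq0 invr_eq0 (gt_eqF T0) orbF subr_eq0.
have [//|rt] := eqVneq r t0.
  by rewrite /dot/= !mulr0 !addr0 mulr0.
have x01 : 0 < x <= 1.
  rewrite ler_pdivrMr// mul1r lerD2r r1 andbT divr_gt0// subr_gt0.
  by rewrite lt_neqAle eq_sym rt.
have [kL /andP[k1 k2]] := leaf_index_itv L x01.
rewrite vbt_queryE// nth_dot mulrA; set k := leaf_index L x in kL k1 k2 *.
congr (_ * _); have mc := masked_coord R im.
(* [time_of] applies the full rule (C) to padded triples, so its absent components need not be 0;
   truncation hides them. *)
rewrite -(dot_trunc _ mc) trunc_concat (vbt_timeE _ _ (ltnW kL)) truncK -trunc_concat.
rewrite (dot_trunc _ mc).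
have AE : m = SpaceTimeTime -> A x *m (A x)^T =
    stt_cov (2 ^- L) (x - k%:R / 2 ^+ L) (k.+1%:R / 2 ^+ L - x).
  by move=> mE; apply: (rootA mE); case/andP: x01 => /ltW -> ->.
have [xE|xn] := eqVneq x (k.+1%:R / 2 ^+ L); last first.
  by rewrite (rhox k)// k1/= lt_neqAle xn.
rewrite [time_of _ _ k.+1]/= -xE [X in vbt_partial _ _ _ _ _ X]xE vbt_partial_end//.
move=> /AE ->; rewrite xE subrr; congr (stt_cov _ _ _).
by rewrite -natr1; field; rewrite expf_neq0.
Qed.

End vbt_query_value.

Section brownian_query_value.
Variable R : realType.
Implicit Types (u y z : R * R * R).

(* Brownian scaling from an interval of length [c ^+ 2] to one of length 1. *)
Definition scale (c : R) y : R * R * R := (y.1.1 / c, y.1.2 / c ^+ 3, y.2 / c ^+ 5).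

Lemma dot_scale c u y : dot u (scale c y) = dot (scale c u) y.
Proof. by rewrite /dot/=; ring. Qed.

Lemma scale_concat (c s r : R) y z : c != 0 ->
  scale c (stt_concat (c ^+ 2 * s) (c ^+ 2 * r) y z) =
  stt_concat s r (scale c y) (scale c z).
Proof.
move=> c0; case: y => -[W H] K; case: z => -[W' H'] K'.
by rewrite /scale/=; congr (_, _, _); field.
Qed.

Lemma levy_var_scale (c h : R) u : c != 0 ->
  levy_var (c ^+ 2 * h) (scale c u) = levy_var h u.
Proof. by move=> c0; rewrite /levy_var/=; field. Qed.

Context d (O : measurableType d) (P : probability O R).
Variables (n : nat) (W : R -> O -> n.-tuple R).
Hypothesis bmW : brownian_motion P W.
Variables (t0 c : R) (L : nat) (rho : nat -> R).
Hypothesis t0_ge0 : 0 <= t0.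
Hypothesis c_gt0 : 0 < c.
Hypothesis rhoI : forall k, k%:R / 2 ^+ L < rho k < k.+1%:R / 2 ^+ L.

Definition path_triple (w : O) (j : 'I_n) (x x' : R) : R * R * R :=
  scale c (levy_triple (fun t => tnth (W t w) j) (t0 + c ^+ 2 * x) (t0 + c ^+ 2 * x')).

Definition path_leaf (w : O) (j : 'I_n) (k : nat) : R * R * R :=
  path_triple w j (k%:R / 2 ^+ L) (k.+1%:R / 2 ^+ L).

Definition path_partial (w : O) (j : 'I_n) (k : nat) : R * R * R :=
  path_triple w j (k%:R / 2 ^+ L) (rho k).

Lemma path_triple_concat w j (x x' x2 : R) : 0 <= x -> x <= x' <= x2 ->
  path_triple w j x x2 =
  stt_concat (x' - x) (x2 - x) (path_triple w j x x') (path_triple w j x' x2).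
Proof.
have c2 : 0 < c ^+ 2 by rewrite exprn_gt0.
move=> x0 /andP[xx' x'x2]; rewrite /path_triple.
rewrite (levy_triple_path_concat bmW j w (r := t0 + c ^+ 2 * x')); last 2 first.
- by rewrite addr_ge0// mulr_ge0// ltW.
- by rewrite !lerD2l !ler_pM2l// xx'.
have E (y z : R) : t0 + c ^+ 2 * z - (t0 + c ^+ 2 * y) = c ^+ 2 * (z - y) by ring.
by rewrite !E scale_concat// gt_eqF.
Qed.

Lemma path_timeE w j k : time_of L (path_leaf w j) k = path_triple w j 0 (k%:R / 2 ^+ L).
Proof.
elim: k => [|k IH].
  by rewrite /= /path_triple mul0r mulr0 addr0 levy_triplexx /scale/= !mul0r.
rewrite /= IH [RHS](@path_triple_concat w j 0 (k%:R / 2 ^+ L))// ?subr0//.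
by apply/andP; split; [rewrite divr_ge0|rewrite ler_pM2r ?invr_gt0 ?exprn_gt0// ler_nat].
Qed.

(** With [r - t0 = c^2 x], undoing the scaling and dividing by [(r - t0)^i] leaves [c x^-i] for each
    component: [c^3 / (c^2 x)] for H and [c^5 / (c^4 x^2)] for K. *)
Lemma levy_component_query w j (r : R) (i : nat) :
  let x := (r - t0) / c ^+ 2 in
    t0 <= r <= t0 + c ^+ 2 -> (i < 3)%N ->
    (forall k, k%:R / 2 ^+ L < x < k.+1%:R / 2 ^+ L -> rho k = x) ->
  levy_component (fun t => tnth (W t w) j) t0 r i =
  c * x ^- i * dot (coord R i) (query_value L x (path_leaf w j) (path_partial w j)).
Proof.
move=> x /andP[r0 r1] i3 rhox.
have c0 : c != 0 by rewrite gt_eqF.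
have c2 : 0 < c ^+ 2 by rewrite exprn_gt0.
have rE : r = t0 + c ^+ 2 * x by rewrite /x; field.
rewrite /query_value.
have [x0|xn0] := eqVneq x 0.
  rewrite rE x0 mulr0 addr0 /levy_component /levyH /levyK eqxx subrr.
  rewrite /dot/= !mulr0 !addr0 mulr0.
  by case: i i3 => [|[|[|i]]].
have x01 : 0 < x <= 1.
  rewrite lt_neqAle eq_sym xn0/= divr_ge0 ?subr_ge0 ?(ltW c2)//=.
  by rewrite ler_pdivrMr// mul1r lerBlDl.
have [_ /andP[k1 k2]] := leaf_index_itv L x01.
set k := leaf_index L x in k1 k2 *.
rewrite (_ : (if _ then _ else _) = path_triple w j 0 x); last first.
  have [->|xn] := eqVneq x (k.+1%:R / 2 ^+ L); first exact: path_timeE.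
  rewrite path_timeE /path_partial (rhox k); last by rewrite k1 lt_neqAle xn.
  rewrite [RHS](@path_triple_concat w j 0 (k%:R / 2 ^+ L)) ?subr0//.
  by rewrite divr_ge0//= ltW.
rewrite /path_triple mulr0 addr0 -rE /dot /scale/=.
have -> : r - t0 = c ^+ 2 * x by rewrite rE; ring.
by case: i i3 => [|[|[|i]]] // _; rewrite /coord /levy_component/= ?expr0 ?expr1; field;
  rewrite ?c0 ?xn0.
Qed.

(** Cutting each leaf at its interior point gives two independent pieces. Transposing rule (C) turns
    [b] and [a] into one vector per piece, and the two variances add up to [joint_var]. *)
Lemma gaussian_path_data (b a : 'I_n -> nat -> R * R * R) :
  gaussian P
    (fun w => \sum_j \sum_(k <- iota 0 (2 ^ L))
       (dot (b j k) (path_leaf w j k) + dot (a j k) (path_partial w j k)))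
    (\sum_j \sum_(k <- iota 0 (2 ^ L))
      joint_var (rho k - k%:R / 2 ^+ L) (k.+1%:R / 2 ^+ L - rho k) (b j k) (a j k)).
Proof.
have c0 : c != 0 by rewrite gt_eqF.
have c2 : 0 < c ^+ 2 by rewrite exprn_gt0.
(* Even indices are leaf ends, odd ones interior points. *)
pose s k : R := if odd k then rho k./2 else k./2%:R / 2 ^+ L.
have s0 k : s k.*2 = k%:R / 2 ^+ L by rewrite /s odd_double doubleK.
have s1 k : s k.*2.+1 = rho k by rewrite /s /= odd_double /= uphalf_double.
have sS k : s k < s k.+1.
  rewrite -(odd_double_half k); case: (odd k); rewrite ?add0n ?add1n -?doubleS ?s0 ?s1;
    by have /andP[] := rhoI k./2.
pose u (j : 'I_n) k : R * R * R := let p := rho k./2 - k./2%:R / 2 ^+ L in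
  let q := k./2.+1%:R / 2 ^+ L - rho k./2 in
  if odd k then pullR p q (b j k./2) else addt (pullL p q (b j k./2)) (a j k./2).
have := @gaussian_levy_triples _ _ _ P n W bmW (2 ^ L).*2
  (fun k => t0 + c ^+ 2 * s k) (fun j k => scale c (u j k)).
have u0 j k : u j k.*2 = addt (pullL (rho k - k%:R / 2 ^+ L)
    (k.+1%:R / 2 ^+ L - rho k) (b j k)) (a j k).
  by rewrite /u odd_double doubleK.
have u1 j k : u j k.*2.+1 = pullR (rho k - k%:R / 2 ^+ L)
    (k.+1%:R / 2 ^+ L - rho k) (b j k).
  by rewrite /u /= odd_double /= uphalf_double.
have iotaE (F : nat -> R) : \sum_(p < (2 ^ L).*2) F p =
    \sum_(k <- iota 0 (2 ^ L)) (F k.*2 + F k.*2.+1).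
  by rewrite -(big_mkord xpredT) /index_iota subn0 sum_iota_double.
have tauB k : t0 + c ^+ 2 * s k.+1 - (t0 + c ^+ 2 * s k) = c ^+ 2 * (s k.+1 - s k).
  by ring.
rewrite (eq_bigr (fun j => \sum_(k <- iota 0 (2 ^ L))
    joint_var (rho k - k%:R / 2 ^+ L) (k.+1%:R / 2 ^+ L - rho k) (b j k) (a j k))); last first.
  move=> j _; rewrite (iotaE (fun p => levy_var
    (t0 + c ^+ 2 * s p.+1 - (t0 + c ^+ 2 * s p)) (scale c (u j p)))).
  apply: eq_bigr => k _; rewrite !tauB !levy_var_scale//.
  by rewrite -doubleS !s0 !s1 u0 u1.
rewrite (_ : (fun w => _) = (fun w => \sum_j \sum_(k <- iota 0 (2 ^ L))
       (dot (b j k) (path_leaf w j k) + dot (a j k) (path_partial w j k)))); last first.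
  apply/funext => w; apply: eq_bigr => j _.
  rewrite (iotaE (fun p => dot (scale c (u j p)) (levy_triple
    (fun t => tnth (W t w) j) (t0 + c ^+ 2 * s p) (t0 + c ^+ 2 * s p.+1)))).
  apply: eq_bigr => k _; rewrite -!dot_scale -doubleS !s0 !s1 u0 u1.
  have /andP[/ltW r1 /ltW r2] := rhoI k.
  rewrite /path_leaf (@path_triple_concat w j _ (rho k)) ?divr_ge0 ?r1//.
  rewrite -/(path_partial w j k) dot_stt_concat.
  rewrite (_ : k.+1%:R / 2 ^+ L - k%:R / 2 ^+ L - _ = k.+1%:R / 2 ^+ L - rho k); last by ring.
  by rewrite dotDl addrAC.
apply; last by move=> k; rewrite ltrD2l ltr_pM2l.
by rewrite (s0 0%N) mul0r mulr0 addr0.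
Qed.

End brownian_query_value.

(** The queries are nondecreasing, so a point of [V] found in a shorter range remains in the longer
    one. *)
Lemma separated_queries (R : realType) (N : nat) (V : set R) (r : 'I_N -> R) :
    (forall n n' : 'I_N, n' = n.+1 :> nat ->
      r n <= r n' /\ V `&` `[r n, r n'] !=set0) ->
  forall n n' : 'I_N, (n < n')%N -> V `&` `[r n, r n'] !=set0.
Proof.
move=> sep n [i iN] /= ni.
elim: i iN ni => // i IH iN; rewrite ltnS leq_eqVlt => /orP[/eqP ni|ni].
  by have [] := sep n (Ordinal iN); first by rewrite /= ni.
have [v [Vv]] := IH (ltnW iN) ni; rewrite /= in_itv/= => /andP[nv vi].
have [le_r _] := sep (Ordinal (ltnW iN)) (Ordinal iN) erefl.
by exists v; split=> //=; rewrite in_itv/= nv (le_trans vi).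
Qed.

(** Two distinct indices with queries inside the open leaf [k] would enclose a dyadic time [i / 2^L]
    with [k < i < k.+1]. Hence there is at most one, and [rho] can select it. *)
Lemma leaf_points (R : realType) (L N : nat) (t0 t1 : R) (r : 'I_N -> R) :
    t0 < t1 ->
    (forall n n' : 'I_N, n' = n.+1 :> nat ->
      r n <= r n' /\ dyadic_times L t0 t1 `&` `[r n, r n'] !=set0) ->
  exists rho : nat -> R, (forall k, k%:R / 2 ^+ L < rho k < k.+1%:R / 2 ^+ L) /\
    forall n k, k%:R / 2 ^+ L < (r n - t0) / (t1 - t0) < k.+1%:R / 2 ^+ L ->
      rho k = (r n - t0) / (t1 - t0).
Proof.
move=> t01 /separated_queries sep; have T0 : 0 < t1 - t0 by rewrite subr_gt0.
have h0 : 0 < 2 ^+ L :> R by rewrite exprn_gt0.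
pose x n := (r n - t0) / (t1 - t0).
pose inside k n := k%:R / 2 ^+ L < x n < k.+1%:R / 2 ^+ L.
have lt_inside k n n' : inside k n -> inside k n' -> ~~ (n < n')%N.
  move=> /andP[kn _] /andP[_ nk]; apply/negP => /sep[_ [[i _ <-]]].
  rewrite /= in_itv/= mulrC -lerBlDl -ler_pdivrMr// -/(x n) => /andP[ni].
  rewrite -lerBrDl -ler_pdivlMr// -/(x n') => /le_lt_trans/(_ nk).
  have := lt_le_trans kn ni.
  by rewrite !ltr_pM2r ?invr_gt0// !ltr_nat ltnS => /leq_trans h /h; rewrite ltnn.
have inside_inj k n n' : inside k n -> inside k n' -> n = n'.
  move=> kn kn'; apply/val_inj/eqP; rewrite eqn_leq.
  by rewrite leqNgt (lt_inside k)//= leqNgt (lt_inside k).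
(* Without a query inside the leaf, the midpoint keeps [rho k] strictly interior. *)
exists (fun k => if [pick n | inside k n] is Some n then x n
  else (k%:R / 2 ^+ L + k.+1%:R / 2 ^+ L) / 2); split=> [k|n k kn].
  case: pickP => [n //|_].
  have : k%:R / 2 ^+ L < k.+1%:R / 2 ^+ L :> R.
    by rewrite ltr_pM2r ?invr_gt0// ltr_nat.
  by move=> kk; apply/andP; split; lra.
case: pickP => [n' kn'|/(_ n)]; last by rewrite [inside _ _]kn.
by rewrite (inside_inj k n n').
Qed.

Theorem theorem4p2 (R : realType) (m : mode) (L d N : nat) (t0 t1 : R)
    (dW : measure_display) (OW : measurableType dW) (PW : probability OW R)
    (W : R -> OW -> d.-tuple R)
    (dV : measure_display) (OV : measurableType dV) (PV : probability OV R)
    (xi : site -> nat -> OV -> d.-tuple R) (A : R -> 'M[R]_3)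
    (r : 'I_N -> R) :
  0 <= t0 -> t0 < t1 ->
  brownian_motion PW W ->
  vbt_noise m L PV xi ->
  (m = SpaceTimeTime -> stt_roots L A) ->
  (forall n, t0 <= r n <= t1) ->
  (forall n n' : 'I_N, n' = n.+1 :> nat ->
     r n <= r n' /\ dyadic_times L t0 t1 `&` `[r n, r n'] !=set0) ->
  eq_distribution PV PW
    (fun w => [tuple vbt_process m xi A L t0 t1 (r n) w | n < N])
    (fun w => [tuple levy_process m W t0 (r n) w | n < N]).

Proof.
move=> t0_ge0 t01 bmW nxi rootA r01 sep.
have T0 : 0 < t1 - t0 by rewrite subr_gt0.
pose c := Num.sqrt (t1 - t0).
have c2 : c ^+ 2 = t1 - t0 by rewrite sqr_sqrtr// ltW.
have c0 : 0 < c by rewrite sqrtr_gt0.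
have [rho [rhoI rhox]] := leaf_points t01 sep.
pose x n := (r n - t0) / (t1 - t0).
have x01 n : 0 <= x n <= 1.
  have /andP[r0 r1] := r01 n.
  by rewrite divr_ge0 ?subr_ge0 ?(ltW t01)//= ler_pdivrMr// mul1r lerD2r.
pose g w j (s : site) (i : nat) : R := tnth (xi s i w) j.
pose D1 w j := vbt_interval (g w j) m L.
pose E1 w j k := vbt_partial (g w j) m (A (rho k)) L k (rho k).
pose D2 := path_leaf W t0 c L.
pose E2 := path_partial W t0 c L rho.
pose F (a : 'I_N * 'I_(ncomp m) * 'I_d) (D E : 'I_d -> nat -> R * R * R) : R :=
  c * x a.1.1 ^- a.1.2 *
  dot (coord R a.1.2) (query_value L (x a.1.1) (D a.2) (E a.2)).
pose X1 a w := F a (D1 w) (E1 w).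
pose X2 a w := F a (D2 w) (E2 w).
have -> : (fun w => [tuple vbt_process m xi A L t0 t1 (r n) w | n < N]) =
    (fun w => nested_tuple (X1 ^~ w)).
  apply/funext => w; apply/eq_mktuple => n; apply/eq_mktuple => i.
  apply/eq_mktuple => j; apply: vbt_component_query => //; exact: rhox.
have -> : (fun w => [tuple levy_process m W t0 (r n) w | n < N]) =
    (fun w => nested_tuple (X2 ^~ w)).
  apply/funext => w; apply/eq_mktuple => n; apply/eq_mktuple => i.
  apply/eq_mktuple => j; rewrite /X2 /F /x -c2.
  apply: (levy_component_query bmW) => //.
  - by rewrite c2 subrKC.
  - by apply: leq_trans (ltn_ord i) _; case: (m).
  - by rewrite c2; exact: rhox.
have lin (l : seq ('I_N * 'I_(ncomp m) * 'I_d * R)) :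
    leaf_linear m L (fun D E => \sum_(a <- l) a.2 * F a.1 D E).
  elim: l => [|a l IH].
    by apply: eq_leaf_linear (leaf_linear0 _ _ _ _) _ => D E; rewrite big_nil.
  have Fa := leaf_linear_query L a.1.2 (x01 a.1.1.1) (masked_coord R (ltn_ord a.1.1.2)).
  apply: eq_leaf_linear (leaf_linearD (a.2 * (c * x a.1.1.1 ^- a.1.1.2)) Fa IH) _.
  by move=> D E; rewrite big_cons /F !mulrA.
have AE k : (k < 2 ^ L)%N -> m = SpaceTimeTime -> A (rho k) *m (A (rho k))^T =
    stt_cov (2 ^- L) (rho k - k%:R / 2 ^+ L) (k.+1%:R / 2 ^+ L - rho k).
  move=> kL mE; have /andP[k1 k2] := rhoI k.
  (* The hypothesis on square roots speaks of the leaf found by [leaf_index]; it has to be leaf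
     [k]. *)
  have kE : leaf_index L (rho k) = k by apply: leaf_indexE; rewrite k1 ltW.
  have := rootA mE (rho k); rewrite kE; apply; apply/andP; split.
    by apply: ltW; apply: le_lt_trans k1; rewrite divr_ge0.
  apply: ltW; apply: lt_le_trans k2 _.
  by rewrite ler_pdivrMr ?exprn_gt0// mul1r -natrX ler_nat.
(* The variance depends only on [rho] and the coefficients, so one [v] fits both laws. *)
have gauss l : exists v, gaussian PV (lincomb X1 l) v /\ gaussian PW (lincomb X2 l) v.
  have [b [a [mb ma E]]] := lin l.
  exists (\sum_j \sum_(k <- iota 0 (2 ^ L))
      joint_var (rho k - k%:R / 2 ^+ L) (k.+1%:R / 2 ^+ L - rho k) (b j k) (a j k)).
  split.
    rewrite (_ : lincomb X1 l = (fun w => \sum_j \sum_(k <- iota 0 (2 ^ L))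
      (dot (b j k) (D1 w j k) + dot (a j k) (E1 w j k)))).
      exact: gaussian_vbt_data.
    by apply/funext => w; rewrite -E.
  rewrite (_ : lincomb X2 l = (fun w => \sum_j \sum_(k <- iota 0 (2 ^ L))
      (dot (b j k) (D2 w j k) + dot (a j k) (E2 w j k)))).
    exact: gaussian_path_data.
  by apply/funext => w; rewrite -E.
(* A combination with one term is a single component, and its Gaussianity includes its
   measurability. *)
have lincomb1 (O : Type) (X : 'I_N * 'I_(ncomp m) * 'I_d -> O -> R) a :
    lincomb X [:: (a, 1)] = X a.
  by apply/funext => w; rewrite /lincomb big_seq1 mul1r.
apply: eq_distribution_lincomb => [a|a|l th].
- by have [v [[+ _] _]] := gauss [:: (a, 1)]; rewrite lincomb1.
- by have [v [_ [+ _]]] := gauss [:: (a, 1)]; rewrite lincomb1.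
- by have [v [[_ ->] [_ ->]]] := gauss l.
Qed.
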